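(* Let $G=(V,E)$ be a finite simple graph with a fixed total order on $V$, and let $\lambda$ be a partition. Write $\overline{X}_G=\sum_{\mu}c_\mu\,\overline{p}_\mu$ for the unique expansion of $\overline{X}_G$ in the $\overline{p}$-basis (sum over all partitions $\mu$). Then $(-1)^{|\lambda|-\ell(\lambda)}c_\lambda$ equals the number of families $(M_k)_{k\ge1}$ satisfying: (i) for each odd $k$, $M_k$ is a set of $i_k(\lambda)$ distinct Lyndon heaps on $G$, each of size $k$; (ii) for each even $k$, $M_k$ is a multiset of $i_k(\lambda)$ Lyndon heaps on $G$ (repetition allowed), each of size $k/2^j$ for some integer $j\ge 0$ such that $k/2^j$ is even; (iii) every vertex of $G$ is used by at least one Lyndon heap appearing in some $M_k$. Equivalently, $$(-1)^{|\lambda|-\ell(\lambda)}c_\lambda=\sum_{W\subseteq V}(-1)^{|V\setminus W|}\prod_{k\text{ odd}}\binom{|\mathcal{L}_{G|_W}(k)|}{i_k(\lambda)}\prod_{k\text{ even}}\left(\!\!\binom{\sum_{j\ge0,\ k/2^j\text{ even}}|\mathcal{L}_{G|_W}(k/2^j)|}{i_k(\lambda)}\!\!\right),$$ where $\left(\!\binom{n}{r}\!\right)=\binom{n+r-1}{r}$. In particular this coefficient is a nonnegative integer.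
   Context: Graphs are finite, simple, unweighted. $G|_W$ is the induced subgraph on $W$. For a partition $\lambda$, $\ell(\lambda)$ is its number of parts, $|\lambda|$ the sum of parts, and $i_k(\lambda)$ the number of parts equal to $k$. Kromatic symmetric function: a proper set coloring of $G$ is a map $\kappa$ from $V$ to nonempty subsets of $\mathbb{Z}_{>0}$ such that adjacent vertices receive disjoint sets; $\overline{X}_G(x_1,x_2,\dots)=\sum_\kappa\prod_{v\in V}\prod_{i\in\kappa(v)}x_i$, summed over proper set colorings. The $K$-theoretic power sums: $1+\overline{p}_k=\prod_{i\ge1}(1+x_i^k)$, $\overline{p}_\lambda=\overline{p}_{\lambda_1}\cdots\overline{p}_{\lambda_{\ell(\lambda)}}$; every symmetric power series has a unique expansion as a (possibly infinite) linear combination of the $\overline{p}_\lambda$. Heaps: fix a total order on $V$. A heap on $G$ is an equivalence class of finite words over the alphabet $V$ under the equivalence generated by $\cdots uv\cdots\sim\cdots vu\cdots$ whenever $u\neq v$ are nonadjacent in $G$. Its size is the word length; a vertex is used by a heap if it occurs as a letter. Composition $H_1\circ H_2$ is the class of the concatenation of representatives. Occurrences of letters are called pieces; in a representative $a_1\cdots a_m$, set piece $i\prec$ piece $j$ if $i<j$ and $a_i,a_j$ are equal or adjacent in $G$; the transitive closure is a partial order on pieces, independent of the representative. A pyramid is a heap with exactly one minimal piece. A heap is periodic if it equals $K\circ\cdots\circ K$ ($m>1$ times) for some heap $K$, aperiodic otherwise. Rotation: for a piece $p$ of a heap $H$, the pieces $\succeq p$ form a heap $V_p$ with $H=U\circ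 V_p$; set $A_p(H)=V_p\circ U$. Iterating $A_p$ eventually stabilizes at a pyramid $A_p^\infty(H)$ with unique minimal piece $p$. Two pyramids are rotation-equivalent if one is $A_p^\infty$ of the other for some piece $p$; this is an equivalence relation, and within a class either all pyramids are periodic or all are aperiodic. The standard word of a heap is the lexicographically maximal word in its class. A Lyndon heap is an aperiodic pyramid whose standard word is lexicographically minimal among the standard words of the pyramids in its rotation class. $\mathcal{L}_G(k)$ denotes the set of Lyndon heaps of size $k$ on $G$. *)

(* Defs.v *)
From Stdlib Require Import ClassicalDescription.
From mathcomp Require Import all_boot all_algebra.
Set Implicit Arguments. Unset Strict Implicit. Unset Printing Implicit Defensive.
Import GRing.Theory Num.Theory.

Definition pbool (P : Prop) : bool :=
  if excluded_middle_informative P then true else false.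

(* A partition: weakly decreasing sequence of positive integers.
   |lam| = sumn lam, l(lam) = size lam, i_k(lam) = count_mem k lam. *)
Definition is_partition (l : seq nat) : bool :=
  sorted geq l && all (fun x => 0 < x) l.

(* ---------- Symmetric power series (coefficientwise) ----------
   A monomial x_1^{a_0} x_2^{a_1} ... is encoded by a : seq nat
   (exponent of x_{i+1} is nth 0 a i; trailing zeros are harmless). *)

(* [x^a] Kromatic symmetric function of (T, e): number of proper set
   colorings.  Color i : 'I_(size a) stands for the positive integer i+1;
   colors > size a have exponent 0 in x^a so cannot be used. *)
Definition kromatic_coef (T : finType) (e : rel T) (a : seq nat) : nat :=
  #|[set kap : {ffun T -> {set 'I_(size a)}} |
     [&& [forall v, kap v != set0],
         [forall v, forall w, e v w ==> [disjoint kap v & kap w]] &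
         [forall i : 'I_(size a), #|[set v | i \in kap v]| == nth 0 a i]]]|.

(* [x^a] pbar_mu, where 1 + pbar_k = prod_i (1 + x_i^k), i.e.
   pbar_k = sum over nonempty finite sets S of positive integers of
   prod_{i in S} x_i^k; pbar_mu = prod_j pbar_{mu_j}.  Expanding the
   product, [x^a] pbar_mu counts tuples (S_j)_j of nonempty sets with
   sum_j mu_j [i in S_j] = a_i for all i. *)
Definition pbar_coef (mu : seq nat) (a : seq nat) : nat :=
  #|[set S : {ffun 'I_(size mu) -> {set 'I_(size a)}} |
     [forall j, S j != set0] &&
     [forall i : 'I_(size a),
        (\sum_(j < size mu | i \in S j) nth 0 mu j)%N == nth 0 a i]]|.

Definition partition_sum (f : seq nat -> rat) (s : rat) : Prop :=
  exists F : seq (seq nat),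
    [/\ uniq F, all is_partition F,
        (forall mu, is_partition mu -> mu \notin F -> f mu = 0%R) &
        (\sum_(mu <- F) f mu)%R = s].

Definition pbar_expansion (T : finType) (e : rel T) (c : seq nat -> rat) : Prop :=
  forall a : seq nat,
    partition_sum (fun mu => c mu * (pbar_coef mu a)%:R)%R (kromatic_coef e a)%:R%R.

(* ---------- Heaps ----------
   Graph (T, e); total order on T given by an injective rank r : T -> nat.
   A heap is represented by a word; heaps of size k are equivalence
   classes of k.-tuples. *)
Section Heaps.
Variables (T : finType) (e : rel T) (r : T -> nat).

Fixpoint lexle (s t : seq T) : bool :=
  match s, t with
  | [::], _ => true
  | _ :: _, [::] => false
  | a :: s', b :: t' => (r a < r b) || ((a == b) && lexle s' t')
  end.

Definition can_swap (i : nat) (s : seq T) : bool :=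
  if drop i s is a :: b :: _ then (a != b) && ~~ e a b else false.
Definition swap_at (i : nat) (s : seq T) : seq T :=
  if drop i s is a :: b :: s' then take i s ++ b :: a :: s' else s.
Definition comm_step (s t : seq T) : bool :=
  has (fun i => can_swap i s && (t == swap_at i s)) (iota 0 (size s)).

Definition heap_equiv (s t : seq T) : bool :=
  (size t == size s) &&
  connect [rel x y : (size s).-tuple T | comm_step x y]
          (in_tuple s) (insubd (in_tuple s) t).

Definition standard (s : seq T) : bool :=
  [forall t : (size s).-tuple T, heap_equiv s t ==> lexle t s].

Definition prec k (w : k.-tuple T) : rel 'I_k :=
  fun i j => (i < j) && ((tnth w i == tnth w j) || e (tnth w i) (tnth w j)).
Definition piece_le k (w : k.-tuple T) : rel 'I_k := connect (prec w).
Definition minimal_piece k (w : k.-tuple T) (j : 'I_k) : bool :=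
  [forall i, (i != j) ==> ~~ piece_le w i j].
Definition pyramid k (w : k.-tuple T) : bool :=
  #|[set j | minimal_piece w j]| == 1.

Definition periodic k (w : k.-tuple T) : bool :=
  [exists m : 'I_k.+1, (1 < m) &&
     [exists u : (k %/ m).-tuple T, heap_equiv w (flatten (nseq m (u : seq T)))]].

Definition rotA k (w : k.-tuple T) (p : 'I_k) : k.-tuple T :=
  insubd w ([seq tnth w j | j <- enum 'I_k & piece_le w p j] ++
            [seq tnth w j | j <- enum 'I_k & ~~ piece_le w p j]).

(* track the piece p: after A_p it becomes the first letter *)
Definition rotstep k (x : k.-tuple T * 'I_k) : k.-tuple T * 'I_k :=
  (rotA x.1 x.2, insubd x.2 0).

(* Q is (the heap) A_p^oo(P) for some piece p of P: some iterate of A_p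
   is stable under A_p and equals Q *)
Definition rot_inf_rel k (P Q : k.-tuple T) : Prop :=
  exists (p : 'I_k) (m : nat),
    let x := iter m (@rotstep k) (P, p) in
    heap_equiv (rotA x.1 x.2) x.1 && heap_equiv x.1 Q.

Definition rot_equiv k (P Q : k.-tuple T) : Prop :=
  rot_inf_rel P Q \/ rot_inf_rel Q P.

Definition lyndon k (w : k.-tuple T) : Prop :=
  [/\ pyramid w, ~~ periodic w &
      forall Q : k.-tuple T, standard Q -> pyramid Q -> rot_equiv w Q ->
        lexle w Q].

(* Lyndon heaps of size k, identified with their standard words *)
Definition lyndon_set k : {set k.-tuple T} :=
  [set w : k.-tuple T | standard w && pbool (lyndon w)].

End Heaps.

Definition induced_lyndon_num (T : finType) (e : rel T) (r : T -> nat)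
    (W : {set T}) (k : nat) : nat :=
  #|lyndon_set (T := {x : T | x \in W})
       (fun x y => e (val x) (val y)) (fun x => r (val x)) k|.

(* Families (M_k)_{1 <= k <= |lam|} (all M_k with k > |lam| are empty since
   i_k(lam) = 0); M_k is a multiset of (standard words of) heaps of size
   <= |lam|, given by multiplicities (bounded by l(lam) >= i_k(lam)). *)
Definition family_count (T : finType) (e : rel T) (r : T -> nat)
    (lam : seq nat) : nat :=
  let N := sumn lam in
  #|[set F : {ffun 'I_N.+1 -> {ffun {h : 'I_N.+1 & h.-tuple T} -> 'I_(size lam).+1}} |
     [&& [forall k : 'I_N.+1,
            (\sum_(x : {h : 'I_N.+1 & h.-tuple T}) (F k x : nat))%N
              == count_mem (k : nat) lam],
         [forall k : 'I_N.+1, forall x : {h : 'I_N.+1 & h.-tuple T},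
            (0 < F k x) ==>
            [&& (tagged x \in lyndon_set e r (tag x)),
                odd k ==> ((tag x == k :> nat) && (F k x <= 1)) &
                ~~ odd k ==> [exists j : 'I_k.+1,
                                 ((tag x * 2 ^ j)%N == k) && ~~ odd (tag x)]]] &
         [forall v : T, exists k : 'I_N.+1, exists x : {h : 'I_N.+1 & h.-tuple T},
            (0 < F k x) && (v \in (tagged x : seq T))]]]|.

Definition multichoose (n m : nat) : nat := 'C(n + m - 1, m).

Definition kromatic_formula (T : finType) (e : rel T) (r : T -> nat)
    (lam : seq nat) : rat :=
  let N := sumn lam in
  let Lnum W k := induced_lyndon_num e r W k in
  (\sum_(W : {set T})
    (-1) ^+ #|~: W| *
    ((\prod_(1 <= k < N.+1 | odd k) ('C(Lnum W k, count_mem k lam))%:R) *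
     (\prod_(1 <= k < N.+1 | ~~ odd k)
        (multichoose (\sum_(0 <= j < k | 2 ^ j.+1 %| k) Lnum W (k %/ 2 ^ j))%N
                     (count_mem k lam))%:R)))%R.

(* Main.v *)
(** Writing [W] for the set of vertices that receive a nonempty set of colors,
inclusion-exclusion gives [Xbar_G = \sum_W (-1)^|V \ W| \prod_i I_W(x_i)], where
[I_W] is the independence polynomial of the induced subgraph on [W].
By Cartier-Foata, [I_W(-x)] is the inverse of the generating function [H] of heaps.
Cutting a heap at a marked piece yields [x H' = P H], where [P] counts pyramids.
A pyramid is a power of a unique aperiodic one, and the rotation class of an
aperiodic pyramid of size [d] has exactly [d] elements, one of them Lyndon, so that
[x^n] in [P] is the sum over [d | n] of [d |L(d)|].  Comparing logarithmic derivatives,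
[I_W(-x) = \prod_k (1 - x^k)^|L(k)|].  Finally [1 - x^k = \prod_j (1 + x^(k 2^j))^-1]
and [\prod_i (1 + x_i^k) = 1 + pbar_k], so that [\prod_i I_W(x_i)] becomes a product of
integral powers of the [1 + pbar_k], which is expanded by the binomial series.

Heaps are handled through their projections on pairs of equal or adjacent letters:
two words represent the same heap iff all these projections agree, and a word
represents a left factor of another one iff its projections are prefixes. *)

From Stdlib Require Import ClassicalDescription.
From mathcomp Require Import mpoly.
Require Import Defs.
From mathcomp Require Import all_boot all_algebra.
From mathcomp Require Import zify ring.
Import GRing.Theory Num.Theory.
Set Implicit Arguments. Unset Strict Implicit. Unset Printing Implicit Defensive.

(** * Words *)

Section Words.
Variable X : eqType.
Implicit Types s t u v : seq X.

(** A concatenation of standard words need not be standard, so composition is handled by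
    projections: they commute with concatenation and turn divisibility, conjugacy and commutation of
    heaps into word equations for each pair of letters. Connectedness of the support glues the pairs
    together: it forces commuting heaps to have proportional letter counts, hence a common root, and
    this is why the rotations of an aperiodic pyramid are distinct. A piece is tracked by its letter
    and the number of equal letters before it, which commutations preserve, while they change its
    index. Power series become polynomials modulo a degree; as [1 + x^k] has no polynomial inverse,
    factors with negative exponent stay on the other side of the identity until [pbar_k] is
    substituted. For odd [k], [1 - (-x)^k] is already [1 + x^k]; for even [k] it needs the dyadic
    product of inverses. Hence sets for odd [k], multisets and a sign for even [k]. Families are
    counted by the same sieve over [W] as colorings. *)

Lemma prefix_total u v w : prefix u w -> prefix v w ->
  size u <= size v -> prefix u v.
Proof.
move=> /prefixP[u' ->] /prefixP[v'] E le.
apply/prefixP; exists (drop (size u) v).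
have := congr1 (take (size u)) E.
by rewrite take_size_cat // takel_cat // => {1}->; rewrite cat_take_drop.
Qed.

Lemma catI_size u u' v v' : u ++ v = u' ++ v' -> size u = size u' -> u = u' /\ v = v'.
Proof. by move=> /eqP; move=> + E; rewrite eqseq_cat // => /andP[/eqP-> /eqP->]. Qed.

Lemma catI_sizer u u' v v' : u ++ v = u' ++ v' -> size v = size v' -> u = u' /\ v = v'.
Proof.
move=> E Ev; apply: catI_size => //.
by move/(congr1 size): E; rewrite !size_cat Ev => /addIn.
Qed.

Definition wpow (s : seq X) m := flatten (nseq m s).

Lemma wpowS s m : wpow s m.+1 = s ++ wpow s m. Proof. by []. Qed.

Lemma wpowD s m n : wpow s (m + n) = wpow s m ++ wpow s n.
Proof. by rewrite /wpow nseqD flatten_cat. Qed.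

Lemma wpow1 s : wpow s 1 = s. Proof. by rewrite /wpow /= cats0. Qed.

Lemma wpowSr s m : wpow s m.+1 = wpow s m ++ s.
Proof. by rewrite -addn1 wpowD wpow1. Qed.

Lemma wpowM s m n : wpow (wpow s m) n = wpow s (m * n).
Proof. by elim: n => [|n IH]; rewrite ?muln0 // wpowS IH mulnS wpowD. Qed.

Lemma size_wpow s m : size (wpow s m) = m * size s.
Proof. by elim: m => // m IH; rewrite wpowS size_cat IH mulSn. Qed.

Lemma count_wpow (p : pred X) s m : count p (wpow s m) = m * count p s.
Proof. by elim: m => // m IH; rewrite wpowS count_cat IH mulSn. Qed.

Lemma filter_wpow (p : pred X) s m : filter p (wpow s m) = wpow (filter p s) m.
Proof. by elim: m => // m IH; rewrite wpowS filter_cat IH. Qed.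

Lemma mem_wpow s m x : x \in wpow s m -> x \in s.
Proof. by elim: m => // m IH; rewrite wpowS mem_cat => /orP[]. Qed.

Lemma mem_wpowE s m x : 0 < m -> (x \in wpow s m) = (x \in s).
Proof.
by case: m => // m _; apply/idP/idP; [exact: mem_wpow | rewrite wpowS mem_cat => ->].
Qed.

Lemma prefix_wpow s m n : m <= n -> prefix (wpow s m) (wpow s n).
Proof. by move=> /subnKC <-; rewrite wpowD prefix_prefix. Qed.

Lemma wpow_conj s u v m : s ++ u = u ++ v -> wpow s m ++ u = u ++ wpow v m.
Proof.
move=> E; elim: m => [|m IH]; first by rewrite cats0.
by rewrite wpowSr -catA E catA IH -catA -wpowSr.
Qed.

(** Both [u] and the power of [s] are prefixes of the word [wpow s m ++ u = u ++ wpow v m]. *)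
Lemma conj_prefix_wpow s u v m : s ++ u = u ++ v -> size u <= m * size s ->
  prefix u (wpow s m).
Proof.
move=> /(wpow_conj m) E le.
apply: (@prefix_total _ _ (wpow s m ++ u)); rewrite ?prefix_prefix ?size_wpow //.
by rewrite E prefix_prefix.
Qed.

(** [s ++ t] and [t ++ s] are prefixes of equal length of the doubled common power. *)
Lemma eq_wpow_comm s t m n : 0 < m -> 0 < n -> wpow s m = wpow t n ->
  s ++ t = t ++ s.
Proof.
move=> m0 n0 E; have h (u v : seq X) p q : 0 < p -> 0 < q -> wpow u p = wpow v q ->
    prefix (u ++ v) (wpow u (p + p)).
  case: p => // p _; case: q => // q _ E'.
  rewrite addnS wpowS wpowD E' wpowS -!catA catA; exact: prefix_prefix.
have h1 := h s t m n m0 n0 E; have h2 := h t s n m n0 m0 (esym E).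
rewrite wpowD -E -wpowD in h2.
have /(prefix_total h1 h2) : size (s ++ t) <= size (t ++ s) by rewrite !size_cat addnC.
by rewrite prefixE => /eqP <-; rewrite take_oversize // !size_cat addnC.
Qed.

(** The powers commute as well, and these two exponents give them the same length. This yields
    proportional letter counts without a common root. *)
Lemma comm_wpow s t : s ++ t = t ++ s -> wpow s (size t) = wpow t (size s).
Proof.
move=> E.
have c m n : wpow s m ++ wpow t n = wpow t n ++ wpow s m.
  apply: wpow_conj; elim: n => [|n IH]; first by rewrite cats0.
  by rewrite wpowS catA E -catA IH catA.
have [] := catI_size (c (size t) (size s)); last by [].
by rewrite !size_wpow mulnC.
Qed.

(** Suffixes of one word are nested. Since [v] begins with a letter satisfying [p], a strictly
    shorter suffix would have fewer such letters; so [v] is a suffix of [v'], and every other count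
    is monotone too. *)
Lemma suffix_count_le (p q : pred X) u v u' v' :
  u ++ v = u' ++ v' -> (if v is a :: _ then p a else false) ->
  count p v <= count p v' -> count q v <= count q v'.
Proof.
move=> E hv le; have [lt|le'] := ltnP (size v') (size v).
  case: v hv E le lt => // a v pa E le lt; exfalso.
  have /(congr1 (drop (size (u ++ [:: a])))) : (u ++ [:: a]) ++ v = u' ++ v' by rewrite -catA.
  have lu : size u < size u'.
    by move/(congr1 size): E; move: lt; rewrite !size_cat /=; lia.
  rewrite drop_size_cat // drop_cat size_cat /= addn1.
  case: (ltngtP (size u).+1 (size u')) lu => [lu _ Ev|lu|<- _]; last first.
  - by rewrite subnn drop0 => Ev; move: le; rewrite Ev /= pa add1n ltnn.
  - by move=> h; lia.
  - by move: le; rewrite Ev /= count_cat pa; lia.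
have : v = drop (size u - size u') v'.
  move/(congr1 (drop (size u))): E; rewrite drop_size_cat // drop_cat.
  case: ltnP => // h E; move/(congr1 size): E.
  by rewrite size_cat size_drop => E; move: le'; lia.
by move=> ->; rewrite -{2}(cat_take_drop (size u - size u') v') count_cat leq_addl.
Qed.

End Words.

(** * Heaps as families of projections *)

Section Traces.
Variables (T : finType) (e : rel T).
Hypothesis e_sym : symmetric e.
Implicit Types (s t u v w x y z : seq T) (a b c : T).

Definition dep a b := (a == b) || e a b.

Lemma dep_refl a : dep a a. Proof. by rewrite /dep eqxx. Qed.
Lemma dep_sym : symmetric dep.
Proof. by move=> a b; rewrite /dep eq_sym e_sym. Qed.

Definition prj a b s := filter (pred2 a b) s.

Lemma prj_cat a b s t : prj a b (s ++ t) = prj a b s ++ prj a b t.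
Proof. exact: filter_cat. Qed.

Lemma prj_wpow a b s m : prj a b (wpow s m) = wpow (prj a b s) m.
Proof. exact: filter_wpow. Qed.

Lemma count_prjl a b s : count_mem a (prj a b s) = count_mem a s.
Proof.
rewrite count_filter; apply: eq_count => c /=.
by case: eqP => //= ->; rewrite eqxx.
Qed.

Lemma count_prjr a b s : count_mem b (prj a b s) = count_mem b s.
Proof.
rewrite count_filter; apply: eq_count => c /=.
by rewrite andb_orr; case: (c == b); rewrite ?orbT.
Qed.

Lemma size_prj a b s : size (prj a b s) = count_mem a s + (a != b) * count_mem b s.
Proof.
rewrite size_filter; case: eqP => [->|ab] /=.
  by rewrite mul0n addn0; apply: eq_count => c /=; rewrite orbb.
rewrite mul1n; elim: s => //= c s ->; case: (eqVneq c a) => [->|_] /=; last by lia.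
by case: eqP => // ? /=; lia.
Qed.

Lemma size_prj_le a b s t : (forall c, count_mem c s <= count_mem c t) ->
  size (prj a b s) <= size (prj a b t).
Proof. by move=> h; rewrite !size_prj leq_add // leq_mul. Qed.

(* Two words represent the same heap iff they have the same projections on all pairs of equal or adjacent letters. *)
Definition heq s t := [forall a, forall b, dep a b ==> (prj a b s == prj a b t)].

Lemma heqP s t : reflect (forall a b, dep a b -> prj a b s = prj a b t) (heq s t).
Proof.
apply: (iffP forallP) => [h a b ab|h a].
  by have /forallP/(_ b)/implyP/(_ ab)/eqP := h a.
by apply/forallP => b; apply/implyP => ab; apply/eqP; exact: h.
Qed.

Lemma heq_refl s : heq s s. Proof. exact/heqP. Qed.
Hint Resolve heq_refl : core.

Lemma heq_sym s t : heq s t = heq t s.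
Proof. by apply/heqP/heqP => h a b ab; rewrite h. Qed.

Lemma heqS s t : heq s t -> heq t s. Proof. by rewrite heq_sym. Qed.

Lemma heq_trans t s u : heq s t -> heq t u -> heq s u.
Proof. by move=> /heqP h1 /heqP h2; apply/heqP => a b ab; rewrite h1 ?h2. Qed.

Lemma heq_cat s s' t t' : heq s s' -> heq t t' -> heq (s ++ t) (s' ++ t').
Proof.
by move=> /heqP h1 /heqP h2; apply/heqP => a b ab; rewrite !prj_cat h1 ?h2.
Qed.

Lemma heq_catI u s t : heq (u ++ s) (u ++ t) = heq s t.
Proof.
apply/idP/idP; last exact: heq_cat.
by move=> /heqP h; apply/heqP => a b /h; rewrite !prj_cat => /catI_size[].
Qed.

Lemma heq_cons a s t : heq (a :: s) (a :: t) = heq s t.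
Proof. exact: (heq_catI [:: a]). Qed.

Lemma heq_Icat u s t : heq (s ++ u) (t ++ u) = heq s t.
Proof.
apply/idP/idP; last by move=> h; exact: heq_cat.
by move=> /heqP h; apply/heqP => a b /h; rewrite !prj_cat => /catI_sizer[].
Qed.

Lemma heq_count s t : heq s t -> forall a, count_mem a s = count_mem a t.
Proof. by move=> /heqP h a; rewrite -(count_prjl a a s) h ?dep_refl // count_prjl. Qed.

Lemma heq_perm s t : heq s t -> perm_eq s t.
Proof. by move=> h; apply/allP => a _; apply/eqP; exact: heq_count. Qed.

Lemma heq_size s t : heq s t -> size s = size t.
Proof. by move/heq_perm/perm_size. Qed.

Lemma heq_mem s t : heq s t -> s =i t.
Proof. by move/heq_perm/perm_mem. Qed.

Lemma heq_wpow s t m : heq s t -> heq (wpow s m) (wpow t m).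
Proof. by move=> h; elim: m => // m IH; rewrite !wpowS heq_cat. Qed.

Lemma heq_wpow_conj s u v m : heq (s ++ u) (u ++ v) -> heq (wpow s m ++ u) (u ++ wpow v m).
Proof.
by move=> /heqP h; apply/heqP => a b /h; rewrite !prj_cat !prj_wpow; exact: wpow_conj.
Qed.

Lemma prj_nil a b s : ~~ has (dep a) s -> dep a b ->
  prj a b s = filter (pred1 b) s /\ (b \notin s) .
Proof.
move=> h ab; have bs : b \notin s by apply: contra h => bs; apply/hasP; exists b.
split=> //; apply: eq_in_filter => c cs /=.
suff /negbTE-> : c != a by [].
by apply: contra h => /eqP <-; apply/hasP; exists c => //; rewrite dep_refl.
Qed.

Lemma prj_indep a b s : ~~ has (dep a) s -> dep a b -> prj a b s = [::].
Proof.
move=> h ab; have [-> bs] := prj_nil h ab.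
by apply/eqP; rewrite -size_eq0 size_filter; apply/eqP/count_memPn.
Qed.

Lemma prjC a b s : prj a b s = prj b a s.
Proof. by apply: eq_filter => c /=; rewrite orbC. Qed.

Lemma heq_move a s : ~~ has (dep a) s -> heq (s ++ [:: a]) (a :: s).
Proof.
move=> h; apply/heqP => b c bc; rewrite -[a :: s]cat1s !prj_cat.
case: (eqVneq a b) => [ab|ab]; first by rewrite -ab in bc *; rewrite (prj_indep h bc) cats0.
case: (eqVneq a c) => [ac|ac].
  by rewrite -ac dep_sym in bc; rewrite -ac ![prj b a _]prjC (prj_indep h bc) cats0.
by rewrite /prj /= (negbTE ab) (negbTE ac) cats0.
Qed.

Lemma heq_move_cat a s t : ~~ has (dep a) s -> heq (s ++ a :: t) (a :: (s ++ t)).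
Proof.
by move=> h; rewrite -cat_rcons -cats1 -cat_cons heq_Icat heq_move.
Qed.

(** Cut at the first [a] of [t]: a letter [b] before it with [dep a b] would come first in the
    projection on [a] and [b]. *)
Lemma prj_head_split a t :
  (forall b, dep a b -> prefix [:: a] (prj a b t)) ->
  exists t1 t2, t = t1 ++ a :: t2 /\ ~~ has (dep a) t1.
Proof.
move=> h; have /prefix1s := h a (dep_refl a); rewrite mem_filter => /andP[_ at_].
exists (take (index a t) t), (drop (index a t).+1 t).
have E : t = take (index a t) t ++ a :: drop (index a t).+1 t.
  by rewrite -{2}(nth_index a at_) -drop_nth ?index_mem // cat_take_drop.
split=> //; apply/hasPn => b bt; apply/negP => ab.
have na : a \notin take (index a t) t by rewrite in_take // ltnn.
have := h b ab; rewrite {1}E prj_cat.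
have : b \in prj a b (take (index a t) t) by rewrite mem_filter /= eqxx orbT.
case F : (prj _ _ _) => [|c l] // _ /=; case: eqP => // ac _.
have : c \in prj a b (take (index a t) t) by rewrite F mem_head.
by rewrite mem_filter -ac (negbTE na) andbF.
Qed.

(** Left divisibility is tested on projections: each letter of [s] in turn can be commuted to the
    front of what remains of [t]. *)
Lemma heq_prefix s t : (forall a b, dep a b -> prefix (prj a b s) (prj a b t)) ->
  exists u, heq t (s ++ u).
Proof.
elim: s t => [|a s IH] t h; first by exists t.
have [|t1 [t2 [E na]]] := @prj_head_split a t.
  by move=> b /h; rewrite /prj /= eqxx /= => /(catl_prefix (s1 := [:: a])).
have Ht : heq t (a :: (t1 ++ t2)) by rewrite E heq_move_cat.
have [b c bc|u Hu] := IH (t1 ++ t2).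
  have := h b c bc; rewrite (heqP _ _ Ht) //.
  by rewrite /prj /=; case: ifP => //=; rewrite eqxx.
by exists u; apply: heq_trans Ht _; rewrite cat_cons heq_cons.
Qed.

Lemma heq_consP a s t : heq (a :: s) t ->
  exists t1 t2, [/\ t = t1 ++ a :: t2, ~~ has (dep a) t1 & heq s (t1 ++ t2)].
Proof.
move=> h; have [|t1 [t2 [E na]]] := @prj_head_split a t.
  by move=> b ab; rewrite -(heqP _ _ h) // /prj /= eqxx /= eqxx prefix0s.
exists t1, t2; split=> //; rewrite -(heq_cons a); apply: heq_trans h _.
by rewrite E heq_move_cat.
Qed.

(** The projections of [u] and [u'] are prefixes of the same word, so their lengths decide, and
    these depend only on letter counts. *)
Lemma heq_cat_count_le u v u' v' : heq (u ++ v) (u' ++ v') ->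
  (forall a, count_mem a u <= count_mem a u') -> exists w, heq u' (u ++ w).
Proof.
move=> /heqP h le; apply: heq_prefix => a b ab.
apply: (@prefix_total _ _ _ (prj a b (u ++ v))); last exact: size_prj_le.
  by rewrite prj_cat prefix_prefix.
by rewrite h // prj_cat prefix_prefix.
Qed.

Lemma heq_cat_count_eq u v u' v' : heq (u ++ v) (u' ++ v') ->
  (forall a, count_mem a u = count_mem a u') -> heq u u' /\ heq v v'.
Proof.
move=> /heqP h le; split; apply/heqP => a b ab; have := h a b ab; rewrite !prj_cat;
  by move=> /catI_size[|//] ; rewrite !size_prj !le.
Qed.

End Traces.
#[export] Hint Resolve heq_refl : core.

(** * Pyramids *)

Section Pyramids.
Variables (T : finType) (e : rel T).
Hypothesis e_sym : symmetric e.
Implicit Types (s t u v w x y z A : seq T) (a b c : T).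
Local Notation dep := (dep e).
Local Notation heq := (heq e).

(* Scanning [y] after the letters [A] have been seen: [rch] keeps the pieces lying above some piece of [A], [unr] the other ones. *)
Fixpoint rch A y :=
  if y is b :: y' then if has (dep b) A then b :: rch (b :: A) y' else rch A y'
  else [::].
Fixpoint unr A y :=
  if y is b :: y' then if has (dep b) A then unr (b :: A) y' else b :: unr A y'
  else [::].

Lemma eq_rch A B y : A =i B -> rch A y = rch B y.
Proof.
elim: y A B => //= b y IH A B AB; rewrite (eq_has_r AB) (IH _ _ AB).
by rewrite (IH (b :: A) (b :: B)) // => c; rewrite !inE AB.
Qed.

Lemma eq_unr A B y : A =i B -> unr A y = unr B y.
Proof.
elim: y A B => //= b y IH A B AB; rewrite (eq_has_r AB) (IH _ _ AB).
by rewrite (IH (b :: A) (b :: B)) // => c; rewrite !inE AB.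
Qed.

Lemma unr_indep A y c : c \in unr A y -> ~~ has (dep c) A.
Proof.
elim: y A => //= b y IH A; case: ifP => [h /IH|/negbT h].
  by rewrite /= negb_or => /andP[].
by rewrite inE => /predU1P[->|/IH].
Qed.

Lemma rch_unr_heq A y : heq y (unr A y ++ rch A y).
Proof.
elim: y A => //= b y IH A; case: ifP => h; last by rewrite cat_cons heq_cons.
apply: (@heq_trans _ _ (b :: (unr (b :: A) y ++ rch (b :: A) y))).
  by rewrite heq_cons.
rewrite heq_sym; apply: heq_move_cat => //.
by apply/hasPn => c /unr_indep; rewrite /= negb_or dep_sym // => /andP[].
Qed.

Lemma rch_rch A y : rch A (rch A y) = rch A y.
Proof. by elim: y A => //= b y IH A; case: ifP => //= ->; rewrite IH. Qed.

Lemma unr_rch A y : unr A (rch A y) = [::].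
Proof. by elim: y A => //= b y IH A; case: ifP => //= ->; rewrite IH. Qed.

Lemma unr_nil_rch A y : unr A y = [::] -> rch A y = y.
Proof. by elim: y A => //= b y IH A; case: ifP => //= _ /IH->. Qed.

Lemma rch_cat A y z : rch A (y ++ z) = rch A y ++ rch (rch A y ++ A) z.
Proof.
elim: y A => //= b y IH A; case: ifP => //= h; rewrite IH; congr (_ :: _ ++ _).
by apply: eq_rch => c; rewrite !inE !mem_cat inE; do !case: (_ \in _); rewrite ?orbT.
Qed.

Lemma unr_cat A y z : unr A (y ++ z) = unr A y ++ unr (rch A y ++ A) z.
Proof.
elim: y A => //= b y IH A; case: ifP => //= h; rewrite IH //; congr (_ ++ _).
by apply: eq_unr => c; rewrite !inE !mem_cat inE; do !case: (_ \in _); rewrite ?orbT.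
Qed.

(** Minimal pieces are named by their letters: equal letters are comparable, so only the first
    occurrence of a letter can be minimal. *)
Definition ismin b s := (b \in s) && ~~ has (dep b) (take (index b s) s).

Lemma isminP b s : reflect (exists t, heq s (b :: t)) (ismin b s).
Proof.
apply: (iffP andP) => [[bs h]|[t]]; last first.
  rewrite heq_sym => /(heq_consP e_sym) [t1 [t2 [-> nb _]]].
  have bt : b \notin t1.
    by apply: contra nb => bt; apply/hasP; exists b => //; exact: dep_refl.
  rewrite mem_cat mem_head orbT index_cat (negbTE bt) /= eqxx addn0 take_size_cat //.
exists (take (index b s) s ++ drop (index b s).+1 s).
have {1}-> : s = take (index b s) s ++ b :: drop (index b s).+1 s.
  by rewrite -{2}(nth_index b bs) -drop_nth ?index_mem // cat_take_drop.
exact: heq_move_cat.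
Qed.

Lemma ismin_heq b s t : heq s t -> ismin b s = ismin b t.
Proof.
move=> h; apply/isminP/isminP => -[u hu]; exists u.
  by apply: heq_trans hu; rewrite heq_sym.
exact: heq_trans hu.
Qed.

Lemma ismin_head a s : ismin a (a :: s).
Proof. by apply/isminP; exists s. Qed.

Definition pyr a s := ismin a s && [forall b, ismin b s ==> (b == a)].

Lemma pyr_heq a s t : heq s t -> pyr a s = pyr a t.
Proof.
move=> h; rewrite /pyr (ismin_heq a h); congr andb; apply: eq_forallb => b.
by rewrite (ismin_heq b h).
Qed.

Lemma pyrP a s : reflect (ismin a s /\ forall b, ismin b s -> b = a) (pyr a s).
Proof.
apply: (iffP andP) => -[h1 h2]; split=> //.
  by move=> b hb; apply/eqP; move/forallP/(_ b)/implyP: h2; apply.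
by apply/forallP => b; apply/implyP => /h2->.
Qed.

Lemma pyr_uniq a b s : pyr a s -> pyr b s -> a = b.
Proof. by move=> /pyrP[h _] /pyrP[_]; apply. Qed.

Lemma pyr_mem a s : pyr a s -> a \in s.
Proof. by case/andP => /andP[]. Qed.

Lemma unr_depP A y z1 b z2 : unr A y = [::] -> y = z1 ++ b :: z2 -> has (dep b) (z1 ++ A).
Proof.
elim: z1 A y => [|c z1 IH] A y E Ey; move: E; rewrite {}Ey /=; first by case: ifP.
case: ifP => // _ /IH/(_ erefl) /=.
by rewrite !has_cat /=; do !case: (has _ _); rewrite ?orbT.
Qed.

(** The first unreached letter would commute down to the bottom and be a second minimal piece;
    conversely a reached letter has a dependent letter before it. *)
Lemma pyr_cons a y : pyr a (a :: y) = nilp (unr [:: a] y).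
Proof.
apply/idP/idP => [/pyrP[_ h]|/nilP E].
  case E : (unr _ _) => [|c u] //; have /h ca : ismin c (a :: y).
    apply/isminP; exists (u ++ a :: rch [:: a] y).
    apply: (@heq_trans _ _ (a :: unr [:: a] y ++ rch [:: a] y)).
      by rewrite heq_cons rch_unr_heq.
    rewrite heq_sym -cat_cons -E heq_move_cat //.
    by apply/hasPn => b /unr_indep; rewrite /= orbF dep_sym.
  have : c \in unr [:: a] y by rewrite E mem_head.
  by move/unr_indep; rewrite ca /= orbF dep_refl.
apply/pyrP; split=> [|b]; first exact: ismin_head.
rewrite /ismin inE /=; case: eqP => [->|/eqP ab] //=; rewrite eq_sym (negbTE ab) /=.
move=> /andP[by_]; rewrite negb_or => /andP[nab nb].
have : y = take (index b y) y ++ b :: drop (index b y).+1 y.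
  by rewrite -{2}(nth_index b by_) -drop_nth ?index_mem // cat_take_drop.
by move/(unr_depP E); rewrite has_cat /= orbF (negbTE nab) (negbTE nb).
Qed.

Lemma pyr_wordP a s : pyr a s -> exists y, heq s (a :: y) /\ unr [:: a] y = [::].
Proof.
move=> p; have /pyrP[/isminP[y hy] _] := p; exists y; split=> //.
by move: p; rewrite (pyr_heq a hy) pyr_cons => /nilP.
Qed.

Lemma pyr_rch a y : pyr a (a :: rch [:: a] y).
Proof. by rewrite pyr_cons unr_rch. Qed.

(** This is the factorization of a heap as [U] composed with [V_p], for the displayed piece [a]: the
    pieces of [y] not above it commute below it. *)
Lemma split_heq x a y : heq (x ++ a :: y) ((x ++ unr [:: a] y) ++ a :: rch [:: a] y).
Proof.
rewrite -catA heq_catI; apply: (@heq_trans _ _ (a :: unr [:: a] y ++ rch [:: a] y)).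
  by rewrite heq_cons rch_unr_heq.
rewrite heq_sym heq_move_cat //.
by apply/hasPn => b /unr_indep; rewrite /= orbF dep_sym.
Qed.

Lemma count_unr a y : count_mem a (unr [:: a] y) = 0.
Proof.
by apply/count_memPn/negP => /unr_indep; rewrite /= dep_refl.
Qed.

Lemma pyr_prefix a s u v : pyr a s -> heq s (u ++ v) -> u != [::] -> pyr a u.
Proof.
move=> p h; have /pyrP[_ m] := p; case: u h => // c u h _.
have m' b : ismin b (c :: u) -> b = a.
  move=> /isminP[t ht]; apply: m; apply/isminP; exists (t ++ v).
  by apply: heq_trans h _; rewrite -[b :: _]/((b :: t) ++ v) heq_Icat.
by apply/pyrP; split=> //; rewrite -{1}(m' c (ismin_head _ _)) ismin_head.
Qed.

Lemma pyr_cat a u v : pyr a u -> pyr a v -> pyr a (u ++ v).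
Proof.
move=> /pyr_wordP[y [hy Ey]] pv; have := pv => /pyr_wordP[z [hz Ez]].
rewrite (pyr_heq a (heq_cat hy hz)) cat_cons pyr_cons unr_cat Ey /=.
rewrite has_cat /= dep_refl orbT /=; apply/nilP.
have mono A B w : {subset A <= B} -> unr A w = [::] -> unr B w = [::].
  elim: w A B => //= b w IH A B AB; case: ifP => // /hasP[c cA bc].
  have -> : has (dep b) B by apply/hasP; exists c => //; exact: AB.
  by apply: IH => d; rewrite !inE => /predU1P[->|/AB->]; rewrite ?eqxx ?orbT.
by apply: mono Ez => b; rewrite !inE => ->.
Qed.

Lemma pyr_wpow a u m : 0 < m -> pyr a u -> pyr a (wpow u m).
Proof.
case: m => // m _ p; elim: m => [|m IH]; first by rewrite wpow1.
by rewrite wpowS pyr_cat.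
Qed.

Lemma pyr_wpowE a u m : 0 < m -> pyr a (wpow u m) = pyr a u.
Proof.
move=> m0; apply/idP/idP; last exact: pyr_wpow.
case: m m0 => // m _; rewrite wpowS => p; apply: (pyr_prefix p (heq_refl _ _)).
by apply: contraTneq (pyr_mem p) => ->; rewrite -wpowS; apply/negP => /mem_wpow.
Qed.

(* A pyramid [v] is the least right factor of a heap that contains its minimal piece. *)
Lemma pyr_count_le a u v u' v' : heq (u ++ v) (u' ++ v') -> pyr a v ->
  count_mem a v <= count_mem a v' -> forall b, count_mem b v <= count_mem b v'.
Proof.
move=> h /pyr_wordP[y [hv Ey]].
have {}h : heq (u ++ a :: y) (u' ++ v').
  by apply: heq_trans h; rewrite heq_catI heq_sym.
(* Induction along the scan of [y]: [x] holds the letters already reached, whose counts are known to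
   be bounded, and [z] those still to be read. *)
suff key x z A : A =i x -> has predT x -> unr A z = [::] ->
    heq (u ++ x ++ z) (u' ++ v') ->
    (forall b, b \in x -> count_mem b (x ++ z) <= count_mem b v') ->
    forall b, b \in x ++ z -> count_mem b (x ++ z) <= count_mem b v'.
  move=> le b; have le' c : count_mem c v = count_mem c (a :: y) by rewrite (heq_count hv).
  rewrite le'; case: (boolP (b \in a :: y)) => [bay|/count_memPn-> //].
  apply: (key [:: a] y [:: a]) => // c; rewrite inE => /eqP->.
  by rewrite /= -[X in X <= _]le'.
elim: z x A => [|c z IH] x A Ax x0 /= Ez hx le b; first by rewrite cats0 in le * => /le.
move: Ez; case: ifP => // /hasP[d dA cd] Ez.
have dx : d \in x by rewrite -Ax.
rewrite -cat_rcons; apply: (IH _ (c :: A)) => //.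
- by move=> f; rewrite mem_rcons !inE Ax.
- by rewrite has_rcons.
- by rewrite cat_rcons.
move=> f; rewrite mem_rcons inE cat_rcons => /predU1P[->|/le//].
case: (boolP (c \in x)) => [/le//|cx].
(* The new letter [c] depends on a reached letter [d] and is absent from [x], so the projection of
   [x ++ c :: z] on this pair begins with [d]; the bound for [d] then carries over to [c]. *)
rewrite -(count_prjr d c) -[X in _ <= X](count_prjr d c).
apply: (@suffix_count_le _ (pred1 d) _ (prj d c u) _ (prj d c u')).
- by rewrite -!prj_cat; apply/(heqP _ _ _ hx); rewrite dep_sym.
- rewrite prj_cat; have : d \in prj d c x by rewrite mem_filter /= eqxx.
  case F : (prj d c x) => [|g l] // _ /=.
  have : g \in prj d c x by rewrite F mem_head.
  rewrite mem_filter => /andP[/= /orP[//|/eqP->]].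
  by rewrite (negbTE cx).
by rewrite !count_prjl; apply: le.
Qed.
End Pyramids.

(** * Conjugacy of heaps *)

Section Conjugacy.
Variables (T : finType) (e : rel T).
Hypothesis e_sym : symmetric e.
Implicit Types (s t u v w x y z A P Q U V W K : seq T) (a b c : T).
Local Notation dep := (dep e).
Local Notation heq := (heq e).
Local Notation unr := (unr e).
Local Notation pyr := (pyr e).
Local Notation prj := (@prj T).

(** Each of the two pyramids is least among right factors with as many letters [a], so their letter
    counts agree. Cutting a heap at a piece is thus determined by the number of [a] left below. *)
Lemma heq_split_uniq a u v u' v' : heq (u ++ v) (u' ++ v') -> pyr a v -> pyr a v' ->
  count_mem a u = count_mem a u' -> heq u u' /\ heq v v'.
Proof.
move=> h p p' E.
have tot b : count_mem b u + count_mem b v = count_mem b u' + count_mem b v'.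
  by rewrite -!count_cat (heq_count h).
have Ev : count_mem a v = count_mem a v' by have := tot a; rewrite E => /addnI.
apply: (heq_cat_count_eq h) => b.
have le1 : count_mem b v <= count_mem b v' by apply: (pyr_count_le e_sym h p); rewrite Ev.
have le2 : count_mem b v' <= count_mem b v.
  by apply: (pyr_count_le e_sym (heqS h) p'); rewrite Ev.
by have := tot b; lia.
Qed.

(** Connectedness of the dependence graph on the letters of [s], stated through closed predicates so
    that it can be used directly as an induction principle. *)
Definition conn s := forall S : pred T,
  (forall b c, b \in s -> c \in s -> dep b c -> S b -> S c) ->
  forall b c, b \in s -> c \in s -> S b -> S c.

Lemma eq_conn s t : s =i t -> conn s -> conn t.
Proof.
move=> st h S cl b c bt ct; apply: h; rewrite ?st // => b' c'; rewrite !st; exact: cl.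
Qed.

(** Every letter above the bottom [a] is linked to an earlier one, so a closed predicate true at [a]
    is true everywhere. If it is false at [a], the argument applies to its complement, closed by
    symmetry of [dep]. *)
Lemma pyr_conn a s : pyr a s -> conn s.
Proof.
move=> /(pyr_wordP e_sym)[y [h E]]; have st := heq_mem h.
apply: (@eq_conn (a :: y)) => [b|]; first by rewrite st.
suff key (S : pred T) : (forall b c, b \in a :: y -> c \in a :: y -> dep b c -> S b -> S c) ->
    S a -> forall b, b \in a :: y -> S b.
  move=> S cl b c bs cs Sb; case: (boolP (S a)) => Sa; first exact: key cs.
  have := key (predC S) _ Sa b bs; rewrite /= Sb => /(_ _)/negP[] // {b c bs cs Sb} b c bs cs bc.
  by apply: contra => Sc; apply: cl Sc => //; rewrite dep_sym.
move=> cl Sa b; rewrite inE => /predU1P[->//|].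
have : forall z A, {subset z <= a :: y} -> {subset A <= a :: y} -> all S A ->
    unr A z = [::] -> b \in z -> S b.
  elim=> //= c z IH A sz sA SA; case: ifP => // /hasP[d dA cd] Ez.
  have cy : c \in a :: y by apply: sz; rewrite mem_head.
  have Sc : S c.
    by apply: (cl d) => //; [exact: sA|rewrite dep_sym|move/allP: SA; apply].
  rewrite inE => /predU1P[->//|]; apply: IH Ez.
  - by move=> f fz; apply: sz; rewrite inE fz orbT.
  - by move=> f; rewrite inE => /predU1P[->|/sA].
  - by rewrite /= Sc.
move/(_ y [:: a]); apply => //=; last by rewrite Sa.
  by move=> c; rewrite inE orbC => ->.
by move=> c; rewrite inE => /eqP->; rewrite mem_head.
Qed.

(* Between pyramids, rotation equivalence is conjugacy in the heap monoid; [U] is the heap of pieces moved from below to above. *)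
Definition cj P Q U := heq (P ++ U) (U ++ Q) /\ {subset U <= P}.

Lemma cj_count P Q U : cj P Q U -> forall a, count_mem a P = count_mem a Q.
Proof.
by move=> [/heq_count h _] a; have := h a; rewrite !count_cat addnC => /addnI.
Qed.

Lemma cj_mem P Q U : cj P Q U -> P =i Q.
Proof. by move=> h a; rewrite -!has_pred1 !has_count (cj_count h). Qed.

Lemma cj_size P Q U : cj P Q U -> size P = size Q.
Proof. by move=> [/heq_size]; rewrite !size_cat addnC => /addnI. Qed.

Lemma cj_trans P Q R U V : cj P Q U -> cj Q R V -> cj P R (U ++ V).
Proof.
move=> h [h2 s2]; have m := cj_mem h; case: h => h1 s1; split; last first.
  by move=> a; rewrite mem_cat => /orP[/s1|/s2]; rewrite ?m.
rewrite -catA; apply: (@heq_trans _ _ (U ++ (Q ++ V))); last by rewrite heq_catI.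
by rewrite !catA heq_Icat.
Qed.

Lemma cj_heq P P' Q Q' U : heq P P' -> heq Q Q' -> cj P Q U -> cj P' Q' U.
Proof.
move=> hP hQ [h s]; split; last by move=> a /s; rewrite (heq_mem hP).
apply: (@heq_trans _ _ (P ++ U)); first by rewrite heq_Icat heq_sym.
by apply: heq_trans h _; rewrite heq_catI.
Qed.

Lemma cj_refl P : cj P P [::].
Proof. by split=> //; rewrite cats0. Qed.

Lemma cj_rot U V : cj (U ++ V) (V ++ U) U.
Proof. by split; [rewrite catA | move=> a; rewrite mem_cat => ->]. Qed.

(** Conjugacy becomes an actual rotation after passing to powers: [U] is a left factor of a high
    power of [P], and the complement [V] serves for both sides. *)
Lemma cj_pow P Q U m : cj P Q U -> size U <= m ->
  exists V, heq (wpow P m) (U ++ V) /\ heq (wpow Q m) (V ++ U).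
Proof.
move=> [h s] le; have [|V hV] := @heq_prefix _ _ e_sym U (wpow P m).
  move=> a b ab; rewrite prj_wpow; apply: (@conj_prefix_wpow _ _ _ (prj a b Q)).
    by rewrite -!prj_cat; apply/(heqP _ _ _ h).
  (* The inclusion of the letters of [U] in those of [P] enters here: where the projection of [U] is
     nonempty so is that of [P], hence [m] copies of it are long enough. *)
  case F : (prj a b U) => [|c l] //; rewrite -F.
  have : c \in prj a b U by rewrite F mem_head.
  rewrite mem_filter => /andP[cab /s cP].
  have : 0 < size (prj a b P).
    by rewrite -has_predT; apply/hasP; exists c => //; rewrite mem_filter cab.
  have : size (prj a b U) <= size U by rewrite size_filter count_size.
  by move=> l1 l2; apply: (leq_trans (leq_trans l1 le)); rewrite leq_pmulr.
exists V; split=> //; rewrite -(heq_catI e U) catA.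
apply: (@heq_trans _ _ (wpow P m ++ U)); last by rewrite heq_Icat.
by rewrite heq_sym; apply: heq_wpow_conj.
Qed.

(** The complement of [U] in a power of [P] conjugates back. *)
Lemma cj_sym P Q U : cj P Q U -> exists V, cj Q P V.
Proof.
move=> h; have [V [hV hV']] := cj_pow h (leqnn _); exists V; split; last first.
  move=> a aV; rewrite -(cj_mem h); apply: (@mem_wpow _ P (size U)).
  by rewrite (heq_mem hV) mem_cat aV orbT.
rewrite -(heq_catI e U); case: h => h _.
apply: (@heq_trans _ _ (P ++ wpow P (size U))).
  apply: (@heq_trans _ _ ((P ++ U) ++ V)); first by rewrite catA heq_Icat heq_sym.
  by rewrite -catA heq_catI heq_sym.
by rewrite -wpowS wpowSr catA heq_Icat.
Qed.

(** [U] and [U'] are left factors of one power of [P]. The complement [V'] of [U'] is a left factor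
    of a power of [Q'], hence a pyramid over [a], and its minimality among right factors turns one
    inequality on [a] into inequalities on all letters. *)
Lemma cj_le a P Q Q' U U' : cj P Q U -> cj P Q' U' -> pyr a Q -> pyr a Q' ->
  count_mem a U <= count_mem a U' -> exists W, heq U' (U ++ W).
Proof.
move=> h h' p p' le; pose m := (maxn (size U) (size U')).+1.
(* The successor in [m] makes [V'] nonempty: the power of [P] has at least [m] letters [a], more
   than [U'] can hold. *)
have [V [hV1 hV2]] := @cj_pow _ _ _ m h (leqW (leq_maxl _ _)).
have [V' [hV1' hV2']] := @cj_pow _ _ _ m h' (leqW (leq_maxr _ _)).
have hh : heq (U' ++ V') (U ++ V).
  by apply: heq_trans hV1; rewrite heq_sym.
have pV' : pyr a V'.
  apply: (pyr_prefix e_sym _ hV2'); first exact: pyr_wpow.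
  apply/eqP => V0; have E := heq_count hV1' a; rewrite V0 cats0 count_wpow in E.
  have aP : a \in P by rewrite (cj_mem h') (pyr_mem p').
  have mP : m <= m * count_mem a P by rewrite leq_pmulr // -has_count has_pred1.
  have := leq_trans mP (leq_trans (eq_leq E) (count_size _ _)).
  by rewrite /m ltnNge leq_maxr.
have tot b := heq_count hh b.
have le2 : count_mem a V' <= count_mem a V by have := tot a; rewrite !count_cat; lia.
apply: heq_cat_count_le (e_sym) _ _ _ _ _ _ => [|b].
  by rewrite heq_sym; exact: hh.
have := pyr_count_le e_sym hh pV' le2 b.
by have := tot b; rewrite !count_cat; lia.
Qed.

Lemma cj_uniq a P Q Q' U U' : cj P Q U -> cj P Q' U' -> pyr a Q -> pyr a Q' ->
  count_mem a U = count_mem a U' -> heq Q Q'.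
Proof.
move=> h h' p p' E.
have [|W hW] := cj_le h h' p p'; first by rewrite E.
have [|W' hW'] := cj_le h' h p' p; first by rewrite E.
have W0 : W = [::].
  by apply: size0nil; have := heq_size hW; have := heq_size hW'; rewrite !size_cat; lia.
rewrite W0 cats0 in hW; case: h => h _; case: h' => h' _.
rewrite -(heq_catI e U); apply: (@heq_trans _ _ (P ++ U)); first by rewrite heq_sym.
apply: (@heq_trans _ _ (P ++ U')); first by rewrite heq_catI heq_sym.
by apply: heq_trans h' _; rewrite heq_Icat.
Qed.

(** For dependent [c] and [d] the projections of [Q] and [W] commute as words, so their letter
    counts are proportional; connectedness spreads the proportion to all letters. *)
Lemma comm_ratio Q W : conn Q -> heq (Q ++ W) (W ++ Q) -> forall b c, b \in Q -> c \in Q ->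
  count_mem b W * count_mem c Q = count_mem c W * count_mem b Q.
Proof.
move=> cQ h b c bQ cQ'; apply/eqP.
pose S c := count_mem b W * count_mem c Q == count_mem c W * count_mem b Q.
apply: (cQ S _ b c) => //; last by rewrite /S.
have pos d : d \in Q -> 0 < count_mem d Q by rewrite -has_count has_pred1.
move=> {c cQ'} c d cQ' dQ cd /eqP Sc; apply/eqP.
have := heqP _ _ _ h c d cd; rewrite !prj_cat => /comm_wpow E.
have Ec := congr1 (count_mem c) E; have Ed := congr1 (count_mem d) E.
rewrite !count_wpow !count_prjl in Ec; rewrite !count_wpow !count_prjr in Ed.
have q0 : 0 < size (prj c d Q) by rewrite size_prj addn_gt0 pos.
have cQ0 := pos _ cQ'.
have E2 : count_mem c W * count_mem d Q = count_mem d W * count_mem c Q.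
  by apply/eqP; rewrite -(eqn_pmul2l q0) !mulnA -Ec -Ed; apply/eqP; lia.
by apply/eqP; rewrite -(eqn_pmul2r cQ0); apply/eqP; nia.
Qed.

(* Euclid's algorithm: of two commuting connected heaps with the same letters, one is a left factor of the other. *)
Lemma common_root Q W : conn Q -> Q =i W -> heq (Q ++ W) (W ++ Q) ->
  exists K m n, [/\ 0 < m, 0 < n, heq Q (wpow K m) & heq W (wpow K n)].
Proof.
move: {2}(size Q + size W) (leqnn (size Q + size W)) => N.
elim: N Q W => [|N IH] Q W.
  rewrite leqn0 addn_eq0 !size_eq0 => /andP[/eqP-> /eqP->] _ _ _.
  by exists [::], 1, 1.
have half : forall Q W, size Q + size W <= N.+1 -> conn Q -> Q =i W ->
    heq (Q ++ W) (W ++ Q) -> (forall b, count_mem b Q <= count_mem b W) ->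
    exists K m n, [/\ 0 < m, 0 < n, heq Q (wpow K m) & heq W (wpow K n)].
  move=> {}Q {}W le cQ QW h lec.
  have [W' hW'] := heq_cat_count_le e_sym h lec.
  case: (eqVneq W' [::]) => [E|W0].
    by exists Q, 1, 1; rewrite wpow1; split=> //; move: hW'; rewrite E cats0.
  have h' : heq (Q ++ W') (W' ++ Q).
    rewrite -(heq_catI e Q) catA; apply: (@heq_trans _ _ (W ++ Q)).
      apply: (@heq_trans _ _ (Q ++ W)) => //; rewrite -catA heq_catI heq_sym //.
    by rewrite catA heq_Icat.
  have sW : {subset W' <= Q}.
    by move=> b bW; rewrite QW (heq_mem hW') mem_cat bW orbT.
  have QW' : Q =i W'.
    move=> b; apply/idP/idP => [bQ|/sW//].
    have [c cW] : exists c, c \in W'.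
      by case: (W') W0 => // c l _; exists c; rewrite mem_head.
    have cQ' := sW _ cW; have := comm_ratio cQ h' bQ cQ'.
    by move: bQ cW cQ'; rewrite -!has_pred1 !has_count; nia.
  have sz := heq_size hW'; rewrite size_cat in sz.
  case: (posnP (size Q)) => [/size0nil Q0|Q0].
    by exists W, 0.+1, 1; rewrite Q0 in sW; case: (W') W0 sW => // c l _ /(_ c (mem_head _ _)).
  have [|K [m [n [m0 n0 hK1 hK2]]]] := IH Q W' _ cQ QW' h'; first by lia.
  exists K, m, (m + n); split=> //; first by rewrite addn_gt0 m0.
  by apply: heq_trans hW' _; rewrite wpowD heq_cat.
move=> le cQ QW h.
case: (posnP (size Q)) => [/size0nil Q0|Q0].
  apply: half => // b; rewrite Q0 //.
have [c cQ'] : exists c, c \in Q by case: (Q) Q0 => // c l _; exists c; rewrite mem_head.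
(* Letter counts are proportional, so comparing them at the single letter [c] decides which heap is
   dominated at every letter. *)
case: (leqP (count_mem c Q) (count_mem c W)) => lec.
  apply: half => // b; case: (boolP (b \in Q)) => [bQ|/count_memPn-> //].
  have := comm_ratio cQ h bQ cQ'; move: cQ'; rewrite -has_pred1 has_count; nia.
have [|||||K [m [n [m0 n0 h1 h2]]]] := half W Q.
- by rewrite addnC.
- exact: eq_conn QW cQ.
- by move=> b; rewrite QW.
- by rewrite heq_sym.
- move=> b; case: (boolP (b \in W)) => [bW|/count_memPn-> //].
  rewrite -QW in bW; have := comm_ratio cQ h bW cQ'; move: cQ' bW; rewrite -!has_pred1 !has_count; nia.
by exists K, n, m.
Qed.
End Conjugacy.

(** * Rotation *)

Section Rotation.
Variables (T : finType) (e : rel T).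
Hypothesis e_sym : symmetric e.
Implicit Types (s t u v w x y z A P Q U V W K : seq T) (a b c : T).
Local Notation dep := (dep e).
Local Notation heq := (heq e).
Local Notation rch := (rch e).
Local Notation unr := (unr e).
Local Notation pyr := (pyr e).
Local Notation cj := (cj e).
Local Notation conn := (conn e).
Local Notation prj := (@prj T).

Definition per P := exists K m, 1 < m /\ heq P (wpow K m).

Lemma per_heq P Q : heq P Q -> per P -> per Q.
Proof.
move=> h [K [m [m1 hK]]]; exists K, m; split=> //; exact: heq_trans (heqS h) hK.
Qed.

(** The root itself is conjugated: the projections of [U] are prefixes of powers of those of [K], so
    [U] is a left factor of [K ++ U]. Writing the latter as [U ++ K'] and cancelling [U] gives [Q]
    as the [m]-th power of [K']. *)
Lemma cj_per P Q U : cj P Q U -> per P -> per Q.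
Proof.
move=> h [K [m [m1 hK]]].
have [||h' s] := @cj_heq _ _ P (wpow K m) Q Q U _ _ h; rewrite ?heq_refl //.
have [|K' hK'] := @heq_prefix _ _ e_sym U (K ++ U).
  move=> a b ab.
  have pre : prefix (prj a b U) (wpow (prj a b (wpow K m)) (size U)).
    apply: (@conj_prefix_wpow _ _ _ (prj a b Q)).
      by rewrite -!prj_cat; apply/(heqP _ _ _ h').
    case F : (prj a b U) => [|c l] //; rewrite -F.
    have : c \in prj a b U by rewrite F mem_head.
    rewrite mem_filter => /andP[cab /s cP].
    have : 0 < size (prj a b (wpow K m)).
      by rewrite -has_predT; apply/hasP; exists c => //; rewrite mem_filter cab.
    have : size (prj a b U) <= size U by rewrite size_filter count_size.
    by move=> l1 l2; apply: (leq_trans l1); rewrite leq_pmulr.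
  rewrite prj_wpow wpowM in pre; rewrite prj_cat.
  apply: (@prefix_total _ _ _ (wpow (prj a b K) (m * size U).+1)); last by rewrite size_cat leq_addl.
    by apply: prefix_trans pre _; apply: prefix_wpow.
  by rewrite wpowS prefix_catr // eqxx pre.
exists K', m; split=> //; rewrite -(heq_catI e U).
apply: (@heq_trans _ _ (wpow K m ++ U)); first exact: heqS.
exact: heq_wpow_conj.
Qed.

(** By [comm_ratio] the two heaps have the same letters, so both are powers of a common root; [W] is
    a nontrivial but smaller power, so the exponent of [P] exceeds 1. *)
Lemma per_comm P W a : conn P -> {subset W <= P} -> heq (P ++ W) (W ++ P) ->
  0 < count_mem a W < count_mem a P -> per P.
Proof.
move=> cP sW h /andP[W0 lt].
have aW : a \in W by rewrite -has_pred1 has_count.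
have PW : P =i W.
  move=> b; apply/idP/idP => [bP|/sW//]; have := comm_ratio cP h bP (sW _ aW).
  by move: bP; rewrite -!has_pred1 !has_count; nia.
have [K [m [n [m0 n0 h1 h2]]]] := common_root e_sym cP PW h.
exists K, m; split=> //; move: lt.
by rewrite (heq_count h1) (heq_count h2) !count_wpow ltn_mul2r => /andP[_]; lia.
Qed.

(** Equal powers make all projections commute, so [P] and [Q] commute and have a common root;
    aperiodicity forces both exponents to be 1. *)
Lemma root_uniq a P Q m n : 0 < m -> 0 < n -> pyr a P -> ~ per P -> ~ per Q ->
  heq (wpow P m) (wpow Q n) -> heq P Q.
Proof.
move=> m0 n0 p nP nQ h.
have PQ : P =i Q by move=> b; rewrite -(mem_wpowE P b m0) -(mem_wpowE Q b n0) (heq_mem h).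
have hc : heq (P ++ Q) (Q ++ P).
  apply/heqP => b c bc; rewrite !prj_cat; apply: (eq_wpow_comm m0 n0).
  by rewrite -!prj_wpow; apply/(heqP _ _ _ h).
have [K [m' [n' [m1 n1 h1 h2]]]] := common_root e_sym (pyr_conn e_sym p) PQ hc.
have E1 : m' = 1.
  by apply/eqP; rewrite eqn_leq m1 andbT leqNgt; apply/negP => l; case: nP; exists K, m'.
have E2 : n' = 1.
  by apply/eqP; rewrite eqn_leq n1 andbT leqNgt; apply/negP => l; case: nQ; exists K, n'.
by move: h1 h2; rewrite E1 E2 wpow1 => h1 h2; exact: heq_trans h1 (heqS h2).
Qed.

Lemma root_exists a P : pyr a P ->
  exists Q m, [/\ 0 < m, pyr a Q, ~ per Q & heq P (wpow Q m)].
Proof.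
move: {2}(size P) (leqnn (size P)) => N; elim: N P => [|N IH] P.
  by rewrite leqn0 size_eq0 => /eqP-> /pyr_mem.
move=> le p; case: (excluded_middle_informative (per P)) => // [[K [m [m1 h]]]|nP]; last first.
  by exists P, 1; rewrite wpow1.
have m0 : 0 < m by lia.
have pK : pyr a K by rewrite -(pyr_wpowE e_sym a K m0) -(pyr_heq e_sym a h).
have K0 : 0 < size K by have := pyr_mem pK; case: (K).
have [|Q [n [n0 pQ nQ hQ]]] := IH K _ pK.
  have := heq_size h; rewrite size_wpow => E.
  have : 2 * size K <= m * size K by rewrite leq_mul2r m1 orbT.
  by rewrite -E; lia.
exists Q, (n * m); split=> //; first by rewrite muln_gt0 n0.
by apply: heq_trans h _; rewrite -wpowM; apply: heq_wpow.
Qed.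

(* [A_p] for the piece [p] of index [i]; in the result [p] has index 0. *)
Definition hrot s i :=
  if drop i s is a :: y then (a :: rch [:: a] y) ++ (take i s ++ unr [:: a] y) else s.

Definition hrotn m s i := iter m (fun s => hrot s 0) (hrot s i).

Lemma hrotE x a y : hrot (x ++ a :: y) (size x) = (a :: rch [:: a] y) ++ (x ++ unr [:: a] y).
Proof. by rewrite /hrot drop_size_cat // take_size_cat. Qed.

Lemma hrot0E a y : hrot (a :: y) 0 = a :: (rch [:: a] y ++ unr [:: a] y).
Proof. by rewrite (hrotE [::]). Qed.

Lemma hrot_cj x a y :
  cj (x ++ a :: y) (hrot (x ++ a :: y) (size x)) (x ++ unr [:: a] y).
Proof.
rewrite hrotE; have h := split_heq e_sym x a y.
by apply: (cj_heq (heqS h) (heq_refl _ _)); apply: cj_rot.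
Qed.

(** Once the marked piece is in front, every other [a] lies above it and is never moved, so these
    steps do not change the count of [a] in the conjugator. *)
Lemma iter_hrot_cj m a y : exists y' U, [/\ iter m (fun s => hrot s 0) (a :: y) = a :: y',
  cj (a :: y) (a :: y') U & count_mem a U = 0].
Proof.
elim: m => [|m [y' [U [E h U0]]]]; first by exists y, [::]; split=> //; exact: cj_refl.
rewrite iterS E hrot0E; exists (rch [:: a] y' ++ unr [:: a] y'), (U ++ unr [:: a] y').
split=> //; last by rewrite count_cat U0 count_unr.
by apply: cj_trans h _; have := hrot_cj [::] a y'; rewrite (hrotE [::]).
Qed.

Lemma rch_nil A y : rch A y = [::] -> forall c, c \in y -> ~~ has (dep c) A.
Proof.
elim: y A => //= b y IH A; case: ifP => // /negbT h /IH nA c.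
by rewrite inE => /predU1P[->|/nA].
Qed.

(* By connectedness, each rotation step enlarges the set of pieces above the marked one until it is everything. *)
Lemma iter_hrot_progress m a y : conn (a :: y) ->
  exists y', iter m (fun s => hrot s 0) (a :: y) = a :: y' /\
   (unr [:: a] y' = [::] \/ m <= size (rch [:: a] y')).
Proof.
move=> cn; elim: m => [|m [y' [E h]]]; first by exists y; split=> //; right.
have [y1 [U [E1 hc _]]] := iter_hrot_cj m a y.
have {U E1 hc} cn' : conn (a :: y').
  apply: eq_conn cn => b; rewrite (cj_mem hc b).
  by move: E1; rewrite E => -[->].
rewrite iterS E hrot0E; set R := rch _ y' in h *; set N := unr _ y' in h *.
exists (R ++ N); split=> //.
rewrite unr_cat rch_cat unr_rch rch_rch /= -/R; case: h => [N0|le].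
  by left; rewrite N0.
case F : (rch (R ++ [:: a]) N) => [|c l]; last by right; rewrite size_cat /=; lia.
(* If nothing more is reached, no leftover letter depends on a reached one, and connectedness leaves
   no letter over. *)
left; have nd := rch_nil F; case EN : N => [|c l] //; exfalso.
have memP b : (b \in a :: y') = (b \in R ++ [:: a]) || (b \in N).
  rewrite inE (heq_mem (rch_unr_heq e_sym [:: a] y')) -/N -/R !mem_cat inE.
  by do !case: (_ \in _); case: (_ == _).
have cN : c \in N by rewrite EN mem_head.
have nin b : b \in N -> b \in R ++ [:: a] -> False.
  by move=> /nd/hasPn nb bR; move: (nb b bR); rewrite dep_refl.
apply: (nin c cN); apply: (cn' (mem (R ++ [:: a])) _ a c) => /=.
- move=> b d _; rewrite memP => /orP[//|dN] bd bR.
  by move: (hasPn (nd d dN) b bR); rewrite dep_sym // bd.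
- by rewrite memP mem_cat mem_head orbT.
- by rewrite memP cN orbT.
- by rewrite mem_cat mem_head orbT.
Qed.

(** [size s] iterations suffice since each one that is not yet stable enlarges the reached part. The
    count of [a] in the conjugator records which occurrence was marked; both injectivity and
    surjectivity of rotation are read off it. *)
Lemma hrotn_spec s x a y : s = x ++ a :: y -> conn s ->
  [/\ pyr a (hrotn (size s) s (size x)),
      hrot (hrotn (size s) s (size x)) 0 = hrotn (size s) s (size x) &
      exists U, cj s (hrotn (size s) s (size x)) U /\ count_mem a U = count_mem a x].
Proof.
move=> Es cn; have h := hrot_cj x a y; rewrite -Es in h.
have Er : hrot s (size x) = a :: (rch [:: a] y ++ (x ++ unr [:: a] y)) by rewrite Es hrotE.
have cn' : conn (a :: (rch [:: a] y ++ (x ++ unr [:: a] y))).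
  by apply: eq_conn cn => b; rewrite (cj_mem h) Er.
have [y' [E hy']] := iter_hrot_progress (size s) cn'.
have [y1 [U [E1 hc U0]]] := iter_hrot_cj (size s) a (rch [:: a] y ++ (x ++ unr [:: a] y)).
move: E1; rewrite E => -[Ey1]; rewrite -{}Ey1 in hc.
have {hy'} N0 : unr [:: a] y' = [::].
  case: hy' => // le; exfalso; have := cj_size h; rewrite Er (cj_size hc) /=.
  have := heq_size (rch_unr_heq e_sym [:: a] y'); rewrite size_cat; lia.
have -> : hrotn (size s) s (size x) = a :: y' by rewrite /hrotn Er.
split.
- by rewrite (pyr_cons e_sym) N0.
- by rewrite hrot0E N0 cats0 unr_nil_rch.
rewrite Er in h; have H := cj_trans h hc; exists (x ++ unr [:: a] y ++ U).
split; first by rewrite catA.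
by rewrite !count_cat count_unr U0 !addn0.
Qed.

Lemma cj_pow_self P k : cj P P (wpow P k).
Proof.
split; last by move=> b; exact: mem_wpow.
by rewrite -wpowS wpowSr heq_refl.
Qed.

Lemma nth_occ a s j : j < count_mem a s ->
  exists x y, s = x ++ a :: y /\ count_mem a x = j.
Proof.
elim: s j => //= b s IH j; case: (eqVneq b a) => [->|ba] /=.
  case: j => [|j]; first by exists [::], s.
  by rewrite add1n ltnS => /IH[x [y [-> <-]]]; exists (a :: x), y; rewrite /= eqxx.
by rewrite add0n => /IH[x [y [-> <-]]]; exists (b :: x), y; rewrite /= (negbTE ba).
Qed.

Lemma hrotn_surj P Q U a : conn P -> pyr a Q -> cj P Q U ->
  exists2 i, i < size P & heq (hrotn (size P) P i) Q.
Proof.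
move=> cn p h; have aP : 0 < count_mem a P.
  by rewrite -has_count has_pred1 (cj_mem h) (pyr_mem p).
(* Conjugating [P] by a power of itself does nothing, so the number of [a] in [U] matters only
   modulo [count_mem a P]: the remainder selects the occurrence to mark, the quotient the power of
   [P] to insert. *)
have [x [y [E cx]]] := nth_occ (ltn_pmod (count_mem a U) aP).
have [pr _ [V [hV cV]]] := hrotn_spec E cn.
exists (size x); first by rewrite E size_cat /=; lia.
apply: (cj_uniq e_sym (cj_trans (cj_pow_self P (count_mem a U %/ count_mem a P)) hV) h pr p).
by rewrite count_cat count_wpow cV cx -divn_eq.
Qed.

Lemma occ_inj a x y x' y' : x ++ a :: y = x' ++ a :: y' ->
  count_mem a x = count_mem a x' -> size x = size x'.
Proof.
elim: x x' => [|b x IH] [|b' x'] //=.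
- by move=> [<- _]; rewrite eqxx.
- by move=> [-> _]; rewrite eqxx.
by move=> [-> /IH h] /addnI/h ->.
Qed.

Lemma split_at (s : seq T) i : i < size s -> exists x a y, s = x ++ a :: y /\ size x = i.
Proof.
move=> h; case F : (drop i s) => [|a y].
  by move/(congr1 size): F; rewrite size_drop /=; lia.
by exists (take i s), a, y; rewrite -F cat_take_drop size_take h.
Qed.

(** Equal results have the same bottom [a], so both indices mark occurrences of [a]. If these
    differ, one conjugator is the other followed by some [W] that commutes with the result and has
    fewer letters [a]; then [per_comm] makes the result periodic, and [P] with it. *)
Lemma hrotn_inj P i j : conn P -> ~ per P -> i < size P -> j < size P ->
  heq (hrotn (size P) P i) (hrotn (size P) P j) -> i = j.
Proof.
move=> cn nP /split_at[x [a [y [E <-]]]] /split_at[x' [a' [y' [E' <-]]]] h.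
have [p _ [U [hU cU]]] := hrotn_spec E cn; have [p' _ [U' [hU' cU']]] := hrotn_spec E' cn.
have pa : pyr a (hrotn (size P) P (size x')) by rewrite -(pyr_heq e_sym a h).
have ea := pyr_uniq pa p'; rewrite -{}ea in E' p' cU'.
apply: (@occ_inj a _ y _ y'); first by rewrite -E.
wlog: x y x' y' U U' E E' h p p' hU hU' cU cU' pa / count_mem a x <= count_mem a x'.
  move=> H; case: (leqP (count_mem a x) (count_mem a x')) => [|/ltnW] le.
    exact: (H x y x' y' U U').
  by apply/esym/(H x' y' x y U' U) => //; exact: heqS.
rewrite leq_eqVlt => /orP[/eqP//|lt]; exfalso; apply: nP.
set Q := hrotn _ _ _ in h p hU; set Q' := hrotn _ _ _ in h p' hU' pa.
have [|W hW] := cj_le e_sym hU hU' p p'; first by rewrite cU cU' ltnW.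
have [V hV] := cj_sym e_sym hU; apply: (cj_per hV).
have cW : count_mem a W = count_mem a x' - count_mem a x.
  by rewrite -cU -cU' (heq_count hW) count_cat addKn.
apply: (@per_comm _ W a).
- exact: pyr_conn p.
- move=> b bW; rewrite -(cj_mem hU); case: hU' => _; apply.
  by rewrite (heq_mem hW) mem_cat bW orbT.
- case: hU => hU _; case: hU' => hU' _; rewrite -(heq_catI e U).
  apply: (@heq_trans _ _ (P ++ U ++ W)); first by rewrite !catA heq_Icat heqS.
  apply: (@heq_trans _ _ (P ++ U')); first by rewrite heq_catI heqS.
  apply: (heq_trans hU'); apply: (@heq_trans _ _ (U' ++ Q)); first by rewrite heq_catI heqS.
  by rewrite catA heq_Icat.
rewrite cW subn_gt0 lt /= -(cj_count hU a) E count_cat /= eqxx.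
by rewrite E' in E; move/(congr1 (count_mem a)): E; rewrite !count_cat /= eqxx; lia.
Qed.

End Rotation.

(** * Comparison with the definitions on tuples *)

Lemma pboolP (Q : Prop) : reflect Q (pbool Q).
Proof. by rewrite /pbool; case: excluded_middle_informative => h; constructor. Qed.

Section Link.
Variables (T : finType) (e : rel T).
Hypothesis e_sym : symmetric e.
Implicit Types (s t u v w x y z A P Q U V W K : seq T) (a b c : T).
Local Notation heq := (heq e).
Local Notation pyr := (pyr e).
Local Notation per := (per e).
Local Notation comm_step := (comm_step e).

Lemma comm_stepP s t : reflect
  (exists x a b y, [/\ s = x ++ a :: b :: y, t = x ++ b :: a :: y & ~~ dep e a b])
  (comm_step s t).
Proof.
apply: (iffP hasP) => [[i _ /andP[]]|[x [a [b [y [-> -> nab]]]]]].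
  rewrite /can_swap /swap_at; case F : (drop i s) => [|a [|b y]] // nab /eqP ->.
  by exists (take i s), a, b, y; rewrite -F cat_take_drop; split=> //; rewrite negb_or.
exists (size x); first by rewrite mem_iota size_cat /=; lia.
by rewrite /can_swap /swap_at drop_size_cat // take_size_cat // eqxx andbT -negb_or.
Qed.

Lemma comm_step_heq s t : comm_step s t -> heq s t.
Proof.
move=> /comm_stepP[x [a [b [y [-> -> nab]]]]]; rewrite heq_catI.
apply: heqS; rewrite -[b :: a :: y]/([:: b] ++ a :: y); apply: heq_move_cat => //=.
by rewrite orbF.
Qed.

Definition steps s t := exists2 p, path comm_step s p & last s p = t.

Lemma steps_refl s : steps s s. Proof. by exists [::]. Qed.

Lemma steps_trans t s u : steps s t -> steps t u -> steps s u.
Proof.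
by move=> [p hp <-] [q hq <-]; exists (p ++ q); rewrite ?last_cat // cat_path hp.
Qed.

Lemma steps_cons a s t : steps s t -> steps (a :: s) (a :: t).
Proof.
move=> [p hp <-]; exists (map (cons a) p); last by rewrite last_map.
rewrite path_map; apply: sub_path hp => u v /comm_stepP[x [b [c [y [-> -> h]]]]].
by apply/comm_stepP; exists (a :: x), b, c, y.
Qed.

(** After the tail has been transformed, adjacent swaps carry the head [a] past the letters
    independent of it to its place in [t]. *)
Lemma heq_steps s t : heq s t -> steps s t.
Proof.
elim: s t => [|a s IH] t h.
  by have := heq_size h; case: t h => // _ _; exact: steps_refl.
have [t1 [t2 [-> na ht]]] := heq_consP e_sym h.
apply: (steps_trans (steps_cons a (IH _ ht))).
elim: t1 na {h ht} => [|b t1 IH1] /=; first by move=> _; exact: steps_refl.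
rewrite negb_or => /andP[nab /IH1 h].
apply: (steps_trans _ (steps_cons b h)).
exists [:: b :: a :: t1 ++ t2] => //=; rewrite andbT.
by apply/comm_stepP; exists [::], a, b, (t1 ++ t2).
Qed.

Lemma steps_connect k (x y x0 : k.-tuple T) : steps x y ->
  connect [rel u v : k.-tuple T | comm_step u v] x y.
Proof.
move=> [p]; elim: p x => [|z p IH] x /= => [_ /val_inj-> //|/andP[xz hp] E].
have sz : size z == k by rewrite -(heq_size (comm_step_heq xz)) size_tuple.
by apply: connect_trans (IH (Tuple sz) hp E); apply: connect1.
Qed.

Lemma heap_equivE s t : heap_equiv e s t = heq s t.
Proof.
apply/andP/idP => [[/eqP sz]|h].
  have -> : heq s t = heq (in_tuple s) (insubd (in_tuple s) t).
    by rewrite insubdK //; change (size t == size s); apply/eqP.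
  move/connectP => [p]; elim: p (in_tuple s) (insubd _ t) => [|z p IH] x y /=.
    by move=> _ ->.
  by move=> /andP[xz hp] /(IH _ _ hp); apply: heq_trans; exact: comm_step_heq.
split; first by rewrite (heq_size h).
apply: steps_connect; first exact: in_tuple.
rewrite insubdK; first exact: (heq_steps h).
change (size t == size s).
by rewrite (heq_size h).
Qed.

Section Order.
Variable r : T -> nat.
Hypothesis r_inj : injective r.
Local Notation lexle := (lexle r).
Local Notation standard := (standard e r).

Lemma lexle_refl s : lexle s s.
Proof. by elim: s => //= a s ->; rewrite eqxx orbT. Qed.

Lemma lexle_anti s t : lexle s t -> lexle t s -> s = t.
Proof.
elim: s t => [|a s IH] [|b t] //= /orP[l1|/andP[/eqP-> h1]] /orP[l2|/andP[/eqP E h2]].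
- by have := ltn_trans l1 l2; rewrite ltnn.
- by move: l1; rewrite E ltnn.
- by move: l2; rewrite ltnn.
by rewrite (IH t).
Qed.

Lemma lexle_trans t s u : lexle s t -> lexle t u -> lexle s u.
Proof.
elim: s t u => [|a s IH] [|b t] [|c u] //= /orP[l1|/andP[/eqP-> h1]] /orP[l2|/andP[/eqP<- h2]].
- by rewrite (ltn_trans l1 l2).
- by rewrite l1.
- by rewrite l2.
by rewrite eqxx (IH t) ?orbT.
Qed.

Lemma lexle_total s t : lexle s t || lexle t s.
Proof.
elim: s t => [|a s IH] [|b t] //=; rewrite (eq_sym b a).
by case: (ltngtP (r a) (r b)) => [||/r_inj->] //=; rewrite ?orbT // eqxx /= IH.
Qed.

Lemma standardP s : reflect (forall t, heq s t -> lexle t s) (standard s).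
Proof.
apply: (iffP forallP) => [h t st|h t].
  have sz : size t == size s by rewrite (heq_size st).
  by have /implyP := h (Tuple sz); rewrite heap_equivE; apply.
by apply/implyP; rewrite heap_equivE; apply: h.
Qed.

Lemma standard_heq s t : standard s -> standard t -> heq s t -> s = t.
Proof.
by move=> /standardP hs /standardP ht h; apply: lexle_anti; [apply/ht/heqS|apply: hs].
Qed.

Lemma lexle_max (l : seq (seq T)) s : s \in l ->
  exists2 t, t \in l & forall u, u \in l -> lexle u t.
Proof.
elim: l s => // s0 l IH s _; case: l IH => [_|s1 l IH].
  by exists s0; rewrite ?mem_head // => u; rewrite inE => /eqP->; exact: lexle_refl.
have [t tl ht] := IH s1 (mem_head _ _); case/orP: (lexle_total s0 t) => h.
  exists t; first by rewrite inE tl orbT.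
  by move=> u; rewrite inE => /predU1P[->|/ht].
exists s0; first by rewrite mem_head.
move=> u; rewrite inE => /predU1P[->|/ht h']; first exact: lexle_refl.
exact: lexle_trans h' h.
Qed.

Lemma lexle_min (l : seq (seq T)) s : s \in l ->
  exists2 t, t \in l & forall u, u \in l -> lexle t u.
Proof.
elim: l s => // s0 l IH s _; case: l IH => [_|s1 l IH].
  by exists s0; rewrite ?mem_head // => u; rewrite inE => /eqP->; exact: lexle_refl.
have [t tl ht] := IH s1 (mem_head _ _); case/orP: (lexle_total t s0) => h.
  exists t; first by rewrite inE tl orbT.
  by move=> u; rewrite inE => /predU1P[->|/ht].
exists s0; first by rewrite mem_head.
move=> u; rewrite inE => /predU1P[->|/ht h']; first exact: lexle_refl.
exact: lexle_trans h h'.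
Qed.

Lemma standard_exists s : exists t, standard t && heq s t.
Proof.
pose l := [seq tval d | d <- enum {: (size s).-tuple T} & heq s (tval d)].
have memP t : (t \in l) = heq s t.
  apply/mapP/idP => [[t']|h]; first by rewrite mem_filter => /andP[? _] ->.
  have sz : size t == size s by rewrite (heq_size h).
  by exists (Tuple sz) => //; rewrite mem_filter mem_enum h.
have [|t tl ht] := @lexle_max l s; first by rewrite memP heq_refl.
exists t; rewrite -memP tl andbT; apply/standardP => u tu; apply: ht.
by rewrite memP; apply: heq_trans tu; rewrite -memP.
Qed.

Definition std s := xchoose (standard_exists s).

Lemma std_standard s : standard (std s).
Proof. by have /andP[] := xchooseP (standard_exists s). Qed.

Lemma heq_std s : heq s (std s).
Proof. by have /andP[] := xchooseP (standard_exists s). Qed.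

Lemma std_id s : standard s -> std s = s.
Proof. by move=> h; apply: standard_heq; rewrite ?std_standard // heqS ?heq_std. Qed.

Lemma stdE s t : heq s t = (std s == std t).
Proof.
apply/idP/eqP => [h|E].
  apply: standard_heq; rewrite ?std_standard //.
  by apply: heq_trans (heq_trans h (heq_std t)); exact/heqS/heq_std.
by apply: heq_trans (heq_std s) _; rewrite E; exact/heqS/heq_std.
Qed.

Lemma size_std s : size (std s) = size s.
Proof. by rewrite -(heq_size (heq_std s)). Qed.

End Order.

Section Tuples.
Variable k : nat.
Implicit Types (p : k.-tuple T) (i j : 'I_k).

Lemma prec_dep (w : k.-tuple T) i j :
  prec e w i j = (i < j) && dep e (tnth w i) (tnth w j).
Proof. by []. Qed.

Lemma connect_last (F : finType) (g : rel F) (a b : F) : connect g a b ->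
  a = b \/ exists2 c, connect g a c & g c b.
Proof.
move=> /connectP[p]; case/lastP: p => [|p c] /=; first by left.
rewrite rcons_path last_rcons => /andP[hp gl] ->; right; exists (last a p) => //.
by apply/connectP; exists p.
Qed.

(** The transitive closure is unfolded at its last step, the form that matches a left-to-right
    scan. *)
Lemma piece_leE (w : k.-tuple T) i j : piece_le e w i j =
  (i == j) || [exists l : 'I_k, [&& l < j, piece_le e w i l & dep e (tnth w l) (tnth w j)]].
Proof.
apply/idP/orP => [/connect_last[->|[l h]]|[/eqP->|/existsP[l /and3P[lj h d]]]].
- by left.
- by rewrite prec_dep => /andP[lj d]; right; apply/existsP; exists l; apply/and3P.
- exact: connect0.
by apply: connect_trans h _; apply: connect1; rewrite prec_dep lj.
Qed.

Lemma minimal_pieceE (w : k.-tuple T) j :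
  minimal_piece e w j = ~~ has (dep e (tnth w j)) (take j w).
Proof.
apply/forallP/hasPn => [h b /(nthP b)[i]|h i].
  rewrite size_take size_tuple ltn_ord => ij; rewrite nth_take // => Eb.
  have ik : i < k by apply: ltn_trans ij _.
  have /implyP := h (Ordinal ik); rewrite -val_eqE /= neq_ltn ij => /(_ isT).
  apply: contra => d; apply: connect1; rewrite prec_dep /= ij /=.
  have -> : tnth w (Ordinal ik) = b by rewrite (tnth_nth b).
  by rewrite dep_sym.
apply/implyP => ij; apply/negP; rewrite piece_leE (negbTE ij) /= => /existsP[l].
case/and3P=> lj _; rewrite dep_sym //; apply/negP/h.
rewrite (tnth_nth (tnth w j)) -(nth_take (n0 := j)) // mem_nth //.
by rewrite size_take size_tuple ltn_ord.
Qed.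

(** A minimal piece is the first occurrence of its letter, so minimal pieces correspond to letters
    satisfying [ismin]. *)
Lemma pyramidP (w : k.-tuple T) : reflect (exists a, pyr a w) (pyramid e w).
Proof.
have minP j : minimal_piece e w j -> ismin e (tnth w j) w /\ index (tnth w j) w = j.
  rewrite minimal_pieceE => h.
  have ji : index (tnth w j) w = j.
    apply/eqP; rewrite eqn_leq; apply/andP; split.
      rewrite leqNgt; apply/negP => /(before_find (tnth w j)) /=.
      by rewrite -tnth_nth eqxx.
    rewrite leqNgt; apply/negP => lt; move/hasPn: h => /(_ (tnth w j)).
    by rewrite in_take ?mem_tnth // lt dep_refl => /(_ isT).
  by rewrite /ismin mem_tnth ji.
have minP' a : ismin e a w -> exists2 j, minimal_piece e w j & tnth w j = a.
  case/andP=> aw h; have lt : index a w < k by rewrite -[X in _ < X](size_tuple w) index_mem.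
  have E : tnth w (Ordinal lt) = a by rewrite (tnth_nth a) /= nth_index.
  by exists (Ordinal lt) => //; rewrite minimal_pieceE E.
apply: (iffP cards1P) => [[j Ej]|[a /pyrP[/minP'[j hj Ej] ha]]].
  have hj : minimal_piece e w j by have := set11 j; rewrite -Ej inE.
  exists (tnth w j); apply/pyrP; split; first by have [] := minP j hj.
  by move=> b /minP'[i hi <-]; congr tnth; apply/set1P; rewrite -Ej inE.
exists j; apply/setP => i; rewrite !inE; apply/idP/eqP => [hi|->//].
have [h1 h2] := minP i hi; have [_ h3] := minP j hj.
by apply: val_inj; rewrite /= -h2 -h3 Ej (ha _ h1).
Qed.

Lemma periodicP (w : k.-tuple T) : 0 < k -> reflect (per w) (periodic e w).
Proof.
move=> k0; apply: (iffP existsP) => [[m /andP[m1 /existsP[u]]]|[K [m [m1 h]]]].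
  by rewrite heap_equivE => h; exists u, m.
have E : k = m * size K by have := heq_size h; rewrite size_wpow size_tuple.
have m0 : 0 < m by lia.
(* Since [k] is positive the root is nonempty, so the exponent fits the bound built into
   [periodic]. *)
have mk : m < k.+1 by rewrite ltnS E leq_pmulr //; lia.
exists (Ordinal mk); rewrite /= m1; apply/existsP.
have sK : size K == k %/ m by rewrite E mulKn.
by exists (Tuple sK); rewrite heap_equivE.
Qed.

End Tuples.
End Link.

(** * Rotation of tuples and rotation of words *)

Section RotationLink.
Variables (T : finType) (e : rel T).
Hypothesis e_sym : symmetric e.
Implicit Types (s t u v x y z A : seq T) (a b c : T).
Local Notation pyr := (pyr e).
Local Notation cj := (cj e).
Local Notation per := (per e).
Local Notation rch := (rch e).
Local Notation unr := (unr e).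

Section Index.
Variables (a0 : T) (s : seq T) (g : pred nat) (p : nat).
Hypothesis ps : p < size s.
Hypothesis gE : forall j, j < size s ->
  g j = (j == p) || has (fun i => g i && dep e (nth a0 s j) (nth a0 s i)) (iota 0 j).
Local Notation sel m n := [seq nth a0 s j | j <- iota m n & g j].
Local Notation uns m n := [seq nth a0 s j | j <- iota m n & ~~ g j].

Lemma sel_low j : j < p -> g j = false.
Proof.
elim/ltn_ind: j => j IH jp; rewrite gE ?(ltn_trans jp) //; apply/norP; split.
  by rewrite neq_ltn jp.
apply/hasPn => i; rewrite mem_iota /= add0n => ij.
by rewrite IH // (ltn_trans ij).
Qed.

Lemma sel_p : g p.
Proof. by rewrite gE // eqxx. Qed.

(** Any predicate on positions obeying the recursion [gE] is computed by the scan, because the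
    recursion depends on the positions selected so far only through their set of letters. *)
Lemma sel_rch n m A : p < m -> m + n = size s -> A =i sel 0 m ->
  sel m n = rch A (drop m s) /\ uns m n = unr A (drop m s).
Proof.
elim: n m A => [|n IH] m A pm mn AE.
  by rewrite drop_oversize ?mn ?addn0 // -mn addn0.
have ms : m < size s by rewrite -mn addnS ltnS leq_addr.
rewrite (drop_nth a0 ms) /=.
have -> : has (dep e (nth a0 s m)) A = g m.
  rewrite (eq_has_r AE) gE // gtn_eqF //= has_map has_filter -filter_predI -has_filter.
  by apply: eq_has => i /=; rewrite andbC.
have S1 : sel 0 m.+1 = sel 0 m ++ (if g m then [:: nth a0 s m] else [::]).
  by rewrite -addn1 iotaD filter_cat map_cat add0n /=; case: (g m).
case: ifP S1 => gm S1 /=.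
  have [|||-> ->] // := IH m.+1 (nth a0 s m :: A); first exact: ltnW.
    by rewrite addSnnS.
  by move=> b; rewrite S1 mem_cat !inE AE orbC.
have [|||-> ->] // := IH m.+1 A; first exact: ltnW.
  by rewrite addSnnS.
by move=> b; rewrite S1 cats0.
Qed.

Lemma sel_rot : sel 0 (size s) ++ uns 0 (size s) = hrot e s p.
Proof.
have [n En] : exists n, size s = p + n.+1.
  by exists (size s - p).-1; lia.
have low (h : pred nat) : (forall j, j < p -> h j = false) -> filter h (iota 0 p) = [::].
  by move=> H; apply/eqP; rewrite -[_ == _]negbK -has_filter; apply/hasPn => j;
    rewrite mem_iota => /H->.
have up : filter (predC g) (iota 0 p) = iota 0 p.
  by apply/all_filterP/allP => j; rewrite mem_iota => /sel_low /= ->.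
have tk : [seq nth a0 s j | j <- iota 0 p] = take p s.
  by apply: map_nth_iota0; exact: ltnW.
rewrite /hrot (drop_nth a0 ps).
have [||| S U] := @sel_rch n p.+1 [:: nth a0 s p]; first by [].
- by rewrite addSnnS.
- move=> b; rewrite -addn1 iotaD filter_cat add0n (low g) /=; last exact: sel_low.
  by rewrite sel_p.
rewrite -[in iota _ (size s)]/(size s) En !iotaD !filter_cat !map_cat add0n /= sel_p /=.
by rewrite (low g) /= -?S -?U; [rewrite -[filter (fun j => ~~ g j) (iota 0 p)]/(filter (predC g) _) up tk|exact: sel_low].
Qed.

End Index.

Section Tuples.
Variable k : nat.

Lemma rotAE (w : k.-tuple T) (p : 'I_k) : tval (rotA e w p) = hrot e w p.
Proof.
pose g j := if insub j is Some i then piece_le e w p i else false.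
have gv (i : 'I_k) : g i = piece_le e w p i by rewrite /g valK.
have E (h : pred 'I_k) (h' : pred nat) : (forall i, h' (val i) = h i) ->
    [seq tnth w j | j <- enum 'I_k & h j] = [seq nth (tnth w p) w j | j <- iota 0 k & h' j].
  move=> hh; rewrite -val_enum_ord filter_map -map_comp.
  rewrite [in RHS](eq_filter (a2 := h)) => [|i]; last exact: hh.
  by apply: eq_map => i /=; rewrite (tnth_nth (tnth w p)).
have R : [seq tnth w j | j <- enum 'I_k & piece_le e w p j] ++
         [seq tnth w j | j <- enum 'I_k & ~~ piece_le e w p j] = hrot e w p.
  rewrite (E _ g) // (E _ (fun j => ~~ g j)) => [|i]; last by rewrite gv.
  have := @sel_rot (tnth w p) w g p; rewrite size_tuple; apply=> // j jk; rewrite -[j]/(val (Ordinal jk)) gv piece_leE eq_sym.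
  congr orb; apply/existsP/hasP => [[l /and3P[lj h d]]|[i]].
    exists (val l); first by rewrite mem_iota.
    by rewrite gv h -!tnth_nth dep_sym.
  rewrite mem_iota /= add0n => ij /andP[gi d]; have ik : i < k := ltn_trans ij jk.
  exists (Ordinal ik); rewrite ij -gv gi /=.
  by rewrite dep_sym // (tnth_nth (tnth w p) w (Ordinal ik)) (tnth_nth (tnth w p) w (Ordinal jk)).
rewrite /rotA R insubdK //; change (size (hrot e w p) == k).
rewrite -R size_cat !size_map !size_filter count_predC size_enum_ord.
by [].
Qed.

Lemma iter_rotstep (P : k.-tuple T) (p : 'I_k) m :
  let x := iter m.+1 (@rotstep T e k) (P, p) in tval x.1 = hrotn e m P p /\ x.2 = 0 :> nat.
Proof.
have k0 : 0 < k by apply: leq_ltn_trans (leq0n p) _.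
elim: m => [|m [h1 h2]]; first by split; [rewrite /= rotAE|rewrite /= val_insubd k0].
by rewrite iterS; split; [rewrite [LHS]rotAE h1 h2|rewrite /= val_insubd k0].
Qed.

Lemma hrotn_cj m (s : seq T) i : i < size s -> exists U, cj s (hrotn e m s i) U.
Proof.
move=> /split_at[x [a [y [-> <-]]]]; have h := hrot_cj e_sym x a y.
have [y' [U [E hU _]]] := iter_hrot_cj e_sym m a (rch [:: a] y ++ (x ++ unr [:: a] y)).
exists ((x ++ unr [:: a] y) ++ U); rewrite /hrotn; apply: cj_trans h _.
by rewrite hrotE /= E.
Qed.

Lemma rot_inf_rel_cj (P Q : k.-tuple T) : rot_inf_rel e P Q -> exists U, cj P Q U.
Proof.
move=> [p [m /andP[_]]]; rewrite heap_equivE // => h.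
have [U hU] : exists U, cj P (iter m (@rotstep T e k) (P, p)).1 U.
  case: m {h} => [|m]; first by exists [::]; exact: cj_refl.
  have [-> _] := iter_rotstep P p m; apply: hrotn_cj; by rewrite size_tuple.
by exists U; apply: cj_heq hU => //; rewrite heq_refl.
Qed.

Lemma cj_rot_inf_rel (P Q : k.-tuple T) a b U :
  pyr a P -> pyr b Q -> cj P Q U -> rot_inf_rel e P Q.
Proof.
move=> pP pQ h; have cn := pyr_conn e_sym pP.
have [i iP hi] := hrotn_surj e_sym cn pQ h.
have ik : i < k by rewrite size_tuple in iP.
(* One step more than [size P], because [hrotn m] performs [m + 1] rotations. *)
exists (Ordinal ik), (size P).+1 => /=; rewrite !heap_equivE //.
have [E1 E2] := iter_rotstep P (Ordinal ik) (size P).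
rewrite iterS in E1 E2; rewrite rotAE E1 E2 /= hi andbT.
have [x [c [y [E <-]]]] := split_at iP.
by have [_ -> _] := hrotn_spec e_sym E cn; rewrite heq_refl.
Qed.

Variable r : T -> nat.
(** Conjugacy replaces the rotation relation on tuples: it is visibly transitive, and it compares
    words without fixing their length in a type. *)
Definition lyndon_word (s : seq T) :=
  [/\ standard e r s, (exists a, pyr a s), ~ per s &
      forall Q, standard e r Q -> (exists b, pyr b Q) -> (exists U, cj s Q U) -> lexle r s Q].

Lemma lyndon_setP (w : k.-tuple T) : reflect (lyndon_word w) (w \in lyndon_set e r k).
Proof.
have pos a (v : k.-tuple T) : pyr a v -> 0 < k.
  by move/pyr_mem; rewrite -{2}(size_tuple v); case: (tval v).
rewrite inE; apply: (iffP andP) => [[st /pboolP[/(pyramidP e_sym)[a pa] np lex]]|].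
  split=> //; first by exists a.
    by move/(periodicP e_sym _ (pos _ _ pa)); apply/negP.
  move=> Q sQ pQ [U hU]; have sz : size Q == k by rewrite -(cj_size hU) size_tuple.
  apply: (lex (Tuple sz)) => //; first exact/(pyramidP e_sym).
  by left; have [b pb] := pQ; apply: (@cj_rot_inf_rel _ (Tuple sz) a b U).
move=> [st [a pa] np lex]; split=> //; apply/pboolP; split.
- by apply/(pyramidP e_sym); exists a.
- by apply/negP => /(periodicP e_sym _ (pos _ _ pa)).
move=> Q sQ /(pyramidP e_sym) pQ [/rot_inf_rel_cj|/rot_inf_rel_cj [U /(cj_sym e_sym)]] hU;
  exact: lex.
Qed.

End Tuples.
End RotationLink.

(** * Counting heaps, pyramids and Lyndon heaps *)

Lemma size_bij (A B : eqType) (f : A -> B) (l : seq A) (l' : seq B) :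
  uniq l -> uniq l' -> {in l, forall x, f x \in l'} -> {in l &, injective f} ->
  (forall y, y \in l' -> exists2 x, x \in l & f x = y) -> size l = size l'.
Proof.
move=> ul ul' fl finj fsurj; rewrite -(size_map f); apply/eqP.
rewrite -uniq_size_uniq ?map_inj_in_uniq // => y.
by apply/idP/mapP => [/fsurj[x xl <-]|[x xl ->]]; [exists x|exact: fl].
Qed.

Lemma size_fibers (A : eqType) (D : seq nat) (P : nat -> pred A) (l : seq A) :
  (forall x, x \in l -> count (P^~ x) D = 1) -> size l = \sum_(d <- D) count (P d) l.
Proof.
elim: l => [|x l IH] h; first by rewrite big1.
rewrite /= big_split /= -IH => [|y yl]; last by apply: h; rewrite inE yl orbT.
rewrite -add1n; congr addn; rewrite -(h x (mem_head _ _)) -sum1_count big_mkcond.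
by apply: eq_bigr => d _; case: (P d x).
Qed.

Lemma count_eq1 (D : seq nat) (p : pred nat) d : uniq D -> d \in D -> p d ->
  (forall d', d' \in D -> p d' -> d' = d) -> count p D = 1.
Proof.
move=> uD dD pd h; rewrite -[RHS](_ : (d \in D) = 1 :> nat); last by rewrite dD.
rewrite -count_uniq_mem //; apply: eq_in_count => d' d'D /=.
by apply/idP/eqP => [/(h _ d'D)|->].
Qed.

Section Counting.
Variables (T : finType) (e : rel T) (r : T -> nat).
Hypotheses (e_sym : symmetric e) (r_inj : injective r).
Implicit Types (s t u v x y z A : seq T) (a b c : T).
Local Notation heq := (heq e).
Local Notation pyr := (pyr e).
Local Notation cj := (cj e).
Local Notation per := (per e).
Local Notation rch := (rch e).
Local Notation unr := (unr e).
Local Notation std := (std e_sym r_inj).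
Local Notation standard := (standard e r).
Local Notation lyndon_word := (lyndon_word e r).

Definition heap_words n : seq (seq T) := [seq tval w | w : n.-tuple T <- enum {: n.-tuple T} & standard w].
Definition pyramid_words n := [seq s <- heap_words n | [exists a, pyr a s]].
Definition aperiodic_words n := [seq s <- pyramid_words n | ~~ pbool (per s)].
Definition lyndon_words n := [seq tval w | w : n.-tuple T <- enum (lyndon_set e r n)].

Lemma mem_heap_words n s : (s \in heap_words n) = (size s == n) && standard s.
Proof.
apply/mapP/andP => [[w]|[sz st]].
  by rewrite mem_filter => /andP[st _] ->; rewrite size_tuple.
by exists (Tuple sz) => //; rewrite mem_filter mem_enum st.
Qed.

Lemma uniq_heap_words n : uniq (heap_words n).
Proof. by rewrite map_inj_uniq => [|? ? /val_inj] //; apply: filter_uniq; exact: enum_uniq. Qed.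

Lemma mem_pyramid_words n s : reflect [/\ size s = n, standard s & exists a, pyr a s] (s \in pyramid_words n).
Proof.
rewrite mem_filter mem_heap_words; apply: (iffP and3P) => [[/existsP h /eqP]|[/eqP -> -> h]] //.
by split=> //; apply/existsP.
Qed.

Lemma mem_aperiodic_words n s : reflect [/\ size s = n, standard s, (exists a, pyr a s) & ~ per s] (s \in aperiodic_words n).
Proof.
rewrite mem_filter; apply: (iffP andP) => [[/pboolP np /mem_pyramid_words[]]|[h1 h2 h3 np]] //.
by split; [apply/pboolP|apply/mem_pyramid_words].
Qed.

Lemma mem_lyndon_words n s : reflect (size s = n /\ lyndon_word s) (s \in lyndon_words n).
Proof.
apply: (iffP mapP) => [[w]|[/eqP sz h]].
  by rewrite mem_enum => /(lyndon_setP e_sym) h ->; rewrite size_tuple.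
by exists (Tuple sz) => //; rewrite mem_enum; apply/(lyndon_setP e_sym).
Qed.

Lemma uniq_lyndon_words n : uniq (lyndon_words n).
Proof. by rewrite map_inj_uniq ?enum_uniq // => ? ? /val_inj. Qed.

Lemma size_lyndon_words n : size (lyndon_words n) = #|lyndon_set e r n|.
Proof. by rewrite size_map cardE. Qed.

Lemma std_inj s t : std s = std t -> heq s t.
Proof. by move=> h; rewrite (stdE e_sym r_inj) h. Qed.

Lemma std_heap_words s : std s \in heap_words (size s).
Proof. by rewrite mem_heap_words size_std eqxx std_standard. Qed.

Lemma pyr_std s a : pyr a (std s) = pyr a s.
Proof. by apply/esym/(pyr_heq e_sym)/heq_std. Qed.

(** [up s i] and [dn s i] are the factors [V_p] and [U] of the cut at the piece [p] of index [i]. *)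
Definition up s i := if drop i s is a :: y then a :: rch [:: a] y else [::].
Definition dn s i := if drop i s is a :: y then take i s ++ unr [:: a] y else s.

Lemma up_dn x a y : let s := x ++ a :: y in
  [/\ heq s (dn s (size x) ++ up s (size x)), pyr a (up s (size x)) &
      count_mem a (dn s (size x)) = count_mem a x].
Proof.
rewrite /= /up /dn drop_size_cat // take_size_cat //; split.
- exact: split_heq.
- exact: pyr_rch.
by rewrite count_cat count_unr addn0.
Qed.

Lemma marked_heaps n :
  n * size (heap_words n) = \sum_(k <- iota 0 n.+1) size (pyramid_words k) * size (heap_words (n - k)).
Proof.
pose L := [seq (s, i) | s <- heap_words n, i <- iota 0 n].
have LP s i : (s, i) \in L -> [/\ size s = n, standard s & exists x a y, s = x ++ a :: y /\ size x = i].
  move=> /allpairsP[[s' i'] [/= h1 h2 [-> ->]]]; move: h1 h2; rewrite mem_heap_words mem_iota add0n /=.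
  by move=> /andP[/eqP sz st] lt; split=> //; apply: split_at; rewrite sz.
have uL : uniq L.
  by apply: allpairs_uniq; rewrite ?uniq_heap_words ?iota_uniq // => -[? ?] [? ?] _ _ [-> ->].
have -> : n * size (heap_words n) = size L by rewrite size_allpairs size_iota mulnC.
rewrite (@size_fibers _ (iota 0 n.+1) (fun k (w : seq T * nat) => size (up w.1 w.2) == k)); last first.
  move=> [s i] /LP[sz _ [x [a [y [E <-]]]]]; apply: (@count_eq1 _ _ (size (up s (size x)))) => //.
  - exact: iota_uniq.
  - have [h _ _] := up_dn x a y; rewrite -E in h.
    by rewrite mem_iota leq0n add0n ltnS -sz (heq_size h) size_cat leq_addl.
  - by move=> d _ /eqP.
apply: eq_big_seq => k; rewrite mem_iota add0n ltnS => /= kn.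
rewrite -size_filter mulnC -(size_allpairs pair).
apply: (@size_bij _ _ (fun w : seq T * nat => (std (dn w.1 w.2), std (up w.1 w.2)))).
- by rewrite filter_uniq.
- apply: allpairs_uniq; rewrite ?uniq_heap_words ?filter_uniq ?uniq_heap_words //.
  by move=> [? ?] [? ?] _ _ [-> ->].
- move=> [s i]; rewrite mem_filter => /andP[/eqP/= sk /LP[sz _ [x [a [y [E Ei]]]]]].
  have [h p _] := up_dn x a y; rewrite -E Ei in h p.
  apply: allpairs_f.
    have -> : n - k = size (dn s i) by rewrite -sz -sk (heq_size h) size_cat addnK.
    exact: std_heap_words.
  by apply/mem_pyramid_words; split; rewrite ?size_std ?std_standard //; exists a; rewrite pyr_std.
- move=> [s i] [s' i']; rewrite !mem_filter /=.
  move=> /andP[_ /LP[sz st [x [a [y [E Ei]]]]]] /andP[_ /LP[sz' st' [x' [a' [y' [E' Ei']]]]]].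
  move=> [/std_inj hd /std_inj hu].
  have [h p c] := up_dn x a y; rewrite -E Ei in h p c.
  have [h' p' c'] := up_dn x' a' y'; rewrite -E' Ei' in h' p' c'.
  have Ess : s = s'.
    apply: (standard_heq e_sym st st'); apply: (heq_trans h); apply: heqS.
    by apply: (heq_trans h'); apply: heqS; apply: heq_cat.
  have Ea : a' = a by apply: (pyr_uniq p'); rewrite -(pyr_heq e_sym a hu).
  subst a'; rewrite -Ess; suff -> : i = i' by []; rewrite -Ei -Ei'; apply: (@occ_inj _ a _ y _ y'); first by rewrite -E -E'.
  by rewrite -c -c' (heq_count hd).
move=> [u v] /allpairsP[[u' v'] [/= hu /mem_pyramid_words[sv stv [a pa]] [Eu Ev]]]; subst u' v'.
move: hu; rewrite mem_heap_words => /andP[/eqP su stu].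
have sz : size (std (u ++ v)) = n by rewrite size_std size_cat su sv subnK.
(* Inverse of the cut: the standard word of [u ++ v] may order the pieces differently, so the marked
   piece is recovered as the occurrence of [a] preceded by as many [a] as [u] contains. *)
have lt : count_mem a u < count_mem a (std (u ++ v)).
  rewrite -(heq_count (heq_std e_sym r_inj (u ++ v))) count_cat -[X in X < _]addn0 ltn_add2l.
  by rewrite -has_count has_pred1 (pyr_mem pa).
have [x [y [E c]]] := nth_occ lt; have [h p c'] := up_dn x a y; rewrite -E in h p c'.
have hh : heq (dn (std (u ++ v)) (size x) ++ up (std (u ++ v)) (size x)) (u ++ v).
  by apply: heqS; apply: (heq_trans (heq_std e_sym r_inj _)).
have [|h1 h2] := heq_split_uniq e_sym hh p pa; first by rewrite c'.
exists (std (u ++ v), size x).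
  rewrite mem_filter /= (heq_size h2) sv eqxx; apply: allpairs_f.
    by rewrite mem_heap_words sz eqxx std_standard.
  by rewrite mem_iota add0n -[X in _ < X]sz E size_cat /=; lia.
by congr pair; rewrite -[RHS](std_id e_sym r_inj) //; apply/eqP; rewrite -stdE.
Qed.

(** Pyramids are sorted by the size [d] of their aperiodic root, which [root_uniq] makes well
    defined. *)
Lemma pyramids_roots n : 0 < n ->
  size (pyramid_words n) = \sum_(d <- [seq d <- iota 1 n | d %| n]) size (aperiodic_words d).
Proof.
move=> n0.
pose P d := [pred s : seq T | has (fun q => heq s (wpow q (n %/ d))) (aperiodic_words d)].
rewrite (@size_fibers _ [seq d <- iota 1 n | d %| n] P); last first.
  move=> s /mem_pyramid_words[sz st [a pa]].
  have [q [m [m0 pq nq hq]]] := root_exists e_sym pa.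
  have E : n = m * size q by have := heq_size hq; rewrite size_wpow sz.
  have q0 : 0 < size q by have := pyr_mem pq; case: (q).
  apply: (@count_eq1 _ _ (size q)).
  - by rewrite filter_uniq ?iota_uniq.
  - rewrite mem_filter mem_iota E dvdn_mull // q0 add1n ltnS.
    by rewrite leq_pmull.
  - apply/hasP; exists (std q).
      apply/mem_aperiodic_words; split; rewrite ?size_std ?std_standard //.
        by exists a; rewrite pyr_std.
      by move/(per_heq (heqS (heq_std e_sym r_inj q))).
    by rewrite E mulnK //; apply: (heq_trans hq); apply: heq_wpow; apply: heq_std.
  move=> d; rewrite mem_filter mem_iota => /and3P[dn d0 _] /hasP[q' /mem_aperiodic_words[sq' _ _ nq'] hq'].
  have m'0 : 0 < n %/ d by rewrite divn_gt0 // dvdn_leq.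
  rewrite -sq'; apply: (@heq_size _ e); apply: heqS.
  apply: (root_uniq e_sym m0 m'0 pq nq nq').
  exact: heq_trans (heqS hq) hq'.
apply: eq_big_seq => d; rewrite mem_filter mem_iota => /and3P[dn d0 _].
have m0 : 0 < n %/ d by rewrite divn_gt0 // dvdn_leq.
rewrite -size_filter; apply/esym.
apply: (@size_bij _ _ (fun q => std (wpow q (n %/ d)))).
- by rewrite !filter_uniq ?uniq_heap_words.
- by rewrite !filter_uniq ?uniq_heap_words.
- move=> q qa; have /mem_aperiodic_words[sq stq [a pa] nq] := qa; rewrite mem_filter; apply/andP; split.
    by apply/hasP; exists q => //; apply/heqS/heq_std.
  apply/mem_pyramid_words; split; rewrite ?size_std ?std_standard //; first by rewrite size_wpow sq divnK.
  by exists a; rewrite pyr_std pyr_wpow.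
- move=> q q' /mem_aperiodic_words[sq stq [a pa] nq] /mem_aperiodic_words[sq' stq' _ nq'] /std_inj h.
  by apply: (standard_heq e_sym stq stq'); apply: (root_uniq e_sym m0 m0 pa nq nq' h).
move=> s; rewrite mem_filter => /andP[/hasP[q qa h] /mem_pyramid_words[sz st _]].
exists q => //; rewrite -[RHS](std_id e_sym r_inj) //; apply/eqP; rewrite -stdE.
exact: heqS.
Qed.

Lemma aperiodic_lyndon d : size (aperiodic_words d) = d * size (lyndon_words d).
Proof.
rewrite mulnC -[X in _ * X](size_iota 0 d) -(size_allpairs pair); apply/esym.
have LP s i : (s, i) \in [seq (s, i) | s <- lyndon_words d, i <- iota 0 d] -> 
    [/\ size s = d, lyndon_word s & i < size s].
  move=> /allpairsP[[s' i'] [/= /mem_lyndon_words[sz h] + [-> ->]]].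
  by rewrite mem_iota add0n sz.
have spec s i : i < size s -> lyndon_word s -> exists a U,
    pyr a (hrotn e (size s) s i) /\ cj s (hrotn e (size s) s i) U.
  move=> /split_at[x [a [y [E <-]]]] [_ [b pb] _ _].
  by have [p _ [U [hU _]]] := hrotn_spec e_sym E (pyr_conn e_sym pb); exists a, U.
apply: (@size_bij _ _ (fun w : seq T * nat => std (hrotn e (size w.1) w.1 w.2))).
- apply: allpairs_uniq; rewrite ?uniq_lyndon_words ?iota_uniq //.
  by move=> [? ?] [? ?] _ _ [-> ->].
- by rewrite !filter_uniq ?uniq_heap_words.
- move=> [s i] /LP /= [sz h lt]; have [a [U [p hU]]] := spec _ _ lt h.
  apply/mem_aperiodic_words; split; rewrite ?size_std ?std_standard //.
  + by rewrite -(cj_size hU).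
  + by exists a; rewrite pyr_std.
  move/(per_heq (heqS (heq_std e_sym r_inj _))) => np.
  by have [V hV] := cj_sym e_sym hU; case: h => _ _ nps _; apply: nps; apply: cj_per hV np.
- move=> [s i] [s' i'] /LP /= [sz h lt] /LP /= [sz' h' lt'] /std_inj E.
  have [a [U [p hU]]] := spec _ _ lt h; have [a' [U' [p' hU']]] := spec _ _ lt' h'.
  have [V' hV'] := cj_sym e_sym hU'.
  have hss : cj s s' (U ++ V').
    by apply: cj_trans hU _; apply: cj_heq hV'; rewrite ?heq_refl // heqS.
  have [W hW] := cj_sym e_sym hss.
  have Ess : s = s'.
    case: (h) => st p1 _ lex; case: (h') => st' p1' _ lex'.
    apply: (lexle_anti (r := r)); first by apply: lex => //; exists (U ++ V').
    by apply: lex' => //; exists W.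
  rewrite -Ess in E lt' *; suff -> : i = i' by []; case: h => _ [b pb] np _.
  exact: (hrotn_inj e_sym (pyr_conn e_sym pb) np).
move=> q /mem_aperiodic_words[sq stq [a pa] nq].
(* The rotation class of [q]; the Lyndon word is its least element. *)
pose C := [seq s <- pyramid_words d | pbool (exists U, cj q s U)].
have CP s : reflect [/\ size s = d, standard s, (exists a, pyr a s) & exists U, cj q s U] (s \in C).
  rewrite mem_filter; apply: (iffP andP) => [[/pboolP hc /mem_pyramid_words[]]|[h1 h2 h3 hc]] //.
  by split; [apply/pboolP|apply/mem_pyramid_words].
have [|l /CP[sl stl [b pb] [U hU]] lmin] := @lexle_min _ _ r_inj C q.
  by apply/CP; split=> //; [exists a|exists [::]; exact: cj_refl].
have [V hV] := cj_sym e_sym hU.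
have ll : lyndon_word l.
  split=> //; first by exists b.
    by move/(cj_per e_sym hV).
  move=> Q stQ pQ [W hW]; apply: lmin; apply/CP; split=> //.
    by rewrite -(cj_size hW).
  by exists (U ++ W); apply: cj_trans hU hW.
have [i il hi] := hrotn_surj e_sym (pyr_conn e_sym pb) pa hV.
exists (l, i); last first.
  by rewrite -[RHS](std_id e_sym r_inj) //; apply/eqP; rewrite -stdE.
apply: allpairs_f; first by apply/mem_lyndon_words.
by rewrite mem_iota add0n -sl.
Qed.

End Counting.

(** * Cartier-Foata identity *)

Local Open Scope ring_scope.

Lemma prod_setmem (R : comNzRingType) (T : finType) (x : R) (M J : {set T}) :
  \prod_(i : T) (if i \in J then x *+ (i \in M) else 1) = x ^+ #|J| *+ (J \subset M).
Proof.
rewrite -big_mkcond /=; case: (boolP (J \subset M)) => JM.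
  rewrite mulr1n -prodr_const; apply: eq_bigr => i iJ.
  by rewrite (subsetP JM).
have /subsetPn[i iJ iM] := JM.
by rewrite (bigD1 i) //= (negbTE iM) mulr0n mul0r.
Qed.

Lemma sum_sign_subset (R : comNzRingType) (T : finType) (M : {set T}) :
  \sum_(S : {set T} | S \subset M) (-1) ^+ #|S| = (M == set0)%:R :> R.
Proof.
have E := @bigA_distr R 0 1 *%R +%R T (fun i => (-1) *+ (i \in M)) (fun=> 1).
have -> : \sum_(S : {set T} | S \subset M) (-1) ^+ #|S| =
    \prod_(i : T) ((-1) *+ (i \in M) + 1) :> R.
  rewrite E big_mkcond; apply: eq_bigr => S _; rewrite prod_setmem.
  by case: (S \subset M).
case: (set_0Vmem M) => [->|[i iM]].
  by rewrite eqxx big1 // => i _; rewrite inE mulr0n add0r.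
rewrite (bigD1 i) //= iM addNr mul0r; case: eqP => // M0.
by rewrite M0 inE in iM.
Qed.

(** The sieve that detects covering of all vertices; it serves once for colorings and once for
    families of Lyndon heaps. *)
Lemma sum_sign_supset (R : comNzRingType) (T : finType) (U : {set T}) :
  \sum_(W : {set T}) (-1) ^+ #|~: W| * (U \subset W)%:R = (U == setT)%:R :> R.
Proof.
rewrite (reindex_inj (@setC_inj T)) /=.
rewrite (eq_bigr (fun S : {set T} => if S \subset ~: U then (-1) ^+ #|S| else 0)) => [|S _].
  rewrite -big_mkcond sum_sign_subset; congr (nat_of_bool _)%:R.
  by rewrite -subset0 -setCT setCS subTset.
rewrite setCK -{1}(setCK U) setCS; case: ifP => _; by rewrite ?mulr1 ?mulr0.
Qed.

Section CartierFoata.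
Variables (T : finType) (e : rel T) (r : T -> nat).
Hypotheses (e_sym : symmetric e) (e_irr : irreflexive e) (r_inj : injective r).
Implicit Types (s t u v x y z A : seq T) (a b c : T) (S : {set T}).
Local Notation heq := (heq e).
Local Notation heap_words := (heap_words e r).

Definition indep S := [forall b in S, forall c in S, ~~ e b c].
(** The coefficients of the independence polynomial. *)
Definition nind k := #|[set S : {set T} | indep S & #|S| == k]|.

Lemma indepP S : reflect {in S &, forall b c, ~~ e b c} (indep S).
Proof.
apply: (iffP forall_inP) => [h b c bS cS|h b bS]; first by have /forall_inP := h b bS; apply.
by apply/forall_inP => c cS; exact: h.
Qed.

Lemma ismin_indep b c s : ismin e b s -> ismin e c s -> ~~ e b c.
Proof.
case: (eqVneq b c) => [->|bc]; first by rewrite e_irr.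
have half b' c' : b' != c' -> (index b' s < index c' s)%N ->
    ismin e b' s -> ismin e c' s -> ~~ e b' c'.
  move=> bc' lt /andP[bs _] /andP[_ /hasPn h].
  have : b' \in take (index c' s) s by rewrite in_take.
  by move/h; rewrite /dep eq_sym (negbTE bc') e_sym.
move=> hb hc; case: (ltngtP (index b s) (index c s)) => [lt|lt|E].
- exact: half.
- by rewrite e_sym half // eq_sym.
case/andP: hb => bs _; case/andP: hc => cs _.
by move: bc; rewrite -{1}(nth_index b bs) E nth_index // eqxx.
Qed.

Lemma ismin_cons b c t : b != c -> ismin e c (b :: t) -> ismin e c t && ~~ dep e c b.
Proof.
move=> bc; rewrite /ismin inE eq_sym (negbTE bc) /= (negbTE bc) /= negb_or.
by case/and3P=> -> -> ->.
Qed.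

Lemma mins_factor (l s : seq T) : uniq l -> {in l, forall b, ismin e b s} ->
  exists t, heq s (l ++ t).
Proof.
elim: l s => [|b l IH] s /=; first by exists s; rewrite heq_refl.
move=> /andP[bl ul] h; have /(isminP e_sym)[t ht] := h b (mem_head _ _).
have [//||t' ht'] := IH t; last first.
  by exists t'; apply: (heq_trans ht); rewrite heq_cons.
move=> c cl; have bc : b != c by apply: contraNneq bl => ->.
have := h c; rewrite inE cl orbT (ismin_heq e_sym c ht) => /(_ isT).
by case/(ismin_cons bc)/andP.
Qed.

Lemma ismin_enum S t b : indep S -> b \in S -> ismin e b (enum S ++ t).
Proof.
move=> /indepP iS bS; rewrite /ismin mem_cat mem_enum bS /=.
rewrite index_cat mem_enum bS take_cat index_mem mem_enum bS.
apply/hasPn => c ce; have cS : c \in S by rewrite -mem_enum; exact: mem_take ce.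
rewrite /dep negb_or iS // andbT; apply: contraL ce => /eqP <-.
by rewrite in_take ?mem_enum // ltnn.
Qed.

Definition mins s := [set b | ismin e b s].

(** Letters that are all minimal are pairwise independent and can be stripped off the bottom
    together, leaving an arbitrary heap. *)
Lemma count_mins n S :
  count (fun s => S \subset mins s) (heap_words n) =
  if indep S && (#|S| <= n)%N then size (heap_words (n - #|S|)) else 0%N.
Proof.
case: ifP => [/andP[iS le]|h]; last first.
  apply/eqP; rewrite -leqn0 leqNgt -has_count; apply/negP => /hasP[s shp /subsetP sub].
  have hm b : b \in S -> ismin e b s by move=> /sub; rewrite inE.
  have iS : indep S by apply/indepP => b c /hm hb /hm hc; exact: ismin_indep hb hc.
  have [||t ht] := @mins_factor (enum S) s; first exact: enum_uniq.
    by move=> b; rewrite mem_enum => /hm.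
  have : (#|S| <= n)%N.
    move: shp; rewrite mem_heap_words => /andP[/eqP <- _].
    by rewrite (heq_size ht) size_cat -cardE leq_addr.
  by rewrite iS /= in h; rewrite h.
rewrite -size_filter; apply/esym.
apply: (@size_bij _ _ (fun t => std e_sym r_inj (enum S ++ t))).
- exact: uniq_heap_words.
- by rewrite filter_uniq ?uniq_heap_words.
- move=> t; rewrite mem_heap_words => /andP[/eqP st _]; rewrite mem_filter mem_heap_words std_standard size_std.
  rewrite size_cat -cardE st subnKC // eqxx !andbT.
  apply/subsetP => b bS; rewrite inE -(ismin_heq e_sym b (heq_std e_sym r_inj _)).
  exact: ismin_enum.
- move=> t t'; rewrite !mem_heap_words => /andP[_ st] /andP[_ st'] /std_inj.
  by rewrite heq_catI; exact: (standard_heq e_sym st st').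
move=> s; rewrite mem_filter mem_heap_words => /and3P[/subsetP sub /eqP sz st].
have [||t ht] := @mins_factor (enum S) s; first exact: enum_uniq.
  by move=> b; rewrite mem_enum => /sub; rewrite inE.
exists (std e_sym r_inj t).
  rewrite mem_heap_words std_standard andbT size_std; have := heq_size ht.
  by rewrite sz size_cat -cardE => ->; rewrite addKn.
rewrite -[RHS](std_id e_sym r_inj) //; apply/eqP; rewrite -stdE; apply: heqS.
by apply: (heq_trans ht); rewrite heq_catI heq_std.
Qed.

(** Each heap is weighted by the signed sum over sets of its minimal letters, which vanishes unless
    the heap is empty; exchanging the sums gives the convolution. *)
Lemma cartier_foata (R : comNzRingType) n :
  \sum_(0 <= k < n.+1) (-1) ^+ k * (nind k * size (heap_words (n - k)))%:R = (n == 0%N)%:R :> R.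
Proof.
have -> : (n == 0%N)%:R = \sum_(s <- heap_words n) \sum_(S : {set T} | S \subset mins s) (-1) ^+ #|S| :> R.
  rewrite (eq_big_seq (fun s => (n == 0%N)%:R)) => [|s]; last first.
    rewrite mem_heap_words => /andP[/eqP <- _]; rewrite sum_sign_subset; congr (nat_of_bool _)%:R.
    case: s => [|a s]; last first.
      have -> : (size (a :: s) == 0%N) = false by [].
      apply/negbTE/eqP => /setP/(_ a).
      by rewrite !inE ismin_head.
    by apply/eqP/setP => b; rewrite !inE /ismin.
  rewrite big_const_seq count_predT; case: n => [|n]; last by elim: size => //= m <-; rewrite add0r.
  suff -> : heap_words 0 = [:: [::]] by rewrite /= addr0.
  apply/perm_small_eq => //; apply: uniq_perm; rewrite ?uniq_heap_words // => s.
  rewrite mem_heap_words inE size_eq0; case: eqP => //= ->.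
  by apply/(standardP e_sym) => t /heq_size /esym /size0nil->.
under [RHS]eq_bigr => s _ do rewrite big_mkcond /=.
rewrite exchange_big /=.
have H S : \sum_(s <- heap_words n) (if S \subset mins s then (-1) ^+ #|S| else 0) =
    (if indep S && (#|S| <= n)%N then (-1) ^+ #|S| * (size (heap_words (n - #|S|)))%:R else 0) :> R.
  rewrite -big_mkcond /= big_const_seq iter_addr_0 count_mins.
  by case: ifP; rewrite ?mulr0n // mulr_natr.
under [RHS]eq_bigr => S _ do rewrite H.
rewrite -big_mkcond big_mkord (partition_big (fun S : {set T} => inord #|S| : 'I_n.+1) predT) //=.
apply: eq_bigr => k _; rewrite /nind.
rewrite (eq_bigl (fun S => S \in [set S | indep S & #|S| == k])) => [|S]; last first.
  rewrite inE; case: (boolP (indep S)) => //= iS; apply/andP/eqP => [[le /eqP <-]|E].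
    by rewrite inordK.
  by rewrite E -ltnS ltn_ord; split=> //; apply/eqP/val_inj; rewrite /= inordK // E.
rewrite (eq_bigr (fun S => (-1) ^+ k * (size (heap_words (n - k)))%:R)) => [|S]; last first.
  by rewrite inE => /andP[_ /eqP ->].
by rewrite sumr_const natrM -[RHS]mulr_natr; ring.
Qed.

End CartierFoata.

(** * Univariate generating functions *)

Section Truncated.
Variable N : nat.
Implicit Types p q s t A B : {poly rat}.

Definition peq p q := forall i, (i < N)%N -> p`_i = q`_i.

Lemma peq_sym p q : peq p q -> peq q p. Proof. by move=> h i iN; rewrite h. Qed.
Lemma peq_trans q p s : peq p q -> peq q s -> peq p s.
Proof. by move=> h1 h2 i iN; rewrite h1 ?h2. Qed.

Lemma peqD p q s t : peq p q -> peq s t -> peq (p + s) (q + t).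
Proof. by move=> h1 h2 i iN; rewrite !coefD h1 ?h2. Qed.

Lemma peqN p q : peq p q -> peq (- p) (- q).
Proof. by move=> h i iN; rewrite !coefN h. Qed.

Lemma peqM p q s t : peq p q -> peq s t -> peq (p * s) (q * t).
Proof.
move=> h1 h2 i iN; rewrite !coefM; apply: eq_bigr => j _.
have ji : (j <= i)%N by rewrite -ltnS.
by rewrite h1 ?h2 // (leq_ltn_trans _ iN) // leq_subr.
Qed.

Lemma peqX p q n : peq p q -> peq (p ^+ n) (q ^+ n).
Proof. by move=> h; elim: n => // n IH; rewrite !exprS; apply: peqM. Qed.

Lemma peq_prod (I : Type) (l : seq I) (P : pred I) (F G : I -> {poly rat}) :
  (forall i, P i -> peq (F i) (G i)) -> peq (\prod_(i <- l | P i) F i) (\prod_(i <- l | P i) G i).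
Proof. by move=> h; elim/big_ind2: _ => // *; apply: peqM. Qed.

(* [A] is the logarithmic derivative [x p' / p] modulo [x^N]. *)
Definition logder p A := peq ('X * p^`()) (A * p).

Lemma coefXderiv p i : ('X * p^`())`_i = i%:R * p`_i.
Proof.
by rewrite coefXM; case: i => [|i] /=; rewrite ?mul0r // coef_deriv mulr_natl.
Qed.

Lemma logder1 : logder 1 0.
Proof. by rewrite /logder derivE mulr0 mul0r. Qed.

Lemma logderM p q A B : logder p A -> logder q B -> logder (p * q) (A + B).
Proof.
move=> hp hq; rewrite /logder derivM mulrDr mulrDl.
apply: peqD.
  by rewrite mulrA [A * (p * q)]mulrA; apply: peqM.
by rewrite mulrCA [B * _]mulrCA; apply: peqM.
Qed.

Lemma logderX p A n : logder p A -> logder (p ^+ n) (A *+ n).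
Proof.
move=> h; elim: n => [|n IH]; first exact: logder1.
by rewrite exprS mulrS; apply: logderM.
Qed.

Lemma logder_prod (I : Type) (l : seq I) (P : pred I) (F A : I -> {poly rat}) :
  (forall i, P i -> logder (F i) (A i)) ->
  logder (\prod_(i <- l | P i) F i) (\sum_(i <- l | P i) A i).
Proof. by move=> h; elim/big_ind2: _ => [||//]; [exact: logder1|by move=> *; apply: logderM]. Qed.

Lemma logder_inv p q A : peq (p * q) 1 -> logder q A -> logder p (- A).
Proof.
move=> pq hq.
have h1 : peq ('X * (p * q)^`()) 0.
  by move=> i iN; rewrite coefXderiv pq // coef1 coef0; case: i {iN} => [|i]; rewrite ?mul0r ?mulr0.
have h2 : peq ('X * p^`() * q) (- A * p * q).
  have -> : 'X * p^`() * q = 'X * (p * q)^`() - 'X * q^`() * p by rewrite derivM; ring.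
  have -> : - A * p * q = 0 - A * q * p by ring.
  by apply: peqD => //; apply: peqN; apply: peqM.
have -> : logder p (- A) = peq ('X * p^`() * 1) (- A * p * 1) by rewrite !mulr1.
have h3 : peq ('X * p^`() * q * p) (- A * p * q * p) by apply: peqM.
have qp : peq (q * p) 1 by rewrite mulrC.
apply: (@peq_trans ('X * p^`() * (q * p))); first by apply: peqM => //; exact: peq_sym.
rewrite mulrA; apply: peq_trans h3 _; rewrite -[_ * q * p]mulrA.
by apply: peqM.
Qed.

(** As [A] has no constant term, [i] times the [i]-th coefficient is a combination of lower
    coefficients, and [i] is invertible in [rat]. *)
Lemma logder_uniq p q A B : peq A B -> A`_0 = 0 -> p`_0 = q`_0 ->
  logder p A -> logder q B -> peq p q.
Proof.
move=> AB A0 pq0 hp hq i; elim/ltn_ind: i => -[//|i] IH iN.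
have := hp _ iN; have := hq _ iN; rewrite !coefXderiv !coefM big_ord_recl /= -AB ?(ltn_trans _ iN) //.
rewrite [X in _ -> _ = X -> _]big_ord_recl /= A0 !mul0r !add0r => Eq Ep.
have i0 : (i.+1%:R : rat) != 0 by rewrite pnatr_eq0.
apply: (mulfI i0); rewrite Ep Eq; apply: eq_bigr => j _.
rewrite /bump /= add1n subSS AB ?(leq_ltn_trans _ iN) // ?IH //.
  by rewrite ltnS leq_subr.
by rewrite (leq_ltn_trans _ iN) // (leq_trans (leq_subr _ _)).
Qed.

Lemma logder_geom k : (0 < k)%N ->
  logder (1 - 'X^k) (- (k%:R *: \sum_(1 <= m < N) 'X^(k * m))).
Proof.
move=> k0; rewrite /logder; case: (posnP N) => [N0|N0].
  by move=> i; rewrite N0.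
(* The product telescopes; the leftover [x^(k N)] is invisible modulo [x^N]. *)
have -> : - (k%:R *: \sum_(1 <= m < N) 'X^(k * m)) * (1 - 'X^k) =
    k%:R *: ('X^(k * N) - 'X^k) :> {poly rat}.
  rewrite mulNr -scalerAl -scalerN; congr (_ *: _).
  case: N N0 => // n _; elim: n => [|n IH]; first by rewrite big_geq // mul0r muln1 subrr oppr0.
  rewrite big_nat_recr //= mulrDl opprD IH.
  have -> : 'X^(k * n.+2) = 'X^(k * n.+1) * 'X^k :> {poly rat} by rewrite -exprD -mulnSr.
  ring.
have -> : 'X * (1 - 'X^k)^`() = k%:R *: (0 - 'X^k) :> {poly rat}.
  rewrite derivB derivXn derivC !sub0r -mulr_natl mulrN scalerN; congr (- _).
  rewrite mulrCA -exprS prednK // -mul_polyC; congr (_ * _).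
  by rewrite polyC_natr.
move=> i iN; rewrite !coefZ !coefB !coefXn.
have -> : (i == (k * N)%N) = false by apply/negbTE; rewrite neq_ltn (leq_trans iN) // leq_pmull.
by rewrite coef0.
Qed.

Lemma peq1_Xn n : (N <= n)%N -> peq (1 + 'X^n) 1.
Proof.
move=> h i iN; rewrite coefD coefXn ltn_eqF ?addr0 //; exact: leq_trans h.
Qed.

End Truncated.

(** * The independence polynomial as a product over Lyndon heaps *)

Section Univariate.
Variables (T : finType) (e : rel T) (r : T -> nat).
Hypotheses (e_sym : symmetric e) (e_irr : irreflexive e) (r_inj : injective r).
Variable N : nat.
Local Notation heap_words := (heap_words e r).
Local Notation L k := #|lyndon_set e r k|.
Local Notation peq := (peq N).
Local Notation logder := (logder N).

Definition Ipoly : {poly rat} := \poly_(k < N) (nind e k)%:R.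
Definition Ineg : {poly rat} := \poly_(k < N) ((-1) ^+ k * (nind e k)%:R).
Definition Hpoly : {poly rat} := \poly_(k < N) (size (heap_words k))%:R.
Definition Ppoly : {poly rat} := \poly_(k < N) (size (pyramid_words e r k))%:R.

Lemma Ineg_Hpoly : peq (Ineg * Hpoly) 1.
Proof.
move=> i iN; rewrite coefM coef1 -(cartier_foata e_sym e_irr r_inj rat i) big_mkord.
apply: eq_bigr => j _; have ji : (j <= i)%N by rewrite -ltnS.
rewrite !coef_poly (leq_ltn_trans ji iN) (leq_ltn_trans (leq_subr _ _) iN).
by rewrite natrM mulrA.
Qed.

Lemma logder_Hpoly : logder Hpoly Ppoly.
Proof.
move=> i iN; rewrite coefXderiv coef_poly iN -natrM (marked_heaps e_sym r_inj) coefM.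
rewrite -[in X in X = _](subn0 i.+1) -/(index_iota 0 i.+1) big_mkord natr_sum.
apply: eq_bigr => j _; have ji : (j <= i)%N by rewrite -ltnS.
by rewrite !coef_poly (leq_ltn_trans ji iN) (leq_ltn_trans (leq_subr _ _) iN) natrM.
Qed.

Lemma pyramid_words0 : size (pyramid_words e r 0) = 0%N.
Proof.
case E : (pyramid_words e r 0) => [//|s l]; have : s \in pyramid_words e r 0 by rewrite E mem_head.
by move=> /mem_pyramid_words[/size0nil -> _ [a /pyr_mem]].
Qed.

Lemma Ineg_prod : peq Ineg (\prod_(1 <= k < N) (1 - 'X^k) ^+ (L k)).
Proof.
case: (posnP N) => [N0|N0]; first by move=> i; rewrite N0.
pose A k : {poly rat} := - (k%:R *: \sum_(1 <= m < N) 'X^(k * m)).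
have hE : logder (\prod_(1 <= k < N) (1 - 'X^k) ^+ (L k)) (\sum_(1 <= k < N) A k *+ L k).
  rewrite !big_seq; apply: logder_prod => k; rewrite mem_index_iota => /andP[k0 _].
  by apply: logderX; apply: logder_geom.
apply: (logder_uniq _ _ _ (logder_inv Ineg_Hpoly logder_Hpoly) hE).
- move=> i iN; rewrite coefN coef_poly iN coef_sum.
  case: i iN => [|i] iN.
    rewrite pyramid_words0 oppr0 big1_seq // => k /andP[_]; rewrite mem_index_iota => /andP[k0 _].
    rewrite coefMn coefN coefZ coef_sum big1_seq ?mulr0 ?oppr0 ?mul0rn // => m /andP[_].
    by rewrite mem_index_iota coefXn => /andP[m0 _]; rewrite eq_sym muln_eq0 -!leqn0 leqNgt k0 leqNgt m0.
  rewrite (pyramids_roots e_sym r_inj) // natr_sum -sumrN big_filter.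
  have -> : iota 1 i.+1 = index_iota 1 i.+2 by rewrite /index_iota subSS subn0.
  (* Factors with [k] above [i + 1] do not reach this degree; among the others only divisors
     contribute, each through the single [m] with [k m = i + 1]. *)
  rewrite [RHS](big_cat_nat (n := i.+2)) //= [X in _ + X]big1_seq ?addr0; last first.
    move=> k /andP[_]; rewrite mem_index_iota => /andP[k0 _].
    rewrite coefMn coefN coefZ coef_sum big1_seq ?mulr0 ?oppr0 ?mul0rn // => m /andP[_].
    rewrite mem_index_iota coefXn => /andP[m0 _]; rewrite ltn_eqF //.
    by apply: leq_trans k0 _; apply: leq_pmulr.
  rewrite big_mkcond; apply: eq_big_seq => k; rewrite mem_index_iota => /andP[k0 ki].
  rewrite coefMn coefN coefZ coef_sum; case: ifP => [/dvdnP[m Em]|nd]; last first.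
    rewrite big1_seq ?mulr0 ?oppr0 ?mul0rn // => m _; rewrite coefXn.
    by case: eqP => // E; move: nd; rewrite E dvdn_mulr.
  have m0 : (0 < m)%N by move: Em; case: (m).
  have mN : (m < N)%N by apply: leq_ltn_trans iN; rewrite Em leq_pmulr.
  rewrite (bigD1_seq m) ?mem_index_iota ?m0 ?iota_uniq //= coefXn Em mulnC eqxx.
  rewrite big1 => [|m' /negbTE mm']; last by rewrite coefXn eqn_pmul2l // eq_sym mm'.
  by rewrite addr0 mulr1 (aperiodic_lyndon e_sym r_inj) size_lyndon_words natrM mulNrn mulr_natr.
- by rewrite coefN coef_poly N0 pyramid_words0 oppr0.
rewrite coef_poly N0 expr0 mul1r.
have -> : nind e 0 = 1%N.
  rewrite /nind (_ : [set S | _] = [set set0]) ?cards1 //; apply/setP => S; rewrite !inE.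
  rewrite cards_eq0; case: eqP => [->|]; rewrite ?andbF // andbT.
  by apply/indepP => b c; rewrite inE.
rewrite -horner_coef0 horner_prod big1_seq // => k /andP[_]; rewrite mem_index_iota => /andP[k0 _].
by rewrite horner_exp !hornerE /= expr0n gtn_eqF // subr0 expr1n.
Qed.

Lemma coef_comp_oppX (p : {poly rat}) i : (p \Po (- 'X))`_i = (-1) ^+ i * p`_i.
Proof.
have E j : ((- 'X : {poly rat}) ^+ j)`_i = (-1) ^+ j * (i == j)%:R.
  have -> : - 'X = (-1)%:P * 'X :> {poly rat} by rewrite polyCN mulN1r.
  by rewrite exprMn -polyC_exp coefCM coefXn.
rewrite coef_comp_poly; case: (ltnP i (size p)) => ip.
  rewrite (bigD1 (Ordinal ip)) //= E eqxx big1 => [|j ji]; first by rewrite mulr1 addr0 mulrC.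
  by rewrite E eq_sym -val_eqE /= in ji *; rewrite (negbTE ji) !mulr0.
rewrite (nth_default 0 ip) mulr0 big1 // => j _; rewrite E.
by rewrite gtn_eqF ?mulr0 // (leq_trans (ltn_ord j)).
Qed.

Lemma Ipoly_prod :
  peq Ipoly (\prod_(1 <= k < N) (1 - (- 'X) ^+ k) ^+ (L k)).
Proof.
have -> : \prod_(1 <= k < N) (1 - (- 'X) ^+ k) ^+ (L k) =
    (\prod_(1 <= k < N) (1 - 'X^k) ^+ (L k)) \Po (- 'X) :> {poly rat}.
  rewrite rmorph_prod; apply: eq_bigr => k _.
  by rewrite rmorphXn rmorphB rmorph1 rmorphXn /= comp_polyX.
move=> i iN; rewrite coef_comp_oppX -Ineg_prod // !coef_poly iN mulrA -exprD addnn.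
by rewrite -signr_odd odd_double mul1r.
Qed.

End Univariate.

(** * Inverting the factors of even index *)

Section EvenPart.
Variable N : nat.
Variable L : nat -> nat.
Local Notation peq := (peq N).

(** The exponent of [1 + x^k] once every [1 - x^h] with [h] even is expanded dyadically: it collects
    the [h] with [h 2^j = k], and the divisibility condition says that [k / 2^j] is even. *)
Definition dyadic k := (\sum_(0 <= j < k | 2 ^ j.+1 %| k) L (k %/ 2 ^ j))%N.

Lemma dyadic_bound k : (0 < k < N)%N ->
  dyadic k = (\sum_(0 <= j < N | 2 ^ j.+1 %| k) L (k %/ 2 ^ j))%N.
Proof.
move=> /andP[k0 kN]; rewrite /dyadic [RHS](big_cat_nat (n := k)) //=; last exact: ltnW.
rewrite [X in (_ + X)%N]big1_seq ?addn0 // => j /andP[+]; rewrite mem_index_iota => dv /andP[kj _].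
have := dvdn_leq k0 dv; have := ltn_expl j.+1 (isT : 1 < 2)%N; lia.
Qed.

Lemma telescope_dyadic h n :
  (1 - 'X^h) * \prod_(0 <= j < n) (1 + 'X^(h * 2 ^ j)) = 1 - 'X^(h * 2 ^ n) :> {poly rat}.
Proof.
elim: n => [|n IH]; first by rewrite big_geq // mulr1 muln1.
rewrite big_nat_recr //= mulrA IH expnSr mulnA muln2 -addnn exprD; ring.
Qed.

(** Substitute [k = h 2^j]; the extra factors on the right have [h 2^j] at least [N] and are trivial
    modulo [x^N]. *)
Lemma dyadic_reindex j : peq
  (\prod_(1 <= k < N | (2 ^ j.+1 %| k)%N) (1 + 'X^k) ^+ L (k %/ 2 ^ j))
  (\prod_(1 <= h < N | ~~ odd h) (1 + 'X^(h * 2 ^ j)) ^+ L h).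
Proof.
have p0 : (0 < 2 ^ j)%N by rewrite expn_gt0.
rewrite -big_filter.
have P : perm_eq [seq k <- index_iota 1 N | (2 ^ j.+1 %| k)%N]
    [seq (h * 2 ^ j)%N | h <- [seq h <- index_iota 1 N | ~~ odd h && (h * 2 ^ j < N)%N]].
  apply: uniq_perm; rewrite ?map_inj_uniq ?filter_uniq ?iota_uniq //.
    by move=> a b /eqP; rewrite eqn_pmul2r // => /eqP.
  move=> k; rewrite mem_filter mem_index_iota; apply/and3P/mapP => [[/dvdnP[q Eq] k0 kN]|[h]].
    have E : k = (q * 2 * 2 ^ j)%N by rewrite Eq expnS mulnA.
    exists (q * 2)%N => //; rewrite mem_filter mem_index_iota oddM andbF -E kN /=.
    have q0 : (0 < q)%N by move: k0; rewrite Eq; case: (q).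
    rewrite muln_gt0 q0 /=; apply: leq_ltn_trans kN; rewrite E leq_pmulr //.
  rewrite mem_filter mem_index_iota => /and3P[/andP[ho hN] h0 _] ->.
  rewrite muln_gt0 h0 p0 hN; split=> //.
  by rewrite expnS dvdn_pmul2r // dvdn2.
rewrite (perm_big _ P) big_map big_filter /= big_mkcondr /=.
apply: peq_prod => h ho; rewrite mulnK //; case: ltnP => // le.
apply: (@peq_trans _ (1 ^+ L h)); first by rewrite expr1n.
by apply/peqX/peq_sym/peq1_Xn.
Qed.

Lemma even_part : peq
  (\prod_(1 <= k < N | ~~ odd k) (1 - 'X^k) ^+ L k *
   \prod_(1 <= k < N | ~~ odd k) (1 + 'X^k) ^+ dyadic k) 1.
Proof.
have E : \prod_(1 <= k < N | ~~ odd k) (1 + 'X^k) ^+ dyadic k =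
    \prod_(0 <= j < N) \prod_(1 <= k < N | (2 ^ j.+1 %| k)%N) (1 + 'X^k) ^+ L (k %/ 2 ^ j) :> {poly rat}.
  rewrite (exchange_big_dep (fun k => ~~ odd k)) /=; last first.
    by move=> j k _; rewrite expnS => /(dvdn_trans (dvdn_mulr _ (dvdnn _))); rewrite dvdn2.
  rewrite big_seq_cond [RHS]big_seq_cond; apply: eq_bigr => k /andP[].
  by rewrite mem_index_iota => kN ko; rewrite dyadic_bound // expr_sum.
rewrite {}E; apply: (@peq_trans _ (\prod_(1 <= k < N | ~~ odd k) (1 - 'X^k) ^+ L k *
    \prod_(0 <= j < N) \prod_(1 <= h < N | ~~ odd h) (1 + 'X^(h * 2 ^ j)) ^+ L h)).
  by apply: peqM => //; apply: peq_prod => j _; exact: dyadic_reindex.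
rewrite exchange_big /= -big_split /=.
apply: (@peq_trans _ (\prod_(1 <= h < N | ~~ odd h) 1)); last by rewrite big1.
rewrite big_seq_cond [X in peq _ X]big_seq_cond.
apply: peq_prod => h /andP[]; rewrite mem_index_iota => /andP[h0 hN] _.
rewrite prodrXl -exprMn telescope_dyadic.
apply: (@peq_trans _ (1 ^+ L h)); last by rewrite expr1n.
apply: peqX; apply: (@peq_trans _ (1 - 0)); last by rewrite subr0.
apply: peqD => //; apply: peqN => i iN; rewrite coef0 coefXn ltn_eqF //.
apply: (leq_trans iN); apply: leq_trans (leq_pmull _ h0).
by apply: ltnW; apply: ltn_expl.
Qed.

End EvenPart.

(** The even factors stand on the left to keep both sides polynomial. *)
Lemma univariate_identity (T : finType) (e : rel T) (r : T -> nat) N :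
  symmetric e -> irreflexive e -> injective r ->
  peq N (Ipoly e N * \prod_(1 <= k < N | ~~ odd k) (1 + 'X^k) ^+ dyadic (fun h => #|lyndon_set e r h|) k)
    (\prod_(1 <= k < N | odd k) (1 + 'X^k) ^+ #|lyndon_set e r k|).
Proof.
move=> e_sym e_irr r_inj; set B := (X in _ * X).
apply: (@peq_trans _ ((\prod_(1 <= k < N) (1 - (- 'X) ^+ k) ^+ #|lyndon_set e r k|) * B)).
  by apply: peqM => //; exact: Ipoly_prod.
rewrite (bigID odd) /= -mulrA -[X in peq _ _ X]mulr1; apply: peqM.
  rewrite (eq_bigr (fun k => (1 + 'X^k) ^+ #|lyndon_set e r k|)) // => k ko.
  by rewrite exprNn -signr_odd ko expr1 mulN1r opprK.
rewrite (eq_bigr (fun k => (1 - 'X^k) ^+ #|lyndon_set e r k|)) => [|k ko].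
  exact: even_part.
by rewrite exprNn -signr_odd (negbTE ko) mul1r.
Qed.

(** * Multivariate truncated identities *)

(** This is the series of [(1 + x)^(-b)], by induction on [b] with Pascal's rule. *)
Lemma peq_pascal N b :
  peq N ((1 + 'X) ^+ b * \poly_(m < N) ((-1) ^+ m * (multichoose b m)%:R)) 1.
Proof.
elim: b => [|b IH] i iN.
  (* Truncated subtraction gives the right values at [b = 0]: ['C(0, 0) = 1] for [m = 0] and
     ['C(i, i.+1) = 0] for [m = i.+1]. *)
  rewrite mul1r coef_poly iN coef1 /multichoose; case: i {iN} => [|i]; first by rewrite mul1r.
  by rewrite add0n subn1 bin_small ?mulr0.
rewrite exprSr -mulrA -[RHS](IH i iN); apply: (@peqM N) iN => // {}i iN.
rewrite mulrDl mul1r coefD coefXM !coef_poly iN; case: i iN => [|i] iN.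
  by rewrite addr0 /multichoose !bin0.
rewrite (ltnW iN) /multichoose.
have -> : (b.+1 + i.+1 - 1 = (b + i).+1)%N by lia.
have -> : (b.+1 + i - 1 = b + i)%N by lia.
have -> : (b + i.+1 - 1 = b + i)%N by lia.
by rewrite /= binS natrD exprS; ring.
Qed.

Lemma peq_binomial N b : peq N ((1 + 'X) ^+ b) (\poly_(m < N) ('C(b, m))%:R).
Proof.
move=> i iN; rewrite coef_poly iN exprDn coef_sum.
under eq_bigr => j _ do rewrite expr1n mul1r coefMn coefXn.
case: (leqP i b) => ib.
  rewrite -ltnS in ib; rewrite (bigD1 (Ordinal ib)) //= eqxx big1 ?addr0 // => j ji.
  by rewrite eq_sym -val_eqE /= in ji *; rewrite (negbTE ji) mul0rn.
rewrite bin_small // big1 // => j _; rewrite gtn_eqF ?mul0rn //.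
by apply: leq_ltn_trans ib; rewrite -ltnS.
Qed.

Section MultiTruncated.
Variables (n N : nat).
Implicit Types P Q S U y : {mpoly rat[n]}.

Definition meq P Q := forall m : 'X_{1..n}, (mdeg m < N)%N -> P@_m = Q@_m.

Lemma meq_sym P Q : meq P Q -> meq Q P.
Proof. by move=> h m mN; rewrite h. Qed.
Lemma meq_trans Q P S : meq P Q -> meq Q S -> meq P S.
Proof. by move=> h1 h2 m mN; rewrite h1 ?h2. Qed.

Lemma meqM P Q S U : meq P Q -> meq S U -> meq (P * S) (Q * U).
Proof.
move=> h1 h2 m mN; rewrite !mcoeffM; apply: eq_bigr => -[m1 m2] /= /eqP /(congr1 mdeg).
by rewrite mdegD => E; rewrite h1 ?h2 //; lia.
Qed.

Lemma meq_prod (I : Type) (l : seq I) (C : pred I) (F G : I -> {mpoly rat[n]}) :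
  (forall i, C i -> meq (F i) (G i)) -> meq (\prod_(i <- l | C i) F i) (\prod_(i <- l | C i) G i).
Proof. by move=> h; elim/big_ind2: _ => // *; apply: meqM. Qed.

Definition no_const y := y@_0%MM = 0.

Lemma no_const_pow y k m : no_const y -> (mdeg m < k)%N -> (y ^+ k)@_m = 0.
Proof.
move=> y0; elim: k m => // k IH m mk; rewrite exprS mcoeffM big1 // => -[m1 m2] /= /eqP /(congr1 mdeg).
rewrite mdegD => E.
case: (eqVneq (bmnm m1) 0%MM) => [->|m10]; first by rewrite y0 mul0r.
rewrite IH ?mulr0 //.
by rewrite -mdeg_eq0 in m10; lia.
Qed.

(** Without constant term, [y ^+ N] has no monomial of degree below [N], so multiples of [x^N]
    become invisible. *)
Lemma horner_alg_meq y (p q : {poly rat}) : no_const y -> peq N p q ->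
  meq (horner_alg y p) (horner_alg y q).
Proof.
move=> y0 pq m mN; apply/eqP; rewrite -subr_eq0 -mcoeffB -rmorphB /=.
rewrite -(poly_take_drop N (p - q)) rmorphD rmorphM rmorphXn /= horner_algX.
have -> : take_poly N (p - q) = 0.
  by apply/polyP => i; rewrite coef_take_poly coef0; case: ifP => // iN; rewrite coefB pq ?subrr.
rewrite rmorph0 add0r mcoeffM big1 // => -[m1 m2] /= /eqP E.
by rewrite no_const_pow ?mulr0 //; move: (congr1 mdeg E); rewrite mdegD; lia.
Qed.

Lemma horner_alg_sum y K (c : nat -> rat) :
  horner_alg y (\poly_(m < K) c m) = \sum_(m < K) c m *: y ^+ m.
Proof.
rewrite poly_def rmorph_sum; apply: eq_bigr => i _.
by rewrite -mul_polyC rmorphM rmorphXn /= horner_algC horner_algX mulr_algl.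
Qed.

(* [Fk k] is [1 + pbar_k] and [pb k] is [pbar_k], in [n] variables. *)
Definition Fk k : {mpoly rat[n]} := \prod_(i < n) (1 + 'X_i ^+ k).
Definition pb k : {mpoly rat[n]} := Fk k - 1.
Definition mon (J : {set 'I_n}) k : 'X_{1..n} := (\sum_(i in J) U_(i) *+ k)%MM.

Lemma monE J k i : mon J k i = ((i \in J) * k)%N.
Proof.
rewrite /mon mnm_sumE; case: (boolP (i \in J)) => iJ; last first.
  by rewrite big1 // => j jJ; rewrite mulmnE mnmE; case: eqP jJ iJ => [->->|].
rewrite (bigD1 i) //= big1 => [|j /andP[_ /negbTE ji]]; rewrite mulmnE mnmE ?ji //.
by rewrite eqxx addn0.
Qed.

Lemma pbE k : pb k = \sum_(J : {set 'I_n} | J != set0) 'X_[mon J k].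
Proof.
have E (J : {set 'I_n}) : \prod_(i < n) (if i \in J then 'X_i ^+ k else 1) = 'X_[mon J k] :> {mpoly rat[n]}.
  by rewrite -big_mkcond /= (mprodXnE _ (fun i => U_(i)%MM) (fun i => i \in J) (fun=> k)).
rewrite /pb /Fk; under eq_bigr => i _ do rewrite addrC.
rewrite (bigA_distr 1 +%R) (bigD1 set0) //= E.
have -> : mon set0 k = 0%MM by apply/mnmP => i; rewrite monE inE mnm0E.
by rewrite mpolyX0 addrC addKr; apply: eq_bigr.
Qed.

Lemma pb_no_const k : (0 < k)%N -> no_const (pb k).
Proof.
move=> k0; rewrite /no_const pbE raddf_sum /= big1 // => J /set0Pn[i iJ].
rewrite mcoeffX; case: eqP => // /mnmP/(_ i); rewrite monE iJ mul1n mnm0E => E.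
by rewrite E in k0.
Qed.

Lemma X_no_const i : no_const 'X_i.
Proof. by rewrite /no_const mcoeffX; case: eqP => // /mnmP/(_ i); rewrite mnmE eqxx mnm0E. Qed.

Lemma mcoeff_pb_prod (mu : seq nat) (m : 'X_{1..n}) :
  (\prod_(k <- mu) pb k)@_m = (#|[set S : {ffun 'I_(size mu) -> {set 'I_n}} |
     [forall j, S j != set0] &&
     [forall i : 'I_n, (\sum_(j < size mu | i \in S j) nth 0 mu j)%N == m i]]|)%:R.
Proof.
rewrite (big_nth 0%N) big_mkord; under eq_bigr => j _ do rewrite pbE.
rewrite (bigA_distr_big _ (fun (j : 'I_(size mu)) J => 'X_[mon J (nth 0%N mu j)])) /= raddf_sum /=.
rewrite (eq_bigr (fun f : {ffun 'I_(size mu) -> {set 'I_n}} =>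
   ((\sum_(j < size mu) mon (f j) (nth 0%N mu j))%MM == m)%:R)) => [|f _]; last first.
  have -> : \prod_(j < size mu) 'X_[mon (f j) (nth 0%N mu j)] =
     'X_[(\sum_(j < size mu) mon (f j) (nth 0%N mu j))%MM] :> {mpoly rat[n]}.
    by rewrite mprodXE.
  by rewrite mcoeffX.
rewrite -natr_sum -big_mkcondr /= sum1_card; congr (_%:R); apply: eq_card => f; rewrite !inE.
congr andb.
apply/eqP/forallP => [<- i|h].
  rewrite mnm_sumE [X in _ == X](eq_bigr _ (fun j _ => monE _ _ _)) big_mkcond; apply/eqP.
  by apply: eq_bigr => j _; case: (i \in f j); rewrite ?mul1n ?mul0n.
apply/mnmP => i; rewrite -(eqP (h i)) mnm_sumE [LHS](eq_bigr _ (fun j _ => monE _ _ _)) [RHS]big_mkcond.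
by apply: eq_bigr => j _; case: (i \in f j); rewrite ?mul1n ?mul0n.
Qed.

End MultiTruncated.

Lemma count_leq_sumn k mu : (0 < k)%N -> (k * count_mem k mu <= sumn mu)%N.
Proof.
move=> k0; elim: mu => [|x mu IH] /=; first by rewrite muln0.
by rewrite mulnDr leq_add //; case: eqP => [->|_]; rewrite ?muln1 ?muln0.
Qed.

Lemma pbar_coef_eq0 mu a : (sumn a < sumn mu)%N -> pbar_coef mu a = 0%N.
Proof.
move=> lt; apply/eqP; rewrite cards_eq0; apply/eqP/setP => S; rewrite !inE.
apply/negbTE/negP => /andP[/forallP S0 /forallP h]; move: lt; apply/negP; rewrite -leqNgt.
rewrite !sumnE (big_nth 0%N) [X in (_ <= X)%N](big_nth 0%N) !big_mkord.
rewrite (eq_bigr (fun i : 'I_(size a) => \sum_(j < size mu | i \in S j) nth 0%N mu j)%N); last first.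
  by move=> i _; rewrite (eqP (h i)).
rewrite (exchange_big_dep predT) //=; apply: leq_sum => j _.
by have /set0Pn[i iS] := S0 j; rewrite (bigD1 i) //= leq_addr.
Qed.

(** * Partitions as multiplicity functions *)

Section Parts.
Variable D : nat.
Implicit Types f : {ffun 'I_D -> 'I_D.+1}.

(** [f k] is the multiplicity of the part [k + 1]. The list [parts] also contains partitions of more
    than [D]; they do no harm, as [pbar_coef] vanishes on them in degree [D]. *)
Definition part f : seq nat := sort geq (flatten [seq nseq (f k) k.+1 | k : 'I_D]).
Definition parts : seq (seq nat) := [seq part f | f : {ffun 'I_D -> 'I_D.+1}].

Lemma count_part f (p : pred nat) : count p (part f) = (\sum_(k < D) p k.+1 * f k)%N.
Proof.
rewrite /part (permP (permEl (perm_sort _ _))) count_flatten -map_comp sumnE big_map big_enum /=.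
by apply: eq_bigr => k _; rewrite count_nseq.
Qed.

Lemma count_mem_part f (k : 'I_D) : count_mem k.+1 (part f) = f k.
Proof.
rewrite count_part (bigD1 k) //= eqxx mul1n big1 ?addn0 // => j jk.
by rewrite eqSS [_ == _ :> nat](negbTE jk) mul0n.
Qed.

Lemma part_inj : injective part.
Proof.
by move=> f g E; apply/ffunP => k; apply: val_inj; rewrite /= -!count_mem_part E.
Qed.

Lemma uniq_parts : uniq parts.
Proof. by rewrite map_inj_uniq ?enum_uniq //; exact: part_inj. Qed.

Lemma part_is_partition f : is_partition (part f).
Proof.
rewrite /is_partition sort_sorted => [|x y]; last by rewrite /geq /= leq_total.
rewrite all_count -[X in _ == X]count_predT !count_part; apply/eqP.
by apply: eq_bigr.
Qed.

Lemma partition_eq mu nu : is_partition mu -> is_partition nu -> perm_eq mu nu -> mu = nu.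
Proof.
move=> /andP[smu _] /andP[snu _] h; apply: (sorted_eq (leT := geq)) => //.
  by move=> x y z xy yz; exact: leq_trans yz xy.
by move=> x y; rewrite andbC -eqn_leq => /eqP.
Qed.

Lemma mem_parts mu : is_partition mu -> (sumn mu <= D)%N -> mu \in parts.
Proof.
move=> pmu le; pose f : {ffun 'I_D -> 'I_D.+1} := [ffun k : 'I_D => inord (count_mem k.+1 mu)].
have fE (k : 'I_D) : f k = count_mem k.+1 mu :> nat.
  rewrite ffunE inordK // ltnS; apply: leq_trans le.
  by apply: leq_trans (count_leq_sumn mu (ltn0Sn k)); rewrite leq_pmull.
apply/mapP; exists f; first by rewrite mem_enum.
apply: partition_eq => //; first exact: part_is_partition.
apply/allP => x _; apply/eqP; case: x => [|x] /=.
  rewrite count_part big1 // ; apply/count_memPn/negP => m0.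
  by move: pmu => /andP[_ /allP/(_ _ m0)].
case: (ltnP x D) => xD; first by have := count_mem_part f (Ordinal xD); rewrite fE /= => ->.
rewrite count_part big1 => [|k _]; last first.
  by rewrite /= eqSS ltn_eqF // (leq_trans _ xD).
have := count_leq_sumn mu (ltn0Sn x); case: (count_mem _ mu) => // c.
rewrite mulnS => h; have := leq_trans (leq_trans (leq_addr _ _) h) le.
by rewrite ltnNge xD.
Qed.

Lemma big_part (R : comNzRingType) (F : nat -> R) f :
  \prod_(k <- part f) F k = \prod_(k < D) F k.+1 ^+ f k.
Proof.
rewrite /part (perm_big _ (permEl (perm_sort _ _))) /= big_flatten big_map big_enum /=.
by apply: eq_bigr => k _; rewrite big_nseq iter_mulr_1.
Qed.

End Parts.

(** * Expansion of the product over the variables *)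

Section Expansion.
Variable L : nat -> nat.

(** The coefficient of [pbar_k ^ m] in [(1 + pbar_k) ^ L k] for odd [k], and in
    [(1 + pbar_k) ^ (- dyadic L k)] for even [k]. *)
Definition fac k m : rat := if odd k then ('C(L k, m))%:R
  else (-1) ^+ m * (multichoose (dyadic L k) m)%:R.

Lemma fac0 k : fac k 0 = 1.
Proof. by rewrite /fac /multichoose !bin0 mulr1; case: odd. Qed.

Definition kcoef (mu : seq nat) : rat := \prod_(1 <= k < (sumn mu).+1) fac k (count_mem k mu).

Lemma kcoef_widen mu D : (sumn mu <= D)%N ->
  kcoef mu = \prod_(1 <= k < D.+1) fac k (count_mem k mu).
Proof.
move=> le; rewrite [RHS](big_cat_nat (n := (sumn mu).+1)) //= [X in _ * X]big1_seq ?mulr1 //.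
move=> k /andP[_]; rewrite mem_index_iota => /andP[lt _].
have k0 : (0 < k)%N by apply: leq_trans lt.
have := count_leq_sumn mu k0; case: (count_mem _ mu) => [|c]; first by rewrite fac0.
by rewrite mulnS => h; have := leq_trans (leq_addr _ _) h; rewrite leqNgt lt.
Qed.

Variables (T : finType) (e : rel T).
Variable n : nat.

Lemma coef_indep_prod N (m : 'X_{1..n}) : (mdeg m < N)%N ->
  (\prod_(i < n) horner_alg ('X_i : {mpoly rat[n]}) (Ipoly e N))@_m =
  \prod_(i < n) (nind e (m i))%:R.
Proof.
move=> mN; have miN (i : 'I_n) : (m i < N)%N.
  by apply: leq_ltn_trans mN; rewrite mdegE (bigD1 i) //= leq_addr.
under eq_bigr => i _ do rewrite /Ipoly horner_alg_sum.
rewrite (bigA_distr_bigA (fun i (j : 'I_N) => (nind e j)%:R *: ('X_i : {mpoly rat[n]}) ^+ j)) /=.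
rewrite raddf_sum /= (bigD1 [ffun i => Ordinal (miN i)]) //= [X in _ + X]big1 ?addr0 => [|f fm]; last first.
  rewrite scaler_prod mprodXnE mcoeffZ mcoeffX; case: eqP => [E|]; last by rewrite mulr0.
  case/eqP: fm; apply/ffunP => i; apply: val_inj; rewrite ffunE /= -E mnm_sumE (bigD1 i) //=.
  rewrite mulmnE mnmE eqxx mul1n big1 ?addn0 // => j ji.
  by rewrite mulmnE mnmE (negbTE ji).
rewrite scaler_prod mprodXnE mcoeffZ mcoeffX; case: eqP => [_|[]].
  by rewrite mulr1; apply: eq_bigr => i _; rewrite ffunE.
apply/mnmP => i; rewrite mnm_sumE (bigD1 i) //= ffunE /=.
rewrite mulmnE mnmE eqxx mul1n big1 ?addn0 // => j ji.
by rewrite mulmnE mnmE (negbTE ji).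
Qed.

Lemma multivariate_identity N :
  peq N (Ipoly e N * \prod_(1 <= k < N | ~~ odd k) (1 + 'X^k) ^+ dyadic L k)
    (\prod_(1 <= k < N | odd k) (1 + 'X^k) ^+ L k) ->
  meq N (\prod_(i < n) horner_alg ('X_i : {mpoly rat[n]}) (Ipoly e N))
   (\prod_(1 <= k < N) \sum_(m < N) fac k m *: pb n k ^+ m).
Proof.
move=> U; set P := \prod_(i < n) _.
have EF (C : pred nat) (b : nat -> nat) :
  \prod_(i < n) horner_alg ('X_i : {mpoly rat[n]}) (\prod_(1 <= k < N | C k) (1 + 'X^k) ^+ b k) =
  \prod_(1 <= k < N | C k) Fk n k ^+ b k.
  rewrite (eq_bigr (fun i => \prod_(1 <= k < N | C k) (1 + 'X_i ^+ k) ^+ b k)) => [|i _].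
    by rewrite exchange_big /=; apply: eq_bigr => k _; rewrite -prodrXl.
  rewrite rmorph_prod; apply: eq_bigr => k _.
  by rewrite rmorphXn rmorphD rmorph1 rmorphXn /= horner_algX.
(* Substituting each variable for [x] and multiplying turns [1 + x^k] into [Fk k], that is,
   [1 + pbar_k]. *)
have H1 : meq N (P * \prod_(1 <= k < N | ~~ odd k) Fk n k ^+ dyadic L k)
    (\prod_(1 <= k < N | odd k) Fk n k ^+ L k).
  rewrite -!EF -big_split /=; apply: meq_prod => i _; rewrite -rmorphM.
  by apply: horner_alg_meq => //; exact: X_no_const.
pose G k := \sum_(m < N) fac k m *: pb n k ^+ m.
have FE k b : Fk n k ^+ b = horner_alg (pb n k) ((1 + 'X) ^+ b).
  by rewrite rmorphXn rmorphD rmorph1 /= horner_algX /pb addrC subrK.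
have GE k : G k = horner_alg (pb n k) (\poly_(m < N) fac k m) by rewrite horner_alg_sum.
have H2 : meq N (\prod_(1 <= k < N | ~~ odd k) Fk n k ^+ dyadic L k *
    \prod_(1 <= k < N | ~~ odd k) G k) 1.
  rewrite -big_split /=; apply: (@meq_trans _ _ (\prod_(1 <= k < N | ~~ odd k) 1)); last by rewrite big1.
  rewrite big_seq_cond [X in meq _ _ X]big_seq_cond; apply: meq_prod => k /andP[].
  rewrite mem_index_iota => /andP[k0 _] ko; rewrite GE FE -rmorphM.
  apply: (@meq_trans _ _ (horner_alg (pb n k) 1)); last by rewrite rmorph1.
  apply: horner_alg_meq; first exact: pb_no_const.
  rewrite /fac (negbTE ko); exact: peq_pascal.
(* The truncated inverse series is brought in by inserting the product that [H2] equates with 1. *)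
apply: (@meq_trans _ _ (P * (\prod_(1 <= k < N | ~~ odd k) Fk n k ^+ dyadic L k *
    \prod_(1 <= k < N | ~~ odd k) G k))).
  by rewrite -{1}[P]mulr1; apply: meqM => //; exact: meq_sym.
rewrite mulrA [X in meq _ _ X](bigID odd) /=; apply: meqM => //; apply: (meq_trans H1).
rewrite big_seq_cond [X in meq _ _ X]big_seq_cond; apply: meq_prod => k /andP[].
rewrite mem_index_iota => /andP[k0 _] ko; rewrite -/(G k) GE FE.
apply: horner_alg_meq; first exact: pb_no_const.
rewrite /fac ko; exact: peq_binomial.
Qed.

End Expansion.

Lemma indep_expansion (T : finType) (e : rel T) (r : T -> nat) (a : seq nat) :
  symmetric e -> irreflexive e -> injective r ->
  \sum_(mu <- parts (sumn a)) kcoef (fun k => #|lyndon_set e r k|) mu * (pbar_coef mu a)%:R =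
  \prod_(i < size a) (nind e (nth 0%N a i))%:R.
Proof.
move=> e_sym e_irr r_inj; set D := sumn a; set L := (X in kcoef X).
pose m : 'X_{1..size a} := [multinom nth 0%N a i | i < size a].
have mD : mdeg m = D.
  by rewrite mdegE /D sumnE (big_nth 0%N) big_mkord; apply: eq_bigr => i _; rewrite mnmE.
have mN : (mdeg m < D.+1)%N by rewrite mD.
have := multivariate_identity (n := size a) (univariate_identity (N := D.+1) e_sym e_irr r_inj) mN.
rewrite coef_indep_prod // => E.
under [RHS]eq_bigr => i _ do rewrite -[nth 0%N a i](mnmE (fun i : 'I_(size a) => nth 0%N a i) i).
rewrite -/m E {E} big_add1 /= big_mkord.
rewrite (bigA_distr_bigA (fun (k : 'I_D) (j : 'I_D.+1) => fac L k.+1 j *: pb (size a) k.+1 ^+ j)) /=.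
rewrite raddf_sum /parts big_map big_enum /=; apply: eq_bigr => f _ /=.
rewrite scaler_prod mcoeffZ -(big_part (pb (size a))) mcoeff_pb_prod.
have -> : #|[set S : {ffun 'I_(size (part f)) -> {set 'I_(size a)}} |
     [forall j, S j != set0] &&
     [forall i : 'I_(size a), (\sum_(j < size (part f) | i \in S j) nth 0 (part f) j)%N == m i]]| =
   pbar_coef (part f) a.
  apply: eq_card => S; rewrite !inE; congr andb; apply: eq_forallb => i; by rewrite mnmE.
(* Above degree [D] both terms vanish; below, the range of [kcoef] can be widened to that of the
   product. *)
case: (leqP (sumn (part f)) D) => le; last by rewrite pbar_coef_eq0 ?mulr0.
rewrite (kcoef_widen _ le) big_add1 /= big_mkord; congr (_ * _).
by apply: eq_bigr => k _; rewrite count_mem_part.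
Qed.

(** * Uniqueness of the expansion *)

Lemma partition_nth_gt0 mu j : is_partition mu -> (j < size mu)%N -> (0 < nth 0%N mu j)%N.
Proof. by move=> /andP[_ /allP h] jm; apply: h; rewrite mem_nth. Qed.

Lemma size_leq_sumn mu : is_partition mu -> (size mu <= sumn mu)%N.
Proof.
case/andP=> _; elim: mu => //= x mu IH /andP[x0 /IH h]; lia.
Qed.

Lemma sumn_ord mu : sumn mu = (\sum_(j < size mu) nth 0 mu j)%N.
Proof. by rewrite sumnE (big_nth 0%N) big_mkord. Qed.

Lemma pbar_coef_self mu : (0 < pbar_coef mu mu)%N.
Proof.
rewrite card_gt0; apply/set0Pn; exists [ffun j => [set j]]; rewrite inE; apply/andP; split.
  by apply/forallP => j; rewrite ffunE; apply/set0Pn; exists j; rewrite inE.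
apply/forallP => i; rewrite (bigD1 i) /=; last by rewrite ffunE inE.
by rewrite big1 ?addn0 // => j /andP[]; rewrite ffunE inE => /eqP->; rewrite eqxx.
Qed.

(* In top degree all the sets [S_j] are singletons, so [nu] is a refinement of [mu]. *)
Lemma pbar_coef_top nu mu : is_partition nu -> is_partition mu ->
  (0 < pbar_coef nu mu)%N -> sumn nu = sumn mu ->
  (size mu <= size nu)%N /\ (size mu = size nu -> nu = mu).
Proof.
move=> pnu pmu; rewrite card_gt0 => /set0Pn[S]; rewrite inE => /andP[/forallP S0 /forallP hS] E.
have pos (j : 'I_(size nu)) : (0 < nth 0 nu j)%N by apply: partition_nth_gt0.
(* Adding up the exponents of all variables counts each part [nu_j] once per element of [S j];
   equality of degrees then forces singletons. *)
have tot : (\sum_(j < size nu) nth 0 nu j * #|S j| = \sum_(j < size nu) nth 0 nu j)%N.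
  rewrite -(sumn_ord nu) E sumn_ord.
  rewrite [RHS](eq_bigr (fun i : 'I_(size mu) => \sum_(j < size nu | i \in S j) nth 0 nu j)%N).
    rewrite (exchange_big_dep predT) //=; apply: eq_bigr => j _.
    by rewrite sum_nat_const mulnC.
  by move=> i _; rewrite (eqP (hS i)).
have S1 j : #|S j| = 1%N.
  apply/eqP; rewrite eqn_leq card_gt0 S0 andbT leqNgt; apply/negP => lt.
  have : (\sum_(j < size nu) nth 0 nu j < \sum_(j < size nu) nth 0 nu j * #|S j|)%N.
    rewrite (bigD1 j) //= [X in (_ < X)%N](bigD1 j) //= -addSn leq_add //.
      by rewrite -[X in (X < _)%N]muln1 ltn_pmul2l.
    by apply: leq_sum => i _; rewrite leq_pmulr // card_gt0.
  by rewrite tot ltnn.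
have gex j : exists i, S j == [set i].
  by have /eqP/cards1P[i ->] := S1 j; exists i.
pose g j := xchoose (gex j).
have gS j : S j = [set g j] by apply/eqP/(xchooseP (gex j)).
have hg (i : 'I_(size mu)) : (\sum_(j < size nu | g j == i) nth 0 nu j)%N = nth 0%N mu i.
  by rewrite -(eqP (hS i)); apply: eq_bigl => j; rewrite gS inE eq_sym.
have gsurj i : exists j, g j = i.
  case: (pickP (fun j => g j == i)) => [j /eqP|none]; first by exists j.
  have := hg i; rewrite big_pred0 // => m0.
  by have := partition_nth_gt0 pmu (ltn_ord i); rewrite -m0.
have im : g @: [set: 'I_(size nu)] = [set: 'I_(size mu)].
  by apply/setP => i; rewrite inE; apply/imsetP; have [j <-] := gsurj i; exists j.
have le : (size mu <= size nu)%N.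
  by rewrite -{1}(card_ord (size mu)) -cardsT -im -[X in (_ <= X)%N]card_ord -cardsT leq_imset_card.
split=> // Es.
have ginj : injective g.
  have /imset_injP h : #|g @: [set: 'I_(size nu)]| == #|[set: 'I_(size nu)]|.
    by rewrite im !cardsT !card_ord Es.
  by move=> i j; apply: h; rewrite inE.
have gE (j : 'I_(size nu)) : nth 0%N nu j = nth 0%N mu (g j).
  rewrite -hg (bigD1 j) //= big1 ?addn0 // => i /andP[/eqP/ginj-> ].
  by rewrite eqxx.
apply: partition_eq => //.
have -> : nu = [seq nth 0%N mu (g j) | j : 'I_(size nu)].
  rewrite -[LHS](mkseq_nth 0%N) /mkseq -val_enum_ord -map_comp.
  by apply: eq_map => j /=; rewrite gE.
have -> : [seq nth 0%N mu (g j) | j : 'I_(size nu)] = map (fun i : 'I_(size mu) => nth 0%N mu i) (map g (enum 'I_(size nu))).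
  by rewrite -map_comp.
have -> : perm_eq (map (fun i : 'I_(size mu) => nth 0%N mu i) (map g (enum 'I_(size nu)))) mu =
  perm_eq (map (fun i : 'I_(size mu) => nth 0%N mu i) (map g (enum 'I_(size nu))))
    (map (fun i : 'I_(size mu) => nth 0%N mu i) (enum 'I_(size mu))).
  congr perm_eq; rewrite -[LHS](mkseq_nth 0%N) /mkseq -val_enum_ord -map_comp.
  by apply: eq_map.
apply: perm_map; apply: uniq_perm; [by rewrite (map_inj_uniq ginj) enum_uniq|exact: enum_uniq|move=> i].
rewrite mem_enum inE; apply/mapP; have [j <-] := gsurj i.
by exists j; rewrite ?mem_enum.
Qed.

(** Triangularity: the coefficient of [x^mu] involves, besides [mu], only partitions of smaller
    size, or of the same size with more parts. Hence induction on the size, then on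
    [n - size mu]. *)
Lemma pbar_expansion_uniq (T : finType) (e : rel T) (c c' : seq nat -> rat) :
  pbar_expansion e c -> pbar_expansion e c' -> forall mu, is_partition mu -> c mu = c' mu.
Proof.
move=> hc hc' mu; move: {2}(sumn mu) (erefl (sumn mu)) => n.
elim/ltn_ind: n mu => n IHn mu; move: {2}(n - size mu)%N (erefl (n - size mu)%N) => l.
elim/ltn_ind: l mu => l IHl mu El En pmu.
have [F [uF pF zF sF]] := hc mu; have [F' [uF' pF' zF' sF']] := hc' mu.
(* Each expansion comes with its own finite support; both sums are rewritten over the union. *)
pose G := undup (F ++ F').
have pG : all is_partition G.
  by apply/allP => nu; rewrite mem_undup mem_cat => /orP[/(allP pF)|/(allP pF')].
have big_sub (f : seq nat -> rat) K : uniq K -> {subset K <= G} ->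
    (forall nu, is_partition nu -> nu \notin K -> f nu = 0) ->
    \sum_(nu <- K) f nu = \sum_(nu <- G) f nu.
  move=> uK sK zK; rewrite [RHS](bigID (mem K)) /= [X in _ + X]big1_seq ?addr0.
    rewrite -[RHS]big_filter; apply: perm_big; apply: uniq_perm => //.
      by rewrite filter_uniq ?undup_uniq.
    by move=> nu; rewrite mem_filter; apply/idP/andP => [h|[]//]; split=> //; exact: sK.
  by move=> nu /andP[nK nG]; apply: zK => //; exact: (allP pG).
rewrite (big_sub _ F) // in sF; last by move=> nu h; rewrite mem_undup mem_cat h.
rewrite (big_sub _ F') // in sF'; last by move=> nu h; rewrite mem_undup mem_cat h orbT.
have : \sum_(nu <- G) (c nu - c' nu) * (pbar_coef nu mu)%:R = 0.
  under eq_bigr => nu _ do rewrite mulrBl.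
  by rewrite sumrB sF sF' subrr.
have p0 : ((pbar_coef mu mu)%:R : rat) != 0 by rewrite pnatr_eq0 -lt0n pbar_coef_self.
case: (boolP (mu \in G)) => mG; last first.
  move=> _; apply: (mulIf p0); move: mG; rewrite mem_undup mem_cat negb_or => /andP[h h'].
  by rewrite zF // zF'.
rewrite (bigD1_seq mu) ?undup_uniq //= big1_seq ?addr0 => [|nu /andP[nm /(allP pG) pnu]].
  by move/eqP; rewrite mulf_eq0 (negbTE p0) orbF subr_eq0 => /eqP.
case: (posnP (pbar_coef nu mu)) => [->|pos]; first by rewrite mulr0.
rewrite (_ : c nu = c' nu) ?subrr ?mul0r //.
have le : (sumn nu <= n)%N by rewrite -En leqNgt; apply: contraL pos => /pbar_coef_eq0->.
move: le; rewrite leq_eqVlt => /orP[/eqP E|lt]; last exact: (IHn _ lt nu).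
have [le h] := pbar_coef_top pnu pmu pos (etrans E (esym En)).
have lt : (size mu < size nu)%N.
  by rewrite ltn_neqAle le andbT; apply: contraNneq nm => /h->.
apply: (IHl (n - size nu)%N) => //; rewrite -El; have := size_leq_sumn pnu; rewrite E => h2.
by apply: ltn_sub2l => //; exact: leq_trans lt h2.
Qed.

(** * The Kromatic symmetric function *)

Section Kromatic.
Variables (T : finType) (e : rel T).
Hypotheses (e_sym : symmetric e) (e_irr : irreflexive e).

Definition ind (W : {set T}) : rel {x : T | x \in W} := fun x y => e (val x) (val y).

Lemma ind_sym W : symmetric (@ind W).
Proof. by move=> x y; apply: e_sym. Qed.

Lemma ind_irr W : irreflexive (@ind W).
Proof. by move=> x; apply: e_irr. Qed.

Lemma nind_ind (W : {set T}) k :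
  nind (@ind W) k = #|[set S : {set T} | [&& indep e S, #|S| == k & S \subset W]]|.
Proof.
rewrite /nind -(card_imset _ (imset_inj (@val_inj _ _ {x : T | x \in W}))).
apply: eq_card => S; rewrite inE; apply/imsetP/and3P => [[S' ]|[/indepP iS cS SW]].
  rewrite inE => /andP[/indepP iS cS] ->; split.
  - by apply/indepP => _ _ /imsetP[x xS ->] /imsetP[y yS ->]; exact: iS.
  - by rewrite card_imset //; exact: val_inj.
  - by apply/subsetP => _ /imsetP[x xS ->]; exact: (valP x).
have E : S = val @: [set x : {x : T | x \in W} | val x \in S].
  apply/setP => x; apply/idP/imsetP => [xS|[y]]; last by rewrite inE => ? ->.
  by exists (Sub x (subsetP SW x xS)); rewrite ?inE SubK.
exists [set x : {x : T | x \in W} | val x \in S] => //.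
rewrite inE -(card_imset _ val_inj) -E cS andbT.
by apply/indepP => x y; rewrite !inE; exact: iS.
Qed.

(** Transposition of a coloring: properness and the exponents become conditions on each color class
    separately. *)
Definition color_classes n (kap : {ffun T -> {set 'I_n}}) : {ffun 'I_n -> {set T}} :=
  [ffun i => [set v | i \in kap v]].

Lemma color_classes_bij n : bijective (@color_classes n).
Proof.
exists (fun g : {ffun 'I_n -> {set T}} => [ffun v => [set i | v \in g i]]) => f;
  by apply/ffunP => x; apply/setP => y; rewrite !ffunE inE ffunE inE.
Qed.

(** Colors choose independent sets of prescribed sizes freely, except that the sets must cover all
    vertices because every vertex receives a color. The sieve removes this coupling, and the sum
    over choices factors over colors. *)
Lemma kromatic_sieve a : (kromatic_coef e a)%:R =
  \sum_(W : {set T}) (-1) ^+ #|~: W| * \prod_(i < size a) (nind (@ind W) (nth 0%N a i))%:R :> rat.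
Proof.
pose Q (i : 'I_(size a)) := [pred S : {set T} | indep e S & #|S| == nth 0%N a i].
have -> : kromatic_coef e a = #|[set g : {ffun 'I_(size a) -> {set T}} |
    (g \in family Q) && (\bigcup_i g i == setT)]|.
  rewrite -(on_card_preimset (f := @color_classes (size a))); last exact/onW_bij/color_classes_bij.
  apply: eq_card => kap; rewrite !inE andbC; congr andb; last first.
    apply/forallP/eqP => [h|/setP h v].
      apply/setP => v; rewrite inE; have /set0Pn[i iv] := h v.
      by apply/bigcupP; exists i => //; rewrite ffunE inE.
    have := h v; rewrite inE => /bigcupP[i _]; rewrite ffunE inE => iv.
    by apply/set0Pn; exists i.
  apply/andP/familyP => [[h1 h2] i|h].
    rewrite inE ffunE; have /eqP -> := forallP h2 i.
    rewrite eqxx andbT; apply/indepP => v w; rewrite !inE => iv iw; apply/negP => vw.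
    have /forallP/(_ w)/implyP/(_ vw) := forallP h1 v.
    by rewrite disjoints_subset => /subsetP/(_ i iv); rewrite inE iw.
  split; last by apply/forallP => i; have := h i; rewrite inE ffunE => /andP[].
  apply/forallP => v; apply/forallP => w; apply/implyP => vw.
  rewrite disjoints_subset; apply/subsetP => i iv; rewrite inE; apply/negP => iw.
  have := h i; rewrite inE ffunE => /andP[/indepP/(_ v w)].
  by rewrite !inE vw => /(_ iv iw).
have E (W : {set T}) : \prod_(i < size a) (nind (@ind W) (nth 0%N a i))%:R =
    \sum_(g in family Q) (\bigcup_i g i \subset W)%:R :> rat.
  transitivity (\prod_(i < size a) \sum_(S | S \in Q i) (S \subset W)%:R : rat).
    apply: eq_bigr => i _; rewrite nind_ind -sum1_card natr_sum big_mkcond [RHS]big_mkcond.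
    apply: eq_bigr => S _; rewrite !inE andbA; case: (indep e S && _) => //=.
    by case: (S \subset W).
  rewrite bigA_distr_big_dep; apply: eq_bigr => g _.
  case: (boolP (\bigcup_i g i \subset W)) => h.
    by rewrite big1 // => i _; rewrite (bigcupsP h).
  have [i iW] : exists i, ~~ (g i \subset W).
    apply/existsP; rewrite -negb_forall; apply: contra h => /forallP h.
    by apply/bigcupsP => i _; exact: h.
  by rewrite (bigD1 i) //= (negbTE iW) mul0r.
under [RHS]eq_bigr => W _ do rewrite E mulr_sumr.
rewrite exchange_big /= -sum1_card natr_sum.
under [RHS]eq_bigr => g _ do rewrite (sum_sign_supset _ (\bigcup_i g i)).
rewrite big_mkcond [RHS]big_mkcond; apply: eq_bigr => g _; rewrite inE.
by case: (g \in family Q) => //=; case: (_ == _).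
Qed.

Variables (r : T -> nat).
Hypothesis r_inj : injective r.

Definition kromatic_pcoef (mu : seq nat) : rat :=
  \sum_(W : {set T}) (-1) ^+ #|~: W| * kcoef (induced_lyndon_num e r W) mu.

Lemma kromatic_pbar_expansion : pbar_expansion e kromatic_pcoef.
Proof.
move=> a; exists (parts (sumn a)); split.
- exact: uniq_parts.
- by apply/allP => _ /mapP[f _ ->]; exact: part_is_partition.
- move=> mu pmu nmu; rewrite pbar_coef_eq0 ?mulr0 // ltnNge.
  by apply: contra nmu; exact: mem_parts.
rewrite kromatic_sieve; under eq_bigr => mu _ do rewrite mulr_suml.
rewrite exchange_big /=; apply: eq_bigr => W _.
rewrite -(@indep_expansion _ (@ind W) (fun x => r (val x))) ?mulr_sumr //.
- by apply: eq_bigr => mu _; rewrite mulrA.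
- exact: ind_sym.
- exact: ind_irr.
- by move=> x y /r_inj /val_inj.
Qed.

(** The exponent is the sum of the parts each lowered by 1, so its parity is that of the number of
    even parts. *)
Lemma partition_sign mu : is_partition mu ->
  (-1) ^+ (sumn mu - size mu) = (-1) ^+ count (fun k => ~~ odd k) mu :> rat.
Proof.
move=> /andP[_]; elim: mu => //= x mu IH /andP[x0 pm].
have le : (size mu <= sumn mu)%N.
  by elim: mu pm {IH} => //= y mu IH /andP[y0 /IH h]; lia.
have -> : (x + sumn mu - (size mu).+1 = x.-1 + (sumn mu - size mu))%N by lia.
rewrite exprD IH // exprD; congr (_ * _).
by rewrite -signr_odd; case: x x0 => // x _ /=; rewrite negbK; case: odd.
Qed.

Lemma count_even_parts mu : is_partition mu ->
  (\sum_(1 <= k < (sumn mu).+1 | ~~ odd k) count_mem k mu = count (fun k => ~~ odd k) mu)%N.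
Proof.
move=> pmu; have h x : x \in mu -> (0 < x <= sumn mu)%N.
  move=> xm; have /andP[_ /allP/(_ x xm) x0] := pmu; rewrite x0.
  by apply: leq_trans (count_leq_sumn mu x0); rewrite leq_pmulr // -has_count has_pred1.
elim: mu {pmu} (sumn mu) h => [|x mu IH] N h; first by rewrite big1.
rewrite /= big_split /= IH => [|y ym]; last by apply: h; rewrite inE ym orbT.
congr addn; have /andP[x0 xN] := h x (mem_head _ _); rewrite big_mkcond.
rewrite (bigD1_seq x) ?iota_uniq ?mem_index_iota ?x0 //= eqxx big1 => [|y yx].
  by rewrite addn0; case: odd.
by rewrite eq_sym (negbTE yx); case: odd.
Qed.

Lemma kromatic_pcoef_formula mu : is_partition mu ->
  (-1) ^+ (sumn mu - size mu) * kromatic_pcoef mu = kromatic_formula e r mu.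
Proof.
move=> pmu; rewrite /kromatic_formula mulr_sumr; apply: eq_bigr => W _.
rewrite mulrCA; congr (_ * _); rewrite /kcoef (bigID odd) /= mulrCA; congr (_ * _).
  by apply: eq_bigr => k ko; rewrite /fac ko.
rewrite partition_sign // -count_even_parts //.
rewrite (eq_bigr (fun k => (-1) ^+ count_mem k mu *
   (multichoose (dyadic (induced_lyndon_num e r W) k) (count_mem k mu))%:R)).
  rewrite big_split /= prodrXr mulrA -expr2 sqrr_sign mul1r; exact: eq_bigr.
by move=> k ko; rewrite /fac (negbTE ko).
Qed.

End Kromatic.

(** * Lyndon heaps on induced subgraphs *)

Section Induced.
Local Open Scope nat_scope.
Variables (T : finType) (e : rel T) (r : T -> nat).
Hypotheses (e_sym : symmetric e) (r_inj : injective r).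
Variable W : {set T}.
Local Notation TW := {x : T | x \in W}.
Local Notation eW := (@ind T e W).
Local Notation rW := (fun x : TW => r (val x)).
Local Notation inc := (map (val : TW -> T)).
Implicit Types s t : seq TW.

Lemma incP (u : seq T) : {subset u <= W} -> exists s, u = inc s.
Proof.
elim: u => [|a u IH] h; first by exists [::].
have aW : a \in W by apply: h; rewrite mem_head.
have [s ->] : exists s, u = inc s by apply: IH => b bu; apply: h; rewrite inE bu orbT.
by exists (exist _ a aW :: s).
Qed.

Lemma inc_sub s : {subset inc s <= W}.
Proof. by move=> _ /mapP[x _ ->]; exact: (valP x). Qed.

Lemma inc_inj : injective inc.
Proof. exact: (inj_map val_inj). Qed.

Lemma inc_wpow s m : inc (wpow s m) = wpow (inc s) m.
Proof. by elim: m => // m IH; rewrite !wpowS map_cat IH. Qed.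

Lemma dep_ind (a b : TW) : dep eW a b = dep e (val a) (val b).
Proof. by rewrite /dep val_eqE. Qed.

Lemma prj_inc (a b : TW) s : prj (val a) (val b) (inc s) = inc (prj a b s).
Proof.
by rewrite /prj filter_map; congr map; apply: eq_filter => x /=; rewrite !val_eqE.
Qed.

Lemma heq_inc s t : heq e (inc s) (inc t) = heq eW s t.
Proof.
apply/heqP/heqP => h a b.
  by rewrite dep_ind => /h; rewrite !prj_inc => /inc_inj.
(* A letter outside [W] never occurs, so a pair containing it projects as the other letter alone. *)
have single c u : c \notin W -> forall d, prj c d (inc u) = prj d d (inc u).
  move=> cW d; apply: eq_in_filter => x /inc_sub xW /=; rewrite orbb.
  by case: eqP => // xc; rewrite -xc xW in cW.
have diag c : prj c c (inc s) = prj c c (inc t).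
  case: (boolP (c \in W)) => cW; last first.
    by rewrite /prj !(eq_in_filter (a2 := pred0)) ?filter_pred0 // => x /inc_sub xW /=;
      rewrite orbb; apply/eqP => xc; rewrite -xc xW in cW.
  have -> : c = val (exist _ c cW : TW) by [].
  by rewrite !prj_inc h // dep_refl.
case: (boolP (a \in W)) => aW; last by move=> _; rewrite !single ?diag.
case: (boolP (b \in W)) => bW; last by move=> _; rewrite ![prj a b _]prjC !single ?diag.
have -> : a = val (exist _ a aW : TW) by [].
have -> : b = val (exist _ b bW : TW) by [].
by rewrite -dep_ind => /h; rewrite !prj_inc => ->.
Qed.

Lemma lexle_inc s t : lexle r (inc s) (inc t) = lexle rW s t.
Proof. by elim: s t => [|a s IH] [|b t] //=; rewrite IH val_eqE. Qed.

Lemma heq_incP s (u : seq T) : heq e (inc s) u -> exists2 t, u = inc t & heq eW s t.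
Proof.
move=> h; have [|t Et] := @incP u.
  by move=> a; rewrite -(heq_mem h) => /inc_sub.
by exists t => //; rewrite -heq_inc -Et.
Qed.

Lemma standard_inc s : standard e r (inc s) = standard eW rW s.
Proof.
apply/(standardP e_sym)/(standardP (ind_sym e_sym (W := W))) => h t.
  by rewrite -heq_inc => /h; rewrite lexle_inc.
by move=> /heq_incP[t' -> /h]; rewrite lexle_inc.
Qed.

Lemma ismin_inc (a : TW) s : ismin e (val a) (inc s) = ismin eW a s.
Proof.
rewrite /ismin mem_map; last exact: val_inj.
rewrite index_map; last exact: val_inj.
by rewrite -map_take has_map.
Qed.

Lemma pyr_inc (a : TW) s : pyr e (val a) (inc s) = pyr eW a s.
Proof.
apply/pyrP/pyrP; rewrite ismin_inc => -[h1 h2]; split=> // b.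
  by rewrite -ismin_inc => /h2/val_inj.
move=> hb; have bW : b \in W by case/andP: hb => /inc_sub.
by move: hb; rewrite -[b]/(val (exist _ b bW : TW)) ismin_inc => /h2->.
Qed.

Lemma ex_pyr_inc s : (exists a, pyr e a (inc s)) <-> (exists a, pyr eW a s).
Proof.
split=> -[a h]; last by exists (val a); rewrite pyr_inc.
have aW : a \in W by exact: inc_sub (pyr_mem h).
by exists (exist _ a aW); rewrite -pyr_inc.
Qed.

Lemma per_inc s : per e (inc s) <-> per eW s.
Proof.
split=> -[K [m [m1 h]]]; last first.
  by exists (inc K), m; split=> //; rewrite -inc_wpow heq_inc.
have [|K' EK] := @incP K.
  move=> a aK; apply: (@inc_sub s); rewrite (heq_mem h) mem_wpowE //; exact: ltnW.
by exists K', m; split=> //; rewrite -heq_inc inc_wpow -EK.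
Qed.

Lemma ex_cj_inc s t : (exists U, cj e (inc s) (inc t) U) <-> (exists U, cj eW s t U).
Proof.
split=> -[U [h sU]]; last first.
  exists (inc U); split; first by rewrite -!map_cat heq_inc.
  by move=> _ /mapP[x xU ->]; apply: map_f; exact: sU.
have [|U' EU] := @incP U; first by move=> a /sU /inc_sub.
exists U'; split; first by rewrite -heq_inc !map_cat -EU.
move=> x xU; have : val x \in inc s by apply: sU; rewrite EU map_f.
by rewrite mem_map //; exact: val_inj.
Qed.

(** Equivalent and conjugate words use the same letters, so no competitor of [inc s] in its class
    leaves [W]. *)
Lemma lyndon_word_inc s : lyndon_word e r (inc s) <-> lyndon_word eW rW s.
Proof.
split=> -[st py np lex]; split.
- by rewrite -standard_inc.
- exact/ex_pyr_inc.
- by move/per_inc.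
- move=> Q sQ pQ hQ; rewrite -lexle_inc; apply: lex; rewrite ?standard_inc //.
    exact/ex_pyr_inc.
  exact/ex_cj_inc.
- by rewrite standard_inc.
- exact/ex_pyr_inc.
- by move/per_inc.
move=> Q sQ pQ [U hU]; have [|Q' EQ] := @incP Q.
  by move=> a; rewrite -(cj_mem hU) => /inc_sub.
rewrite EQ in sQ pQ hU *; rewrite lexle_inc; apply: lex.
- by rewrite -standard_inc.
- exact/ex_pyr_inc.
by apply/ex_cj_inc; exists U.
Qed.

(** Lyndon heaps of all induced subgraphs are placed among those of the whole graph, so that one
    type of families serves every [W]. *)
Lemma induced_lyndon_numE k :
  induced_lyndon_num e r W k = #|[set w in lyndon_set e r k | all (mem W) w]|.
Proof.
have inj : injective (fun w : k.-tuple TW => [tuple of inc w] : k.-tuple T).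
  by move=> u v /(congr1 val) /= /inc_inj /val_inj.
rewrite /induced_lyndon_num -(card_imset _ inj); apply: eq_card => w; rewrite inE.
apply/imsetP/andP => [[u hu ->]|[hw /allP wW]].
  split; last by apply/allP => x /inc_sub.
  apply/(lyndon_setP e_sym)/lyndon_word_inc.
  by move: hu => /(lyndon_setP (ind_sym e_sym (W := W))).
have [s Es] := incP wW.
have sz : size s == k by rewrite -(size_tuple w) Es size_map.
exists (Tuple sz); last by apply: val_inj.
apply/(lyndon_setP (ind_sym e_sym (W := W)))/lyndon_word_inc.
by rewrite /= -Es; apply/(lyndon_setP e_sym).
Qed.

End Induced.

(** * Sets and multisets counted through multiplicity functions *)

Section CountFunctions.
Variables (X : finType) (l : nat).

(** Expanding the product chooses a multiplicity at each [x], and the degree of the term is their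
    sum. *)
Lemma card_sum_ffun (Q : X -> pred nat) m :
  (#|[set f : {ffun X -> 'I_l.+1} | (\sum_x f x == m)%N && [forall x, Q x (f x)]]|)%:R =
  (\prod_x \sum_(i < l.+1 | Q x i) 'X^i)`_m :> rat.
Proof.
rewrite bigA_distr_big_dep /= coef_sum -sum1_card natr_sum.
rewrite big_mkcond [RHS]big_mkcond; apply: eq_bigr => f _; rewrite inE.
have -> : (f \in family (fun x (i : 'I_l.+1) => Q x i)) = [forall x, Q x (f x)].
  by apply/familyP/forallP.
case: ifP => [/andP[/eqP <- ->]|].
  by rewrite -(big_morph _ (fun i j => exprD 'X i j) (expr0 'X)) coefXn eqxx.
move=> nm; case: ifP => // q; move: nm; rewrite q andbT => nm.
by rewrite -(big_morph _ (fun i j => exprD 'X i j) (expr0 'X)) coefXn eq_sym nm.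
Qed.

Lemma prod_support (A : {set X}) (c : pred nat) : c 0%N ->
  \prod_x \sum_(i < l.+1 | (0 < i)%N ==> (x \in A) && c i) 'X^i =
  (\sum_(i < l.+1 | c i) 'X^i) ^+ #|A| :> {poly rat}.
Proof.
move=> c0; rewrite (bigID (mem A)) /= [X in _ * X]big1 ?mulr1.
  rewrite -prodr_const; apply: eq_bigr => x xA; apply: eq_bigl => i.
  by rewrite xA; case: (posnP i) => [->|].
move=> x xA; rewrite (bigD1 ord0) //= big1 ?addr0 ?expr0 // => i /andP[+ i0].
by rewrite (negbTE xA) lt0n -[i == 0 :> nat]/(i == ord0) i0.
Qed.

Lemma multichoose_sum b m : (\sum_(i < m.+1) multichoose b i = multichoose b.+1 m)%N.
Proof.
elim: m => [|m IH]; first by rewrite big_ord_recl big_ord0 /multichoose !bin0.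
rewrite big_ord_recr /= IH /multichoose.
have -> : (b.+1 + m - 1 = b + m)%N by lia.
have -> : (b + m.+1 - 1 = b + m)%N by lia.
have -> : (b.+1 + m.+1 - 1 = (b + m).+1)%N by lia.
by rewrite binS addnC.
Qed.

(** Up to degree [l] the base is the geometric series; the induction on [b] is the summation rule
    [multichoose_sum]. *)
Lemma coef_geom_exp b m : (m <= l)%N ->
  ((\sum_(i < l.+1) 'X^i) ^+ b : {poly rat})`_m = (multichoose b m)%:R.
Proof.
have cS j : (j <= l)%N -> (\sum_(i < l.+1) 'X^i : {poly rat})`_j = 1.
  move=> jl; rewrite coef_sum (bigD1 (Ordinal (jl : (j < l.+1)%N))) //= coefXn eqxx big1 ?addr0 //.
  by move=> i ij; rewrite coefXn eq_sym -val_eqE /= in ij *; rewrite (negbTE ij).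
elim: b m => [|b IH] m ml.
  by rewrite expr0 coef1 /multichoose; case: m ml => // m _; rewrite add0n subn1 bin_small.
rewrite exprS coefM -multichoose_sum natr_sum (reindex_inj rev_ord_inj) /=.
apply: eq_bigr => j _; have jm : (j <= m)%N by rewrite -ltnS.
rewrite subSS subKn // cS ?mul1r ?IH //; first exact: leq_trans ml.
by apply: leq_trans (leq_subr _ _) ml.
Qed.

Lemma card_multisets (A : {set X}) m : (m <= l)%N ->
  #|[set f : {ffun X -> 'I_l.+1} | (\sum_x f x == m)%N && [forall x, (0 < f x)%N ==> (x \in A)]]|
  = multichoose #|A| m.
Proof.
move=> ml; apply/eqP; rewrite -(eqr_nat rat) (card_sum_ffun (fun x i => (0 < i)%N ==> (x \in A))).
rewrite -coef_geom_exp //.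
have := @prod_support A predT isT; under eq_bigr => x _ do under eq_bigl => i do rewrite andbT.
by move=> ->.
Qed.

Lemma card_subsets (A : {set X}) m : (m <= l)%N ->
  #|[set f : {ffun X -> 'I_l.+1} |
     (\sum_x f x == m)%N && [forall x, (0 < f x)%N ==> (x \in A) && (f x <= 1)%N]]|
  = 'C(#|A|, m).
Proof.
move=> ml; apply/eqP; rewrite -(eqr_nat rat).
rewrite (card_sum_ffun (fun x i => (0 < i)%N ==> (x \in A) && (i <= 1)%N)).
rewrite (@prod_support A (fun i => (i <= 1)%N)) //.
(* Equality holds only up to degree [l]: for [l = 0] the bound on multiplicities cuts off the term
   ['X]. *)
have h : peq l.+1 (\sum_(i < l.+1 | (i <= 1)%N) 'X^i) (1 + 'X).
  move=> i il; rewrite coefD coef1 coefX coef_sum big_mkcond (bigD1 (Ordinal il)) //=.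
  rewrite coefXn eqxx big1 => [|j ji]; last first.
    by case: ifP => // _; rewrite coefXn eq_sym -val_eqE /= in ji *; rewrite (negbTE ji).
  by case: i il => [|[|i]] _ /=; rewrite ?addr0 ?add0r.
by rewrite (peqX #|A| h) // (@peq_binomial l.+1 #|A|) // coef_poly ltnS ml.
Qed.

End CountFunctions.

(** * Families of Lyndon heaps *)

Section Families.
Local Open Scope nat_scope.
Variables (T : finType) (e : rel T) (r : T -> nat) (lam : seq nat).
Hypotheses (e_sym : symmetric e) (r_inj : injective r) (plam : is_partition lam).
Local Notation N := (sumn lam).
Local Notation l := (size lam).
Local Notation X := {h : 'I_N.+1 & h.-tuple T}.
Local Notation LW W k := (induced_lyndon_num e r W k).
Implicit Types (x : X) (W : {set T}) (f : {ffun X -> 'I_l.+1}).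

Definition size_ok (k h : nat) :=
  if odd k then h == k else [exists j : 'I_k.+1, (h * 2 ^ j == k) && ~~ odd h].

Definition avail W k : {set X} :=
  [set x : X | [&& size_ok k (tag x), tagged x \in lyndon_set e r (tag x) & all (mem W) (tagged x)]].

Lemma card_avail W k : #|avail W k| = \sum_(h < N.+1 | size_ok k h) LW W h.
Proof.
rewrite -sum1_card; under [RHS]eq_bigr => h _ do rewrite (induced_lyndon_numE _ e_sym) -sum1_card.
rewrite sig_big_dep /=; apply: eq_bigl => x.
by rewrite !inE.
Qed.

Lemma card_avail_odd W k : k <= N -> odd k -> #|avail W k| = LW W k.
Proof.
move=> kN ko; rewrite card_avail (bigD1 (Ordinal (kN : k < N.+1))) /=; last first.
  by rewrite /size_ok ko.
rewrite big1 ?addn0 // => h /andP[]; rewrite /size_ok ko => /eqP E.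
by rewrite -val_eqE /= E eqxx.
Qed.

(** The admissible sizes are the quotients [k / 2^j], and distinct [j] give distinct quotients as
    [k] is positive. *)
Lemma card_avail_even W k : 0 < k <= N -> ~~ odd k -> #|avail W k| = dyadic (induced_lyndon_num e r W) k.
Proof.
move=> /andP[k0 kN] ko; rewrite card_avail /dyadic.
rewrite -(big_mkord (size_ok k) (induced_lyndon_num e r W)) -big_filter -[RHS]big_filter.
have P : perm_eq [seq h <- index_iota 0 N.+1 | size_ok k h]
    [seq k %/ 2 ^ j | j <- [seq j <- index_iota 0 k | 2 ^ j.+1 %| k]].
  have p0 j : 0 < 2 ^ j by rewrite expn_gt0.
  have quo j : 2 ^ j.+1 %| k -> k = k %/ 2 ^ j * 2 ^ j.
    by move=> h; rewrite divnK //; apply: dvdn_trans h; rewrite expnS dvdn_mull.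
  apply: uniq_perm; rewrite ?filter_uniq ?iota_uniq //.
    rewrite map_inj_in_uniq ?filter_uniq ?iota_uniq // => i j.
    rewrite !mem_filter => /andP[/quo hi _] /andP[/quo hj _] E.
    have d0 : 0 < k %/ 2 ^ j by move: k0; rewrite {1}hj; case: (_ %/ _).
    move: hi; rewrite E {1}hj => /eqP; rewrite eqn_pmul2l // eqn_exp2l // => /eqP ->.
    by [].
  move=> h; rewrite mem_filter mem_index_iota /= /size_ok (negbTE ko).
  apply/andP/mapP => [[/existsP[[j jk] /= /andP[/eqP Ek ho]] _]|[j]].
    have dv : 2 ^ j.+1 %| k by rewrite -Ek expnS dvdn_pmul2r // dvdn2.
    exists j; last by rewrite -Ek mulnK.
    rewrite mem_filter mem_index_iota dv /=.
    have := dvdn_leq k0 dv; have := ltn_expl j.+1 (isT : 1 < 2); lia.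
  rewrite mem_filter mem_index_iota => /andP[dv jk] ->; split; last first.
    by rewrite ltnS (leq_trans (leq_div _ _) kN).
  have jk' : j < k.+1 by rewrite ltnS ltnW.
  apply/existsP; exists (Ordinal jk'); rewrite /= -quo // eqxx /=.
  by rewrite -dvdn2 -(dvdn_pmul2r (p0 j)) -quo // -expnS.
by rewrite (perm_big _ P) big_map.
Qed.

Definition admissible (k : 'I_N.+1) : pred {ffun X -> 'I_l.+1} := fun f =>
  (\sum_(x : X) (f x : nat) == count_mem (k : nat) lam) &&
  [forall x : X, (0 < f x) ==>
     [&& (tagged x \in lyndon_set e r (tag x)),
        odd k ==> ((tag x == k :> nat) && (f x <= 1)) &
        ~~ odd k ==> [exists j : 'I_k.+1, ((tag x * 2 ^ j) == k) && ~~ odd (tag x)]]].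

Definition inside W : pred {ffun X -> 'I_l.+1} := fun f =>
  [forall x : X, (0 < f x) ==> all (mem W) (tagged x)].

Definition used (F : {ffun 'I_N.+1 -> {ffun X -> 'I_l.+1}}) :=
  [set v : T | [exists k : 'I_N.+1, exists x : X, (0 < F k x) && (v \in (tagged x : seq T))]].

Lemma admissibleE W (k : 'I_N.+1) f : admissible k f && inside W f =
  (\sum_(x : X) f x == count_mem (k : nat) lam) &&
  [forall x, (0 < f x) ==> (x \in avail W k) && (odd k ==> (f x <= 1))].
Proof.
rewrite -andbA; congr andb; apply/andP/forallP => [[/forallP h1 /forallP h2] x|h].
  move: (h1 x) (h2 x); case: (0 < f x) => //= /and3P[hl ho he] hW.
  rewrite inE hl hW andbT /size_ok; case: ifP ho he => //= _; by [case/andP=> -> ->|move=> _ ->].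
split; apply/forallP => x; move: (h x); case: (0 < f x) => //=; rewrite inE /size_ok.
  by case: ifP => _ /andP[/and3P[-> -> _]] //= ->.
by case/andP=> /and3P[_ _ ->].
Qed.

Lemma card_admissible W (k : 'I_N.+1) :
  #|[set f | admissible k f && inside W f]| =
  if odd k then 'C(LW W k, count_mem (k : nat) lam)
  else if k == 0 :> nat then 1
  else multichoose (dyadic (induced_lyndon_num e r W) k) (count_mem (k : nat) lam).
Proof.
have kN : k <= N by rewrite -ltnS.
have cl : count_mem (k : nat) lam <= l by exact: count_size.
case: ifP => ko.
  rewrite -(card_avail_odd _ kN ko) -(card_subsets _ cl); apply: eq_card => f.
  rewrite !inE admissibleE; congr andb; apply: eq_forallb => x.
  by rewrite ko.
have -> : #|[set f | admissible k f && inside W f]| = multichoose #|avail W k| (count_mem (k : nat) lam).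
  rewrite -(card_multisets _ cl); apply: eq_card => f.
  rewrite !inE admissibleE; congr andb; apply: eq_forallb => x.
  by rewrite ko andbT.
(* The index 0 is in the range of families but not in the formula; it contributes a factor 1, since
   a partition has no part 0. *)
case: eqP => [k0|/eqP k0]; last by rewrite card_avail_even ?ko // lt0n k0.
rewrite (_ : count_mem _ _ = 0) ?/multichoose ?bin0 //.
apply/count_memPn/negP => h; have /andP[_ /allP/(_ _ h)] := plam.
by rewrite k0.
Qed.

Local Open Scope ring_scope.

(** Conditions (i) and (ii) bear on each [M_k] separately; only covering the vertices couples them.
    Sieving over the set [W] containing all used vertices leaves a product over [k]. *)
Lemma family_count_formula : (family_count e r lam)%:R = kromatic_formula e r lam.
Proof.
have -> : family_count e r lam = #|[set F | (F \in family admissible) && (used F == setT)]|.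
  apply: eq_card => F; rewrite !inE; apply/and3P/andP => [[/forallP h1 /forallP h2 /forallP h3]|].
    split; first by apply/familyP => k; apply/andP; split; [exact: h1|exact: h2].
    by apply/eqP/setP => v; rewrite !inE; exact: h3.
  move=> [/familyP h /eqP/setP u]; split.
  - by apply/forallP => k; case/andP: (h k).
  - by apply/forallP => k; case/andP: (h k).
  - by apply/forallP => v; have := u v; rewrite !inE.
have E W : (\prod_(k < N.+1) #|[set f | admissible k f && inside W f]|)%:R =
    \sum_(F in family admissible) (used F \subset W)%:R :> rat.
  transitivity (\prod_(k < N.+1) \sum_(f | f \in admissible k) (inside W f)%:R : rat).
    rewrite natr_prod; apply: eq_bigr => k _; rewrite -sum1_card natr_sum big_mkcond [RHS]big_mkcond.
    apply: eq_bigr => f _; rewrite !inE -[f \in admissible k]/(admissible k f).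
    case: (admissible k f) => //=.
    by case: (inside W f).
  rewrite bigA_distr_big_dep; apply: eq_bigr => F _.
  have -> : (used F \subset W) = [forall k, inside W (F k)].
    apply/subsetP/forallP => [h k|h v].
      apply/forallP => x; apply/implyP => pos; apply/allP => v vx; apply: h.
      by rewrite inE; apply/existsP; exists k; apply/existsP; exists x; rewrite pos.
    rewrite inE => /existsP[k /existsP[x /andP[pos vx]]].
    by have /forallP/(_ x)/implyP/(_ pos)/allP := h k; apply.
  case: (boolP [forall k, inside W (F k)]) => [/forallP h|].
    by rewrite big1 // => k _; rewrite h.
  by rewrite negb_forall => /existsP[k hk]; rewrite (bigD1 k) //= (negbTE hk) mul0r.
rewrite -sum1_card natr_sum.
transitivity (\sum_(F in family admissible) \sum_W (-1) ^+ #|~: W| * (used F \subset W)%:R : rat).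
  rewrite big_mkcond [RHS]big_mkcond; apply: eq_bigr => F _; rewrite inE sum_sign_supset.
  by case: (F \in family admissible) => //=; case: (_ == _).
rewrite exchange_big /kromatic_formula; apply: eq_bigr => W _.
rewrite -mulr_sumr -E; congr (_ * _).
rewrite (eq_bigr _ (fun k _ => card_admissible W k)).
rewrite -(big_mkord predT (fun k => if odd k then 'C(LW W k, count_mem k lam)
  else if k == 0%N then 1%N
  else multichoose (dyadic (induced_lyndon_num e r W) k) (count_mem k lam))) /=.
rewrite big_ltn //= mul1n natr_prod (bigID odd) /=; congr (_ * _).
  by apply: eq_bigr => k ko; rewrite ko.
rewrite big_seq_cond [RHS]big_seq_cond; apply: eq_bigr => k /andP[].
rewrite mem_index_iota => /andP[k0 _] /negbTE ko.
by rewrite ko gtn_eqF.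
Qed.

End Families.

Theorem theorem1p2 (T : finType) (e : rel T) (r : T -> nat) (lam : seq nat) :
  symmetric e -> irreflexive e -> injective r -> is_partition lam ->
  (exists c : seq nat -> rat, pbar_expansion e c) /\
  (forall c : seq nat -> rat, pbar_expansion e c ->
     (-1) ^+ (sumn lam - size lam) * c lam = (family_count e r lam)%:R /\
     (-1) ^+ (sumn lam - size lam) * c lam = kromatic_formula e r lam).
Proof.
move=> e_sym e_irr r_inj plam.
have hc := kromatic_pbar_expansion e_sym e_irr r_inj.
split; first by exists (kromatic_pcoef e r).
move=> c /(fun h => pbar_expansion_uniq h hc plam) ->.
by rewrite (family_count_formula r e_sym plam) (kromatic_pcoef_formula e r plam).
Qed.
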